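(* Let $\alpha>0$ be real, let $k\in(0,1)$ be the modulus determined by $K(k')/K(k)=\alpha$ with $k'=\sqrt{1-k^2}$, and write $K=K(k)$, $E=E(k)$. Then $$\int_{0}^{\pi/2}\frac{\cos 2x\,\sin \frac{\ln (2 \cos x)}{\alpha}}{\cosh \frac{x}{\alpha}-\cos \frac{\ln (2 \cos x)}{\alpha}}\,dx=\frac{11\pi\alpha}{48}-\frac{\pi}{24\alpha}+\frac{\pi\alpha}{4\tanh (\pi\alpha)}-\frac{\alpha}{4\pi}\left(E-\frac{2-k^2}{3}K\right)K\qquad\text{if } \alpha>\frac{\ln 2}{2\pi},$$ and $$\int_{0}^{\pi/2}\frac{\cos 2x\,\sin \frac{\ln (2 \cos x)}{\alpha}}{\cosh \frac{x}{\alpha}+\cos \frac{\ln (2 \cos x)}{\alpha}}\,dx=\frac{\pi}{8\alpha}-\frac{\pi\alpha}{4\sinh (\pi\alpha)}+\frac{\alpha}{4\pi}\left(E-K\right)K\qquad\text{if } \alpha>\frac{\ln 2}{\pi}.$$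
   Context: For a modulus $k\in(0,1)$, the complementary modulus is $k'=\sqrt{1-k^2}$, and the complete elliptic integrals of the first and second kind with modulus $k$ are $K=K(k)=\int_0^{\pi/2}\frac{d\varphi}{\sqrt{1-k^2\sin^2\varphi}}$ and $E=E(k)=\int_0^{\pi/2}\sqrt{1-k^2\sin^2\varphi}\,d\varphi$; $K'=K(k')$. Given $\alpha>0$, the modulus $k$ is the one for which $\alpha=K'/K$, and $k',K,K',E$ are the corresponding quantities. *)

(* Defs.v *)
From Stdlib Require Import Reals.
From Coquelicot Require Import Coquelicot.
Open Scope R_scope.

(** The argument of [ellK] and [ellE] is the modulus [k], not the parameter
    [m = k ^ 2]; both are meant for [0 < k < 1], where the integrands are
    continuous. *)
Definition ellK (k : R) : R :=
  RInt (fun phi => 1 / sqrt (1 - k ^ 2 * sin phi ^ 2)) 0 (PI / 2).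

Definition ellE (k : R) : R :=
  RInt (fun phi => sqrt (1 - k ^ 2 * sin phi ^ 2)) 0 (PI / 2).

Definition compl_modulus (k : R) : R := sqrt (1 - k ^ 2).

(* Main.v *)
Require Import Defs.
From Stdlib Require Import Reals Lra Lia ZArith.
From Coquelicot Require Import Coquelicot.
Open Scope R_scope.

(** Up to an algebraic weight in [e^z], the first integrand is the real part of
    [cot (z / (2 alpha))] on the curve [z = ln (1 + e^(2 i x))], [0 <= x < PI / 2].
    The cotangent has period [2 PI alpha], so translating the curve by multiples of
    this period multiplies [e^z] in the weight by powers of [q = exp (- 2 PI alpha)].
    Each translation crosses one pole, at [0], and the translated integrals tend to
    [0]; up to elementary terms, the residues add up to the sum over [n] of
    [1 / (4 sinh (n h) ^ 2)] with [h = PI alpha].  The second integral follows from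
    the first at [alpha] and [alpha / 2], since [tan z = cot z - 2 cot (2 z)].

    These sums are evaluated through [D_h x], the sum of [sech (x + n h)] over all
    integers [n], with [M h = D_h 0] and [m h = D_h (h / 2)].  The product
    [D_h x * D_h (x + h / 2)] does not depend on [x]; this gives
    [M h = M (2 h) + m (2 h)] and [m h ^ 2 = 4 M (2 h) m (2 h)], which is Landen's
    transformation of the modulus [k = m h / M h].  The sums obey the matching
    recursion.  Iterating [h -> 2 h] and [h -> h / 2] to their limits yields
    [K = PI M / 2], [K' = h M / 2] and the sums in terms of [K] and [E]. *)

(** No residue theorem is invoked. The integral along the curve translated by [tau] is
    differentiated in [tau]; for a holomorphic integrand this derivative is an exact derivative
    along the curve, so only fluxes through the two ends remain. The starting point moves on the
    real axis from [ln 2] to [ln 2 - 2 PI alpha], and the condition on [alpha] says that it passes 0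
    and no other pole. That pole is removed beforehand by subtracting explicit functions of [e^z]
    with the same principal part, whose integrals are elementary. The remainder is real on the axis
    and bounded near 0, so nothing flows through the starting point. As the pole sits on the edge of
    the swept region, it counts with half its residue: [PI] appears, not [2 PI].

    At [x = PI / 2] the curve runs to infinity and the first integrand oscillates without a limit;
    hence all estimates are made up to some [X < PI / 2].

    On the elliptic side each closed form is an identity [c * f (2 h) = f h] together with a limit
    for large [h]. Only [K'] needs small [h], where [h] times a lattice sum of [sech] is a Riemann
    sum of its integral [PI]. *)

Ltac minmax H := rewrite Rmin_left, Rmax_right in H by lra.

(** * Limits of sequences and series of nonnegative terms *)

Lemma sin_cos_sqr (x : R) : sin x * sin x + cos x * cos x = 1.
Proof. exact (sin2_cos2 x). Qed.

Lemma lim_eq (u : nat -> R) (l l' : R) : is_lim_seq u l -> l = l' -> is_lim_seq u l'.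
Proof. intros H <-; exact H. Qed.

Lemma lim_scal0 (u : nat -> R) (c : R) : is_lim_seq u 0 -> is_lim_seq (fun n => c * u n) 0.
Proof.
  intros H; apply (lim_eq _ (c * 0)); [|ring].
  apply is_lim_seq_mult'; [apply is_lim_seq_const | exact H].
Qed.

Lemma lim_geom (q : R) : 0 < q < 1 -> is_lim_seq (fun n => q ^ n) 0.
Proof. intros H; apply is_lim_seq_geom; rewrite Rabs_pos_eq; lra. Qed.

Lemma lim_const_unique (u : nat -> R) (c l : R) :
  (forall n, u n = c) -> is_lim_seq u l -> c = l.
Proof.
  intros E L; apply (is_lim_seq_ext _ _ _ E), is_lim_seq_unique in L.
  rewrite Lim_seq_const in L; now injection L.
Qed.

Ltac lim := repeat first [eassumption | apply is_lim_seq_const | apply is_lim_seq_mult'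
  | apply is_lim_seq_minus' | apply is_lim_seq_plus'].

Lemma sum_n_nonneg (a : nat -> R) (N : nat) :
  (forall n, 0 <= a n) -> 0 <= sum_n a N.
Proof.
  intros Ha; induction N as [|N IH].
  - rewrite sum_O; apply Ha.
  - rewrite sum_Sn; unfold plus; simpl; specialize (Ha (S N)); lra.
Qed.

Lemma sum_n_le_Series (a : nat -> R) (N : nat) :
  (forall n, 0 <= a n) -> ex_series a -> sum_n a N <= Series a.
Proof.
  intros Ha Hex.
  apply (is_lim_seq_incr_compare (sum_n a)).
  - exact (Series_correct _ Hex).
  - intros n; rewrite sum_Sn; unfold plus; simpl; specialize (Ha (S n)); lra.
Qed.

Lemma term_le_Series (a : nat -> R) (n : nat) :
  (forall n, 0 <= a n) -> ex_series a -> a n <= Series a.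
Proof.
  intros Ha Hex; apply Rle_trans with (sum_n a n).
  - destruct n as [|n].
    + rewrite sum_O; lra.
    + rewrite sum_Sn; unfold plus; simpl.
      generalize (sum_n_nonneg a n Ha); lra.
  - now apply sum_n_le_Series.
Qed.

Lemma Series_nonneg (a : nat -> R) :
  (forall n, 0 <= a n) -> ex_series a -> 0 <= Series a.
Proof.
  intros Ha Hex; apply Rle_trans with (a 0%nat); auto using term_le_Series.
Qed.

Lemma ex_series_nonneg_le (a b : nat -> R) :
  (forall n, 0 <= a n <= b n) -> ex_series b -> ex_series a.
Proof.
  intros H Hb; apply (ex_series_le a b); auto.
  intros n; unfold norm; simpl; unfold abs; simpl.
  rewrite Rabs_pos_eq; apply H.
Qed.

Lemma ex_series_bounded (a : nat -> R) (B : R) :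
  (forall n, 0 <= a n) -> (forall N, sum_n a N <= B) ->
  ex_series a /\ Series a <= B.
Proof.
  intros Ha HB.
  assert (Hinc : forall n, sum_n a n <= sum_n a (S n)).
  { intros n; rewrite sum_Sn; unfold plus; simpl; specialize (Ha (S n)); lra. }
  destruct (ex_finite_lim_seq_incr (sum_n a) B Hinc HB) as [l Hl].
  assert (Hs : is_series a l) by exact Hl.
  split; [now exists l|].
  rewrite (is_series_unique _ _ Hs).
  apply (is_lim_seq_le (sum_n a) (fun _ => B) l B); auto.
  apply is_lim_seq_const.
Qed.

Lemma is_series_sum_n (a : nat -> nat -> R) (J : nat) :
  (forall j, ex_series (fun n => a n j)) ->
  is_series (fun n => sum_n (a n) J) (sum_n (fun j => Series (fun n => a n j)) J).
Proof.
  intros H; induction J as [|J IH].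
  - rewrite sum_O; apply is_series_ext with (fun n => a n 0%nat).
    + intros n; now rewrite sum_O.
    + now apply Series_correct.
  - rewrite sum_Sn.
    apply is_series_ext with (fun n => plus (sum_n (a n) J) (a n (S J))).
    + intros n; now rewrite sum_Sn.
    + apply @is_series_plus; auto; now apply Series_correct.
Qed.

(** Tonelli's theorem for series. A partial sum of column sums is a series of partial row sums,
    hence at most the total; the reverse inequality is the same argument with rows and columns
    exchanged. *)
Theorem Series_swap_nonneg (a : nat -> nat -> R) :
  (forall n j, 0 <= a n j) -> (forall n, ex_series (a n)) ->
  ex_series (fun n => Series (a n)) ->
  (forall j, ex_series (fun n => a n j)) /\
  is_series (fun j => Series (fun n => a n j)) (Series (fun n => Series (a n))).
Proof.
  intros Ha Hrow Htot.
  assert (Hcol : forall j, ex_series (fun n => a n j)).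
  { intros j; apply ex_series_nonneg_le with (fun n => Series (a n)); auto.
    intros n; split; [apply Ha | now apply term_le_Series]. }
  split; auto.
  assert (Hb : forall J, sum_n (fun j => Series (fun n => a n j)) J
                         <= Series (fun n => Series (a n))).
  { intros J.
    rewrite <- (is_series_unique _ _ (is_series_sum_n a J Hcol)).
    apply Series_le; auto.
    intros n; split; [now apply sum_n_nonneg | now apply sum_n_le_Series]. }
  assert (Hpos : forall j, 0 <= Series (fun n => a n j)).
  { intros j; apply Series_nonneg; auto. }
  destruct (ex_series_bounded _ _ Hpos Hb) as [Hex Hle].
  replace (Series (fun n => Series (a n)))
    with (Series (fun j => Series (fun n => a n j))).
  { now apply Series_correct. }
  apply Rle_antisym; auto.
  apply ex_series_bounded; [intros n; apply Series_nonneg; auto|].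
  intros N.
  apply Rle_trans with (Series (fun j => sum_n (fun n => a n j) N)).
  { right; symmetry; apply is_series_unique.
    exact (is_series_sum_n (fun j n => a n j) N Hrow). }
  apply Series_le; auto.
  intros j; split.
  - now apply sum_n_nonneg.
  - now apply (sum_n_le_Series (fun n => a n j)).
Qed.

Lemma sum_n_even_odd (a : nat -> R) (N : nat) :
  sum_n a (2 * N + 1) =
  sum_n (fun n => a (2 * n)%nat) N + sum_n (fun n => a (2 * n + 1)%nat) N.
Proof.
  induction N as [|N IH].
  - simpl; rewrite sum_Sn, !sum_O; reflexivity.
  - replace (2 * S N + 1)%nat with (S (S (2 * N + 1))) by lia.
    rewrite !sum_Sn, IH; unfold plus; simpl.
    replace (S (N + (N + 0) + 1)) with (N + S (N + 0) + 1)%nat by lia.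
    replace (N + S (N + 0) + 1)%nat with (S (N + S (N + 0)))%nat by lia; ring.
Qed.

Lemma ex_series_even_odd (a : nat -> R) :
  (forall n, 0 <= a n) -> ex_series a ->
  ex_series (fun n => a (2 * n)%nat) /\ ex_series (fun n => a (2 * n + 1)%nat).
Proof.
  intros Ha Hex.
  assert (H : forall N, sum_n a (2 * N + 1) <= Series a)
    by (intros N; now apply sum_n_le_Series).
  split; apply (ex_series_bounded _ (Series a)); auto; intros N;
    specialize (H N); rewrite sum_n_even_odd in H.
  - generalize (sum_n_nonneg (fun n => a (2 * n + 1)%nat) N (fun n => Ha _)); lra.
  - generalize (sum_n_nonneg (fun n => a (2 * n)%nat) N (fun n => Ha _)); lra.
Qed.

Lemma Series_even_odd (a : nat -> R) :
  (forall n, 0 <= a n) -> ex_series a ->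
  Series a = Series (fun n => a (2 * n)%nat) + Series (fun n => a (2 * n + 1)%nat).
Proof.
  intros Ha Hex.
  destruct (ex_series_even_odd a Ha Hex) as [He Ho].
  assert (L1 : is_lim_seq (fun N => sum_n a (2 * N + 1)) (Series a)).
  { apply (is_lim_seq_subseq (sum_n a) (Series a) (fun N => (2 * N + 1)%nat)).
    - apply eventually_subseq; intros n; lia.
    - exact (Series_correct _ Hex). }
  assert (L2 : is_lim_seq (fun N => sum_n a (2 * N + 1))
     (Series (fun n => a (2 * n)%nat) + Series (fun n => a (2 * n + 1)%nat))).
  { apply is_lim_seq_ext with (fun N => sum_n (fun n => a (2 * n)%nat) N
                                     + sum_n (fun n => a (2 * n + 1)%nat) N).
    - intros n; now rewrite sum_n_even_odd.
    - apply is_lim_seq_plus'; [exact (Series_correct _ He) | exact (Series_correct _ Ho)]. }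
  generalize (is_lim_seq_unique _ _ L1) (is_lim_seq_unique _ _ L2); congruence.
Qed.

Lemma is_series_telescoping (g : nat -> R) (l : R) :
  is_lim_seq g l -> is_series (fun n => g (S n) - g n) (l - g 0%nat).
Proof.
  intros Hg.
  change (is_lim_seq (sum_n (fun n => g (S n) - g n)) (l - g 0%nat)).
  apply is_lim_seq_ext with (fun n => g (S n) - g 0%nat).
  - intros n; induction n as [|n IH].
    + now rewrite sum_O.
    + rewrite sum_Sn, <- IH; unfold plus; simpl; ring.
  - apply is_lim_seq_minus'; [now apply is_lim_seq_incr_1 in Hg | apply is_lim_seq_const].
Qed.

(** At [x = exp (- 2 t)] the value is [1 / (4 sinh t ^ 2)]: this is how the squared cosecants are
    expanded in exponentials. *)
Lemma is_series_arith_geom (x : R) :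
  0 < x < 1 -> is_series (fun d => INR (S d) * x ^ S d) (x / (1 - x) ^ 2).
Proof.
  intros Hx.
  assert (Hex : ex_series (fun d => INR (S d) * x ^ S d)).
  { apply ex_series_Rabs.
    apply ex_series_DAlembert with x; [lra| |].
    - intros n; apply Rmult_integral_contrapositive_currified.
      + apply not_0_INR; lia.
      + apply pow_nonzero; lra.
    - apply is_lim_seq_ext with (fun n => x + x * / INR (S n)).
      + intros n.
        assert (0 < INR (S n)) by (apply lt_0_INR; lia).
        replace (INR (S (S n)) * x ^ S (S n) / (INR (S n) * x ^ S n))
          with (x + x * / INR (S n)).
        * rewrite Rabs_pos_eq; auto.
          generalize (Rinv_0_lt_compat _ H); intros.
          assert (0 <= x * / INR (S n)) by (apply Rmult_le_pos; lra); lra.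
        * rewrite (S_INR (S n)); simpl (x ^ S (S n)); simpl (x ^ S n).
          assert (x ^ n <> 0) by (apply pow_nonzero; lra).
          field; repeat split; auto; lra.
      + apply (lim_eq _ (x + 0)); [lim; apply lim_scal0 | ring].
        apply (is_lim_seq_incr_1 (fun n => / INR n)).
        replace (Finite 0) with (Rbar_inv p_infty) by reflexivity.
        apply is_lim_seq_inv; [apply is_lim_seq_INR | discriminate]. }
  assert (Hg : is_series (fun d => x ^ d) (/ (1 - x)))
    by (apply is_series_geom; rewrite Rabs_pos_eq; lra).
  set (s := Series (fun d => INR (S d) * x ^ S d)).
  assert (Hs : is_series (fun d => INR (S d) * x ^ S d) s) by now apply Series_correct.
  (* [s - x s = x + x^2 + ...] determines [s] *)
  assert (H1 : s = x + (x * s + x * (x * / (1 - x)))).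
  { unfold s at 1; rewrite Series_incr_1; auto.
    f_equal; [simpl; ring|].
    apply is_series_unique.
    apply is_series_ext with (fun d => plus (x * (INR (S d) * x ^ S d)) (x * (x * x ^ d))).
    - intros n; rewrite (S_INR (S n)); unfold plus; simpl (x ^ S _); simpl plus.
      change (x * (INR (S n) * (x * x ^ n)) + x * (x * x ^ n)
              = (INR (S n) + 1) * (x * (x * x ^ n))); ring.
    - apply @is_series_plus.
      + now apply (is_series_scal_l x (fun d => INR (S d) * x ^ S d)).
      + apply (is_series_scal_l x (fun d => x * x ^ d)).
        now apply (is_series_scal_l x (fun d => x ^ d)). }
  replace (x / (1 - x) ^ 2) with s; auto.
  apply Rmult_eq_reg_l with (1 - x); [|lra].
  replace ((1 - x) * s) with (x + x * (x * / (1 - x))) by lra.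
  field; lra.
Qed.

(** * Sums over the integers *)

Definition ex_zsum (f : Z -> R) : Prop :=
  ex_series (fun n => f (Z.of_nat n)) /\ ex_series (fun n => f (- Z.of_nat n - 1)%Z).

(** Negative integers are listed as [- n - 1], so that the reflection [i -> - i - 1] merely
    exchanges the two halves. *)
Definition zsum (f : Z -> R) : R :=
  Series (fun n => f (Z.of_nat n)) + Series (fun n => f (- Z.of_nat n - 1)%Z).

Lemma zsum_ext (f g : Z -> R) : (forall i, f i = g i) -> zsum f = zsum g.
Proof. intros H; unfold zsum; f_equal; apply Series_ext; auto. Qed.

Lemma ex_zsum_ext (f g : Z -> R) : (forall i, f i = g i) -> ex_zsum f -> ex_zsum g.
Proof.
  intros H [H1 H2]; split;
    [apply ex_series_ext with (2 := H1) | apply ex_series_ext with (2 := H2)]; auto.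
Qed.

Lemma ex_zsum_le (f g : Z -> R) :
  (forall i, 0 <= f i <= g i) -> ex_zsum g -> ex_zsum f.
Proof.
  intros H [H1 H2]; split; [apply ex_series_nonneg_le with (2 := H1)
    | apply ex_series_nonneg_le with (2 := H2)]; auto.
Qed.

Lemma ex_zsum_scal (c : R) (f : Z -> R) : ex_zsum f -> ex_zsum (fun i => c * f i).
Proof. intros [H1 H2]; split;
  [exact (ex_series_scal_l c _ H1) | exact (ex_series_scal_l c _ H2)]. Qed.

Lemma zsum_scal (c : R) (f : Z -> R) : zsum (fun i => c * f i) = c * zsum f.
Proof.
  unfold zsum; rewrite Rmult_plus_distr_l, <- !Series_scal_l; reflexivity.
Qed.

Lemma zsum_plus (f g : Z -> R) :
  ex_zsum f -> ex_zsum g -> zsum (fun i => f i + g i) = zsum f + zsum g.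
Proof.
  intros [H1 H2] [H3 H4]; unfold zsum; rewrite !Series_plus; auto; ring.
Qed.

Lemma zsum_pair (f : Z -> R) :
  ex_zsum f -> zsum f = Series (fun n => f (Z.of_nat n) + f (- Z.of_nat n - 1)%Z).
Proof. intros [H1 H2]; unfold zsum; rewrite Series_plus; auto. Qed.

Lemma ex_zsum_succ (f : Z -> R) : ex_zsum f -> ex_zsum (fun i => f (i + 1)%Z).
Proof.
  intros [H1 H2]; split.
  - apply ex_series_ext with (fun n => f (Z.of_nat (S n))).
    + intros n; f_equal; lia.
    + now apply (ex_series_incr_1 (fun n => f (Z.of_nat n))).
  - apply (ex_series_incr_1 (fun n => f (- Z.of_nat n - 1 + 1)%Z)).
    apply ex_series_ext with (2 := H2); intros n; f_equal; lia.
Qed.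

Lemma zsum_succ (f : Z -> R) : ex_zsum f -> zsum (fun i => f (i + 1)%Z) = zsum f.
Proof.
  intros Hf; destruct (ex_zsum_succ f Hf) as [_ H3]; destruct Hf as [H1 H2].
  unfold zsum; rewrite (Series_incr_1 _ H1), (Series_incr_1 _ H3).
  simpl (- Z.of_nat 0 - 1 + 1)%Z; simpl (Z.of_nat 0).
  rewrite (Series_ext (fun n => f (Z.of_nat n + 1)%Z) (fun n => f (Z.of_nat (S n))))
    by (intros n; f_equal; lia).
  rewrite (Series_ext (fun n => f (- Z.of_nat (S n) - 1 + 1)%Z)
                      (fun n => f (- Z.of_nat n - 1)%Z))
    by (intros n; f_equal; lia).
  ring.
Qed.

Lemma ex_zsum_opp (f : Z -> R) : ex_zsum f -> ex_zsum (fun i => f (- i - 1)%Z).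
Proof.
  intros [H1 H2]; split; auto.
  apply ex_series_ext with (2 := H1); intros n; f_equal; lia.
Qed.

Lemma zsum_opp (f : Z -> R) : zsum (fun i => f (- i - 1)%Z) = zsum f.
Proof.
  unfold zsum; rewrite Rplus_comm; f_equal; apply Series_ext; intros n; f_equal; lia.
Qed.

Lemma zsum_shift_nat (f : Z -> R) (n : nat) : ex_zsum f ->
  ex_zsum (fun i => f (i + Z.of_nat n)%Z) /\ zsum (fun i => f (i + Z.of_nat n)%Z) = zsum f.
Proof.
  intros Hf; induction n as [|n [IH1 IH2]].
  - split; [apply ex_zsum_ext with (2 := Hf) | apply zsum_ext]; intros i; f_equal; lia.
  - split.
    + apply ex_zsum_succ in IH1; apply ex_zsum_ext with (2 := IH1); intros i; f_equal; lia.
    + rewrite <- IH2, <- (zsum_succ _ IH1); apply zsum_ext; intros i; f_equal; lia.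
Qed.

Lemma zsum_shift (f : Z -> R) (j : Z) : ex_zsum f ->
  ex_zsum (fun i => f (i + j)%Z) /\ zsum (fun i => f (i + j)%Z) = zsum f.
Proof.
  intros Hf; destruct (Z_le_gt_dec 0 j) as [Hj|Hj].
  - rewrite <- (Z2Nat.id j Hj); now apply zsum_shift_nat.
  - destruct (zsum_shift_nat _ (Z.to_nat (- j)) (ex_zsum_opp _ Hf)) as [H1 H2].
    rewrite Z2Nat.id in H1, H2 by lia.
    split.
    + apply ex_zsum_opp in H1; apply ex_zsum_ext with (2 := H1); intros i; f_equal; lia.
    + rewrite <- (zsum_opp f), <- H2, <- (zsum_opp (fun i => f (i + j)%Z)).
      apply zsum_ext; intros i; f_equal; lia.
Qed.

Lemma zsum_even_odd (f : Z -> R) : (forall i, 0 <= f i) -> ex_zsum f ->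
  zsum f = zsum (fun i => f (2 * i)%Z) + zsum (fun i => f (2 * i + 1)%Z).
Proof.
  intros Hf [H1 H2]; unfold zsum.
  rewrite (Series_even_odd _ (fun n => Hf _) H1), (Series_even_odd _ (fun n => Hf _) H2).
  rewrite (Series_ext (fun n => f (Z.of_nat (2 * n))) (fun n => f (2 * Z.of_nat n)%Z))
    by (intros n; f_equal; lia).
  rewrite (Series_ext (fun n => f (Z.of_nat (2 * n + 1))) (fun n => f (2 * Z.of_nat n + 1)%Z))
    by (intros n; f_equal; lia).
  rewrite (Series_ext (fun n => f (- Z.of_nat (2 * n) - 1)%Z)
                      (fun n => f (2 * (- Z.of_nat n - 1) + 1)%Z))
    by (intros n; f_equal; lia).
  rewrite (Series_ext (fun n => f (- Z.of_nat (2 * n + 1) - 1)%Z)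
                      (fun n => f (2 * (- Z.of_nat n - 1))%Z))
    by (intros n; f_equal; lia).
  ring.
Qed.

(** The outer sum on the right stays a series over the pairs [j], [- j - 1]: in [sech_sum_mult] the
    terms depending on [x] cancel within each pair. *)
Lemma zsum_swap (a : Z -> Z -> R) :
  (forall i j, 0 <= a i j) -> (forall i, ex_zsum (a i)) -> ex_zsum (fun i => zsum (a i)) ->
  zsum (fun i => zsum (a i)) =
  Series (fun n => zsum (fun i => a i (Z.of_nat n)) + zsum (fun i => a i (- Z.of_nat n - 1)%Z))
  /\ (forall j, ex_zsum (fun i => a i j)).
Proof.
  intros Ha Hrow Htot.
  (* Folding the four quadrants gives one nonnegative double series over the naturals, the setting
     of [Series_swap_nonneg]. *)
  set (b := fun n m => (a (Z.of_nat n) (Z.of_nat m) + a (Z.of_nat n) (- Z.of_nat m - 1)%Z)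
     + (a (- Z.of_nat n - 1)%Z (Z.of_nat m) + a (- Z.of_nat n - 1)%Z (- Z.of_nat m - 1)%Z)).
  assert (Hcol : forall j, ex_zsum (fun i => a i j)).
  { intros j; apply ex_zsum_le with (2 := Htot); intros i; split; auto.
    destruct (Hrow i) as [R1 R2].
    assert (P1 : 0 <= Series (fun n => a i (Z.of_nat n))) by (apply Series_nonneg; auto).
    assert (P2 : 0 <= Series (fun n => a i (- Z.of_nat n - 1)%Z)) by (apply Series_nonneg; auto).
    unfold zsum.
    destruct (Z_le_gt_dec 0 j) as [Hj|Hj].
    - assert (Q := term_le_Series _ (Z.to_nat j) (fun n => Ha i _) R1).
      simpl in Q; rewrite Z2Nat.id in Q by lia; lra.
    - assert (Q := term_le_Series _ (Z.to_nat (- j - 1)) (fun n => Ha i _) R2).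
      simpl in Q; rewrite Z2Nat.id in Q by lia.
      replace (- (- j - 1) - 1)%Z with j in Q by lia; lra. }
  split; auto.
  assert (Hb1 : forall n, Series (b n) = zsum (a (Z.of_nat n)) + zsum (a (- Z.of_nat n - 1)%Z)).
  { intros n; unfold b.
    destruct (Hrow (Z.of_nat n)), (Hrow (- Z.of_nat n - 1)%Z).
    rewrite Series_plus by (now apply @ex_series_plus).
    now rewrite <- !zsum_pair by auto. }
  assert (Hb2 : forall m, Series (fun n => b n m) =
     zsum (fun i => a i (Z.of_nat m)) + zsum (fun i => a i (- Z.of_nat m - 1)%Z)).
  { intros m; unfold b, zsum.
    destruct (Hcol (Z.of_nat m)), (Hcol (- Z.of_nat m - 1)%Z).
    rewrite !Series_plus; auto; try now apply @ex_series_plus.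
    ring. }
  rewrite zsum_pair by auto.
  rewrite <- (Series_ext _ _ Hb1), <- (Series_ext _ _ Hb2).
  symmetry; apply is_series_unique.
  apply Series_swap_nonneg.
  - intros n m; unfold b; repeat apply Rplus_le_le_0_compat; auto.
  - intros n; unfold b; destruct (Hrow (Z.of_nat n)), (Hrow (- Z.of_nat n - 1)%Z).
    apply @ex_series_plus; now apply @ex_series_plus.
  - apply ex_series_ext with (fun n => zsum (a (Z.of_nat n)) + zsum (a (- Z.of_nat n - 1)%Z)).
    + intros n; now rewrite Hb1.
    + destruct Htot; now apply @ex_series_plus.
Qed.

(** * Lattice sums of the hyperbolic secant *)

Definition sech (x : R) : R := / cosh x.

Lemma cosh_ge_1 (x : R) : 1 <= cosh x.
Proof.
  unfold cosh; rewrite exp_Ropp.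
  assert (H := exp_pos x).
  assert (0 <= (exp x - 1) ^ 2 * / exp x)
    by (apply Rmult_le_pos; [apply pow2_ge_0 | left; now apply Rinv_0_lt_compat]).
  replace ((exp x - 1) ^ 2 * / exp x) with (exp x + / exp x - 2) in H0 by (field; lra).
  lra.
Qed.

Lemma sech_pos (x : R) : 0 < sech x.
Proof. apply Rinv_0_lt_compat; generalize (cosh_ge_1 x); lra. Qed.

Lemma cosh_opp (x : R) : cosh (- x) = cosh x.
Proof. unfold cosh; rewrite Ropp_involutive; lra. Qed.

Lemma sinh_opp (x : R) : sinh (- x) = - sinh x.
Proof. unfold sinh; rewrite Ropp_involutive; lra. Qed.

Lemma sech_opp (x : R) : sech (- x) = sech x.
Proof. unfold sech; now rewrite cosh_opp. Qed.

Lemma sech_le_exp (x : R) : sech x <= 2 * exp (- x).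
Proof.
  unfold sech, cosh; rewrite exp_Ropp.
  assert (H := exp_pos x).
  assert (H0 := Rinv_0_lt_compat _ H).
  apply Rmult_le_reg_l with ((exp x + / exp x) / 2); [lra|].
  rewrite Rinv_r by lra.
  replace ((exp x + / exp x) / 2 * (2 * / exp x)) with (1 + (/ exp x) ^ 2) by (field; lra).
  generalize (pow2_ge_0 (/ exp x)); lra.
Qed.

(** The addition formula for [sinh ((a + d) - a)], divided by the two hyperbolic cosines. For fixed
    [d] it makes a sum over [a] telescope. *)
Lemma sech_mult (a d : R) : d <> 0 ->
  sech a * sech (a + d) = / sinh d * (tanh (a + d) - tanh a).
Proof.
  intros Hd.
  assert (Hs : sinh d <> 0).
  { intros E; apply Hd; unfold sinh in E.
    assert (exp d = exp (- d)) by lra; apply exp_inv in H; lra. }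
  assert (C1 := cosh_ge_1 a); assert (C2 := cosh_ge_1 (a + d)).
  assert (K : sinh (a + d) * cosh a - cosh (a + d) * sinh a = sinh d).
  { unfold sinh, cosh; rewrite !exp_Ropp, !exp_plus.
    field; repeat split; apply Rgt_not_eq, exp_pos. }
  transitivity (/ sinh d * (sinh d * (/ cosh a * / cosh (a + d)))).
  - unfold sech; field; repeat split; lra.
  - rewrite <- K at 2; unfold tanh; field; repeat split; lra.
Qed.

Lemma exp_INR_mult (x : R) (n : nat) : exp (INR n * x) = exp x ^ n.
Proof.
  induction n as [|n IH]; [now rewrite Rmult_0_l, exp_0|].
  rewrite S_INR, Rmult_plus_distr_r, exp_plus, IH, Rmult_1_l; simpl; ring.
Qed.

Lemma exp_opp_lt_1 (x : R) : 0 < x -> 0 < exp (- x) < 1.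
Proof.
  intros H; split; [apply exp_pos|].
  rewrite <- exp_0; apply exp_increasing; lra.
Qed.

Lemma exp_opp_lin (h x : R) (n : nat) : exp (- (x + INR n * h)) = exp (- x) * exp (- h) ^ n.
Proof. rewrite <- exp_INR_mult, <- exp_plus; f_equal; ring. Qed.

Lemma is_lim_seq_exp_lin (h x : R) :
  0 < h -> is_lim_seq (fun n => exp (- (x + INR n * h))) 0.
Proof.
  intros Hh.
  apply is_lim_seq_ext with (fun n => exp (- x) * exp (- h) ^ n).
  - intros n; now rewrite exp_opp_lin.
  - apply lim_scal0.
    apply lim_geom, exp_opp_lt_1, Hh.
Qed.

Lemma tanh_eq (x : R) : tanh x = 1 - 2 * (exp (- x) * sech x) / 2.
Proof.
  unfold tanh, sech, sinh, cosh.
  assert (H := exp_pos x); assert (H0 := exp_pos (- x)); field; lra.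
Qed.

Lemma is_lim_seq_tanh (h x : R) :
  0 < h -> is_lim_seq (fun n => tanh (x + INR n * h)) 1.
Proof.
  intros Hh.
  apply is_lim_seq_le_le with
    (fun n => 1 - exp (- (x + INR n * h))) (fun _ => 1).
  - intros n; rewrite tanh_eq.
    assert (H := exp_pos (- (x + INR n * h))).
    assert (H1 := sech_pos (x + INR n * h)).
    assert (H2 : sech (x + INR n * h) <= 1).
    { unfold sech; rewrite <- Rinv_1; apply Rinv_le_contravar; [lra | apply cosh_ge_1]. }
    split; [|nra].
    apply Rmult_le_compat_l with (r := exp (- (x + INR n * h))) in H2; lra.
  - apply (lim_eq _ (1 - 0)); [lim; now apply is_lim_seq_exp_lin | ring].
  - apply is_lim_seq_const.
Qed.

Lemma ex_zsum_sech (h x : R) : 0 < h -> ex_zsum (fun i => sech (x + IZR i * h)).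
Proof.
  intros Hh.
  assert (Hgen : forall y, ex_series (fun n => sech (y + INR n * h))).
  { intros y; apply ex_series_nonneg_le with (fun n => 2 * exp (- y) * exp (- h) ^ n).
    - intros n; split; [left; apply sech_pos|].
      apply Rle_trans with (1 := sech_le_exp _); right.
      rewrite exp_opp_lin; ring.
    - apply (ex_series_scal_l (2 * exp (- y)) (fun n => exp (- h) ^ n)).
      apply ex_series_geom; rewrite Rabs_pos_eq by (left; apply exp_pos).
      rewrite <- exp_0; apply exp_increasing; lra. }
  split.
  - apply ex_series_ext with (2 := Hgen x); intros n; now rewrite INR_IZR_INZ.
  - apply ex_series_ext with (2 := Hgen (h - x)); intros n.
    rewrite <- sech_opp, minus_IZR, opp_IZR, <- INR_IZR_INZ; f_equal; ring.
Qed.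

Definition sech_sum (h x : R) : R := zsum (fun i => sech (x + IZR i * h)).

(** The common value of the products [sech_sum h x * sech_sum h (x + h / 2)], a Lambert series in
    [exp (- h / 2)]. *)
Definition lambert_sum (h : R) : R :=
  Series (fun n => 2 * (2 * INR n + 1) / sinh ((INR n + / 2) * h)).

Lemma zsum_tanh_succ (h y : R) : 0 < h ->
  ex_zsum (fun i => tanh (y + IZR (i + 1) * h) - tanh (y + IZR i * h)) /\
  zsum (fun i => tanh (y + IZR (i + 1) * h) - tanh (y + IZR i * h)) = 2.
Proof.
  intros Hh.
  assert (T1 := is_series_telescoping _ _ (is_lim_seq_tanh h y Hh)).
  assert (T2 := is_series_telescoping _ _ (is_lim_seq_tanh h (- y) Hh)).
  assert (U1 : is_series (fun n => tanh (y + IZR (Z.of_nat n + 1) * h)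
       - tanh (y + IZR (Z.of_nat n) * h)) (1 - tanh (y + INR 0 * h))).
  { apply is_series_ext with (2 := T1); intros n.
    now rewrite S_INR, plus_IZR, <- INR_IZR_INZ. }
  assert (Hop : forall t, tanh (- t) = - tanh t).
  { intros t; unfold tanh; rewrite sinh_opp, cosh_opp; field; generalize (cosh_ge_1 t); lra. }
  assert (U2 : is_series (fun n => tanh (y + IZR (- Z.of_nat n - 1 + 1) * h)
       - tanh (y + IZR (- Z.of_nat n - 1) * h)) (1 - tanh (- y + INR 0 * h))).
  { apply is_series_ext with (2 := T2); intros n.
    rewrite S_INR, plus_IZR, minus_IZR, opp_IZR, <- INR_IZR_INZ.
    replace (y + (- INR n - 1 + 1) * h) with (- (- y + INR n * h)) by ring.
    replace (y + (- INR n - 1) * h) with (- (- y + (INR n + 1) * h)) by ring.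
    rewrite !Hop; lra. }
  split; [split; eexists; eassumption|].
  unfold zsum; rewrite (is_series_unique _ _ U1), (is_series_unique _ _ U2).
  simpl INR; rewrite Rmult_0_l, !Rplus_0_r, Hop; ring.
Qed.

(** Raising [j] by one adds the increments of [tanh] along a whole lattice, which telescope to
    [1 - (-1) = 2]. *)
Lemma zsum_tanh_shift (h x c : R) (j : Z) : 0 < h ->
  (forall j, ex_zsum (fun i => tanh (x + IZR i * h + (IZR j * h + c)) - tanh (x + IZR i * h))) ->
  zsum (fun i => tanh (x + IZR i * h + (IZR j * h + c)) - tanh (x + IZR i * h)) =
  zsum (fun i => tanh (x + IZR i * h + (IZR 0 * h + c)) - tanh (x + IZR i * h)) + 2 * IZR j.
Proof.
  intros Hh Hex.
  set (f := fun j i : Z => tanh (x + IZR i * h + (IZR j * h + c)) - tanh (x + IZR i * h)) in *.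
  change (zsum (f j) = zsum (f 0%Z) + 2 * IZR j).
  assert (Hstep : forall j : Z, zsum (f (j + 1)%Z) = zsum (f j) + 2).
  { intros l.
    destruct (zsum_tanh_succ h (x + (IZR l * h + c)) Hh) as [S1 S2].
    rewrite <- S2, <- zsum_plus by (auto; apply Hex).
    apply zsum_ext; intros i; unfold f; rewrite !plus_IZR.
    replace (x + (IZR l * h + c) + IZR i * h) with (x + IZR i * h + (IZR l * h + c)) by ring.
    replace (x + (IZR l * h + c) + (IZR i + 1) * h)
      with (x + IZR i * h + ((IZR l + 1) * h + c)) by ring.
    ring. }
  revert j; apply Z.peano_ind.
  - rewrite Rmult_0_r; ring.
  - intros j IH; unfold Z.succ; rewrite Hstep, IH, plus_IZR; ring.
  - intros j IH; assert (E := Hstep (Z.pred j)).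
    replace (Z.pred j + 1)%Z with j in E by lia.
    replace (IZR (Z.pred j)) with (IZR j - 1) by (rewrite <- minus_IZR; f_equal; lia); lra.
Qed.

(* The Jacobi relation [dn u * dn (u + K) = k']. *)
Theorem sech_sum_mult (h x : R) : 0 < h ->
  sech_sum h x * sech_sum h (x + h / 2) = lambert_sum h.
Proof.
  intros Hh.
  (* Two points taken from the two lattices always differ by a half-integer multiple of [h], never
     by 0, so [sech_mult] applies to every product of terms. *)
  set (d := fun j : Z => IZR j * h + h / 2).
  assert (Hd : forall j, d j <> 0).
  { intros j E; unfold d in E.
    replace (IZR j * h + h / 2) with (h * ((IZR j * 2 + 1) / 2)) in E by field.
    apply Rmult_integral in E; destruct E as [E|E]; [lra|].
    assert (E' : IZR (j * 2 + 1) = 0) by (rewrite plus_IZR, mult_IZR; lra).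
    apply eq_IZR in E'; lia. }
  set (a := fun i j : Z => sech (x + IZR i * h) * sech (x + IZR i * h + d j)).
  assert (Hsh : forall i, ex_zsum (fun j => sech (x + IZR i * h + d j)) /\
     zsum (fun j => sech (x + IZR i * h + d j)) = sech_sum h (x + h / 2)).
  { intros i; destruct (zsum_shift _ i (ex_zsum_sech h (x + h / 2) Hh)) as [H1 H2].
    assert (E : forall j, sech (x + h / 2 + IZR (j + i) * h) = sech (x + IZR i * h + d j))
      by (intros j; unfold d; rewrite plus_IZR; f_equal; field).
    split; [now apply ex_zsum_ext with (1 := E)|].
    unfold sech_sum; rewrite <- H2; symmetry; now apply zsum_ext. }
  assert (Hrow : forall i, ex_zsum (a i)) by (intros i; apply ex_zsum_scal, Hsh).
  assert (Hrs : forall i, zsum (a i) = sech_sum h (x + h / 2) * sech (x + IZR i * h)).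
  { intros i; unfold a; rewrite zsum_scal, (proj2 (Hsh i)); ring. }
  destruct (zsum_swap a) as [Hsw Hcol]; auto.
  { intros i j; unfold a; apply Rmult_le_pos; left; apply sech_pos. }
  { apply ex_zsum_ext with (fun i => sech_sum h (x + h / 2) * sech (x + IZR i * h)).
    - intros i; now rewrite Hrs.
    - now apply ex_zsum_scal, ex_zsum_sech. }
  rewrite (zsum_ext _ _ Hrs), zsum_scal in Hsw.
  fold (sech_sum h x) in Hsw.
  rewrite Rmult_comm, Hsw; clear Hsw.
  set (g := zsum (fun i => tanh (x + IZR i * h + d 0%Z) - tanh (x + IZR i * h))).
  assert (Hg : forall j, ex_zsum (fun i => tanh (x + IZR i * h + d j) - tanh (x + IZR i * h))).
  { intros j; apply ex_zsum_ext with (2 := ex_zsum_scal (sinh (d j)) _ (Hcol j)).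
    intros i; unfold a; rewrite sech_mult by apply Hd.
    assert (sinh (d j) <> 0).
    { destruct (Rtotal_order (d j) 0) as [L|[L|L]]; [|destruct (Hd j L)|].
      - apply Rlt_not_eq; rewrite <- sinh_0; now apply sinh_lt.
      - apply Rgt_not_eq; rewrite <- sinh_0; now apply sinh_lt. }
    field; auto. }
  assert (Hc : forall j, zsum (fun i => a i j) = / sinh (d j) * (g + 2 * IZR j)).
  { intros j.
    unfold g, d; rewrite <- zsum_tanh_shift, <- zsum_scal by auto.
    apply zsum_ext; intros i; unfold a; now rewrite sech_mult by apply Hd. }
  (* Only [g] depends on [x]. Since [d (- n - 1) = - d n], it cancels in each pair, and
     [2 n - 2 (- n - 1) = 2 (2 n + 1)] is left over [sinh (d n)]. *)
  apply Series_ext; intros n.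
  rewrite !Hc.
  replace (d (- Z.of_nat n - 1)%Z) with (- d (Z.of_nat n))
    by (unfold d; rewrite minus_IZR, opp_IZR; field).
  rewrite sinh_opp, minus_IZR, opp_IZR, <- INR_IZR_INZ.
  replace (d (Z.of_nat n)) with ((INR n + / 2) * h)
    by (unfold d; rewrite <- INR_IZR_INZ; field).
  assert (sinh ((INR n + / 2) * h) <> 0).
  { apply Rgt_not_eq; rewrite <- sinh_0; apply sinh_lt.
    apply Rmult_lt_0_compat; auto; generalize (pos_INR n); lra. }
  field; auto.
Qed.

(* In terms of the Jacobi function, [sech_sum h] is a multiple of [dn], which runs
   between these two values. *)
Definition dn_max (h : R) : R := sech_sum h 0.
Definition dn_min (h : R) : R := sech_sum h (h / 2).
Definition csch2_even (h : R) : R := Series (fun n => / (4 * sinh (INR (S n) * h) ^ 2)).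
Definition csch2_odd (h : R) : R := Series (fun n => / (4 * sinh ((INR n + / 2) * h) ^ 2)).

(** * Behaviour of the sums under doubling of the step *)

Lemma sinh_pos (x : R) : 0 < x -> 0 < sinh x.
Proof. intros H; rewrite <- sinh_0; now apply sinh_lt. Qed.

Lemma sinh_double (x : R) : sinh (2 * x) = 2 * sinh x * cosh x.
Proof.
  unfold sinh, cosh; replace (2 * x) with (x + x) by ring.
  rewrite !exp_Ropp, !exp_plus; field; apply Rgt_not_eq, exp_pos.
Qed.

Lemma cosh_double (x : R) : cosh (2 * x) = 1 + 2 * sinh x ^ 2.
Proof.
  unfold sinh, cosh; replace (2 * x) with (x + x) by ring.
  rewrite !exp_Ropp, !exp_plus; field; apply Rgt_not_eq, exp_pos.
Qed.

Lemma sinh_double_ge (x : R) : 0 < x -> 2 * sinh x <= sinh (2 * x).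
Proof.
  intros H; rewrite sinh_double.
  generalize (sinh_pos x H) (cosh_ge_1 x); intros; nra.
Qed.

Lemma sech_sum_shift (h x : R) : 0 < h -> sech_sum h (x + h) = sech_sum h x.
Proof.
  intros Hh; unfold sech_sum; rewrite <- (zsum_succ (fun i => sech (x + IZR i * h))).
  - apply zsum_ext; intros i; rewrite plus_IZR; f_equal; ring.
  - now apply ex_zsum_sech.
Qed.

Lemma sech_sum_opp (h x : R) : 0 < h -> sech_sum h (- x) = sech_sum h x.
Proof.
  intros Hh; rewrite <- (sech_sum_shift h (- x)) by auto.
  unfold sech_sum; rewrite <- (zsum_opp (fun i => sech (x + IZR i * h))).
  apply zsum_ext; intros i.
  rewrite minus_IZR, opp_IZR, <- sech_opp; f_equal; ring.
Qed.

Lemma sech_sum_split (h x : R) : 0 < h ->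
  sech_sum h x = sech_sum (2 * h) x + sech_sum (2 * h) (x + h).
Proof.
  intros Hh; unfold sech_sum; rewrite zsum_even_odd.
  - f_equal; apply zsum_ext; intros i; rewrite ?plus_IZR, mult_IZR; f_equal; ring.
  - intros i; left; apply sech_pos.
  - now apply ex_zsum_sech.
Qed.

Lemma dn_max_mult_dn_min (h : R) : 0 < h -> dn_max h * dn_min h = lambert_sum h.
Proof.
  intros Hh; rewrite <- (sech_sum_mult h 0) by auto.
  now rewrite Rplus_0_l.
Qed.

Lemma dn_max_double (h : R) : 0 < h -> dn_max h = dn_max (2 * h) + dn_min (2 * h).
Proof.
  intros Hh; unfold dn_max, dn_min; rewrite sech_sum_split by auto.
  do 2 f_equal; field.
Qed.

(** The lattice of step [h] through [h / 2] consists of two lattices of step [2 h], through [h / 2]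
    and, up to a period, [- h / 2]. By parity they have equal sums, and these two points differ by
    half of [2 h], so the constant product evaluates the square. *)
Lemma dn_min_double (h : R) : 0 < h -> dn_min h ^ 2 = 4 * dn_max (2 * h) * dn_min (2 * h).
Proof.
  intros Hh.
  assert (H2 : 0 < 2 * h) by lra.
  assert (E : dn_min h = 2 * sech_sum (2 * h) (h / 2)).
  { unfold dn_min; rewrite sech_sum_split by auto.
    replace (h / 2 + h) with (- (h / 2) + 2 * h) by field.
    rewrite sech_sum_shift, sech_sum_opp by auto; ring. }
  rewrite E, Rmult_assoc, dn_max_mult_dn_min by auto.
  rewrite <- (sech_sum_mult (2 * h) (- (h / 2))) by auto.
  replace (- (h / 2) + 2 * h / 2) with (h / 2) by field.
  rewrite sech_sum_opp by auto; ring.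
Qed.

Lemma zsum_nonneg (f : Z -> R) : (forall i, 0 <= f i) -> ex_zsum f -> f 0%Z <= zsum f.
Proof.
  intros Hf [H1 H2]; unfold zsum.
  generalize (term_le_Series _ 0 (fun n => Hf _) H1) (Series_nonneg _ (fun n => Hf _) H2).
  simpl; lra.
Qed.

Lemma sech_sum_pos (h x : R) : 0 < h -> sech x <= sech_sum h x.
Proof.
  intros Hh; unfold sech_sum.
  replace (sech x) with (sech (x + IZR 0 * h)) by (f_equal; ring).
  apply (zsum_nonneg (fun i => sech (x + IZR i * h))).
  - intros i; left; apply sech_pos.
  - now apply ex_zsum_sech.
Qed.

Lemma dn_max_ge_1 (h : R) : 0 < h -> 1 <= dn_max h.
Proof.
  intros Hh; apply Rle_trans with (sech 0).
  - unfold sech; rewrite cosh_0; lra.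
  - now apply sech_sum_pos.
Qed.

Lemma dn_min_pos (h : R) : 0 < h -> 0 < dn_min h.
Proof.
  intros Hh; apply Rlt_le_trans with (sech (h / 2)); [apply sech_pos | now apply sech_sum_pos].
Qed.

Lemma inv_csch (x : R) : 0 < x ->
  exp (- x) / (1 - exp (- (2 * x))) = / (2 * sinh x) /\
  exp (- (2 * x)) / (1 - exp (- (2 * x))) ^ 2 = / (4 * sinh x ^ 2).
Proof.
  intros H; assert (Hs := sinh_pos x H); unfold sinh in *.
  rewrite exp_Ropp in Hs.
  replace (2 * x) with (x + x) by ring; rewrite !exp_Ropp, exp_plus.
  assert (E := exp_pos x).
  assert (exp x * (exp x - / exp x) = exp x * exp x - 1) by (field; lra).
  assert (0 < exp x * exp x - 1) by (rewrite <- H0; apply Rmult_lt_0_compat; lra).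
  split; field; repeat split; lra.
Qed.

Lemma ex_series_csch_lin (h : R) : 0 < h ->
  ex_series (fun d => INR (S d) / (2 * sinh (INR (S d) * h))).
Proof.
  intros Hh; assert (Hq := exp_opp_lt_1 h Hh).
  assert (Hq2 := exp_opp_lt_1 (2 * h) ltac:(lra)).
  apply ex_series_nonneg_le with
    (fun d => / (1 - exp (- (2 * h))) * (INR (S d) * exp (- h) ^ S d)).
  - intros d.
    assert (Hd : 1 <= INR (S d)) by (rewrite S_INR; generalize (pos_INR d); lra).
    assert (Hp : 0 < INR (S d) * h) by (apply Rmult_lt_0_compat; lra).
    unfold Rdiv; rewrite <- (proj1 (inv_csch _ Hp)).
    replace (- (INR (S d) * h)) with (INR (S d) * - h) by ring.
    rewrite exp_INR_mult.
    assert (Hle : exp (- (2 * (INR (S d) * h))) <= exp (- (2 * h))).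
    { destruct (Req_dec (INR (S d)) 1) as [->|]; [right; f_equal; ring|].
      left; apply exp_increasing; nra. }
    assert (Hi : / (1 - exp (- (2 * (INR (S d) * h)))) <= / (1 - exp (- (2 * h))))
      by (apply Rinv_le_contravar; lra).
    assert (0 < / (1 - exp (- (2 * (INR (S d) * h))))) by (apply Rinv_0_lt_compat; lra).
    assert (0 <= INR (S d) * exp (- h) ^ S d)
      by (apply Rmult_le_pos; [lra | apply pow_le; lra]).
    unfold Rdiv; rewrite <- Rmult_assoc, (Rmult_comm (/ (1 - exp (- (2 * h))))).
    split; [apply Rmult_le_pos; lra | now apply Rmult_le_compat_l].
  - apply (ex_series_scal_l (/ (1 - exp (- (2 * h)))) (fun d => INR (S d) * exp (- h) ^ S d)).
    eexists; now apply is_series_arith_geom.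
Qed.

(** Each squared cosecant is expanded as a series of [d * exp (- 2 d t)] with [t = (n + 1 / 2) h];
    summing over [n] first gives a geometric series for each [d]. *)
Lemma csch2_odd_double_series (h : R) : 0 < h ->
  is_series (fun n => / (4 * sinh ((INR n + / 2) * h) ^ 2))
    (Series (fun d => INR (S d) / (2 * sinh (INR (S d) * h)))).
Proof.
  intros Hh.
  set (a := fun d n : nat => INR (S d) * (exp (- (INR (S d) * h)) * exp (- (2 * (INR (S d) * h))) ^ n)).
  assert (Hrow : forall d, is_series (a d) (INR (S d) / (2 * sinh (INR (S d) * h)))).
  { intros d.
    assert (Hp : 0 < INR (S d) * h) by (apply Rmult_lt_0_compat; auto; apply lt_0_INR; lia).
    unfold Rdiv; rewrite <- (proj1 (inv_csch _ Hp)).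
    apply (is_series_scal_l (INR (S d)) (fun n => exp (- (INR (S d) * h)) * exp (- (2 * (INR (S d) * h))) ^ n)).
    apply (is_series_scal_l (exp (- (INR (S d) * h))) (fun n => exp (- (2 * (INR (S d) * h))) ^ n)).
    apply is_series_geom, Rabs_def1; generalize (exp_opp_lt_1 (2 * (INR (S d) * h))); lra. }
  destruct (Series_swap_nonneg a) as [_ Hs].
  - intros d n; unfold a; apply Rmult_le_pos; [apply pos_INR|].
    apply Rmult_le_pos; [left; apply exp_pos | apply pow_le; left; apply exp_pos].
  - intros d; eexists; apply Hrow.
  - apply ex_series_ext with (2 := ex_series_csch_lin h Hh).
    intros d; symmetry; apply is_series_unique, Hrow.
  - rewrite (Series_ext (fun n => Series (a n))
       (fun d => INR (S d) / (2 * sinh (INR (S d) * h)))) in Hs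
      by (intros d; apply is_series_unique, Hrow).
    apply is_series_ext with (2 := Hs); intros n.
    apply is_series_unique.
    assert (Hp : 0 < (INR n + / 2) * h)
      by (apply Rmult_lt_0_compat; auto; generalize (pos_INR n); lra).
    rewrite <- (proj2 (inv_csch _ Hp)).
    apply is_series_ext with (fun d => INR (S d) * exp (- (2 * ((INR n + / 2) * h))) ^ S d).
    + intros d; unfold a; f_equal.
      rewrite <- !exp_INR_mult, <- exp_plus; f_equal; field.
    + apply is_series_arith_geom, exp_opp_lt_1; lra.
Qed.

Lemma csch2_odd_eq (h : R) : 0 < h ->
  csch2_odd h = Series (fun d => INR (S d) / (2 * sinh (INR (S d) * h))).
Proof. intros Hh; now apply is_series_unique, csch2_odd_double_series. Qed.

(** In the series over [d], the even indices reproduce twice the series at [2 h], and the odd ones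
    form a quarter of [lambert_sum (2 * h)], which is a product of [dn_max] and [dn_min] and hence a
    multiple of [dn_min h ^ 2]. *)
Lemma csch2_odd_double (h : R) : 0 < h ->
  csch2_odd h - 2 * csch2_odd (2 * h) = dn_min h ^ 2 / 16.
Proof.
  intros Hh.
  rewrite dn_min_double by auto.
  rewrite Rmult_assoc, dn_max_mult_dn_min by lra.
  rewrite !csch2_odd_eq by lra.
  assert (Hpos : forall d, 0 <= INR (S d) / (2 * sinh (INR (S d) * h))).
  { intros d; assert (0 < INR (S d)) by (apply lt_0_INR; lia).
    apply Rdiv_le_0_compat; [lra|].
    apply Rmult_lt_0_compat; [lra|apply sinh_pos, Rmult_lt_0_compat; auto]. }
  rewrite (Series_even_odd _ Hpos (ex_series_csch_lin h Hh)).
  rewrite (Series_ext (fun n => INR (S (2 * n + 1)) / (2 * sinh (INR (S (2 * n + 1)) * h)))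
             (fun n => 2 * (INR (S n) / (2 * sinh (INR (S n) * (2 * h)))))).
  - rewrite Series_scal_l; unfold lambert_sum.
    rewrite (Series_ext (fun n => INR (S (2 * n)) / (2 * sinh (INR (S (2 * n)) * h)))
       (fun n => / 4 * (2 * (2 * INR n + 1) / sinh ((INR n + / 2) * (2 * h))))).
    + rewrite Series_scal_l; lra.
    + intros n; rewrite S_INR, mult_INR; simpl (INR 2).
      replace ((INR n + / 2) * (2 * h)) with ((2 * INR n + 1) * h) by field.
      assert (0 < sinh ((2 * INR n + 1) * h)).
      { apply sinh_pos, Rmult_lt_0_compat; auto; generalize (pos_INR n); lra. }
      replace (1 + 1) with 2 by ring; field; lra.
  - intros n.
    replace (INR (S (2 * n + 1))) with (2 * INR (S n))
      by (rewrite !S_INR, plus_INR, mult_INR; simpl; ring).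
    replace (2 * INR (S n) * h) with (INR (S n) * (2 * h)) by ring.
    assert (0 < INR (S n)) by (apply lt_0_INR; lia).
    assert (0 < sinh (INR (S n) * (2 * h))) by (apply sinh_pos; nra).
    field; lra.
Qed.

Lemma ex_series_csch2_odd (h : R) : 0 < h ->
  ex_series (fun n => / (4 * sinh ((INR n + / 2) * h) ^ 2)).
Proof. intros Hh; eexists; now apply csch2_odd_double_series. Qed.

Lemma inv_sinh2_le (x y : R) : 0 < x <= y -> 0 <= / (4 * sinh y ^ 2) <= / (4 * sinh x ^ 2).
Proof.
  intros H; assert (Hx := sinh_pos x (proj1 H)).
  assert (sinh x <= sinh y) by (destruct (proj2 H) as [L| ->]; [left; now apply sinh_lt | lra]).
  assert (sinh x ^ 2 <= sinh y ^ 2) by (apply pow_incr; lra).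
  assert (0 < sinh x ^ 2) by (apply pow_lt; lra).
  split; [left; apply Rinv_0_lt_compat | apply Rinv_le_contravar]; lra.
Qed.

Lemma ex_series_csch2_even (h : R) : 0 < h ->
  ex_series (fun n => / (4 * sinh (INR (S n) * h) ^ 2)).
Proof.
  intros Hh; apply ex_series_nonneg_le with (2 := ex_series_csch2_odd h Hh).
  intros n; apply inv_sinh2_le; rewrite S_INR; generalize (pos_INR n); nra.
Qed.

Lemma csch2_all_nonneg (h : R) (n : nat) : 0 < h -> 0 <= / (4 * sinh (INR (S n) * h) ^ 2).
Proof.
  intros Hh; apply (inv_sinh2_le (INR (S n) * h) (INR (S n) * h)).
  assert (0 < INR (S n)) by (apply lt_0_INR; lia).
  split; [now apply Rmult_lt_0_compat | lra].
Qed.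

Lemma csch2_even_double (h : R) : 0 < h ->
  csch2_even h = csch2_even (2 * h) + csch2_odd (2 * h).
Proof.
  intros Hh; unfold csch2_even.
  rewrite (Series_even_odd _ (fun n => csch2_all_nonneg h n Hh) (ex_series_csch2_even h Hh)).
  rewrite Rplus_comm; unfold csch2_odd; f_equal; apply Series_ext; intros n; do 4 f_equal.
  - rewrite !S_INR, plus_INR, mult_INR; simpl; ring.
  - rewrite S_INR, mult_INR; simpl; field.
Qed.

Lemma inv_sinh2_double (x : R) : 0 < x ->
  0 <= / (4 * sinh (2 * x) ^ 2) <= / 4 * / (4 * sinh x ^ 2).
Proof.
  intros H; assert (Hx := sinh_pos x H); assert (Hy := sinh_double_ge x H).
  split.
  - left; apply Rinv_0_lt_compat, Rmult_lt_0_compat; [lra|]; apply pow_lt; lra.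
  - rewrite <- Rinv_mult; apply Rinv_le_contravar.
    + assert (0 < sinh x ^ 2) by (apply pow_lt; lra); lra.
    + replace (4 * (4 * sinh x ^ 2)) with (4 * (2 * sinh x) ^ 2) by ring.
      apply Rmult_le_compat_l; [lra|]; apply pow_incr; lra.
Qed.

(** From [sinh (2 x) >= 2 sinh x]. The factor 4 matters: it outweighs the factor 2 per doubling in
    the recursions below. *)
Lemma csch2_decr (c : nat -> R) (h : R) : (forall n, 0 < c n) -> 0 < h ->
  (forall h, 0 < h -> ex_series (fun n => / (4 * sinh (c n * h) ^ 2))) ->
  let f h := Series (fun n => / (4 * sinh (c n * h) ^ 2)) in 0 <= f (2 * h) <= f h / 4.
Proof.
  intros Hc Hh Hex f.
  assert (H : forall n, 0 <= / (4 * sinh (c n * (2 * h)) ^ 2) <= / 4 * / (4 * sinh (c n * h) ^ 2)).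
  { intros n; replace (c n * (2 * h)) with (2 * (c n * h)) by ring.
    now apply inv_sinh2_double, Rmult_lt_0_compat. }
  split.
  - apply Series_nonneg; [apply H | apply Hex; lra].
  - replace (f h / 4) with (/ 4 * f h) by field.
    unfold f; rewrite <- Series_scal_l; apply Series_le; auto.
    exact (ex_series_scal_l (/ 4) _ (Hex h Hh)).
Qed.

Lemma csch2_odd_decr (h : R) : 0 < h -> 0 <= csch2_odd (2 * h) <= csch2_odd h / 4.
Proof.
  intros Hh; apply (csch2_decr (fun n => INR n + / 2)); auto using ex_series_csch2_odd.
  intros n; generalize (pos_INR n); lra.
Qed.

Lemma csch2_even_decr (h : R) : 0 < h -> 0 <= csch2_even (2 * h) <= csch2_even h / 4.
Proof.
  intros Hh; apply (csch2_decr (fun n => INR (S n))); auto using ex_series_csch2_even.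
  intros n; apply lt_0_INR; lia.
Qed.

(** With [cosh (2 t) = 1 + 2 sinh t ^ 2], each term away from the centre is at most
    [1 / (2 sinh t ^ 2)]. As [csch2_even] tends to 0 under doubling, this pins the limit of [dn_max]
    to its central term 1. *)
Lemma dn_max_le (h : R) : 0 < h -> dn_max (2 * h) <= 1 + 4 * csch2_even h.
Proof.
  intros Hh; unfold dn_max, sech_sum, zsum.
  destruct (ex_zsum_sech (2 * h) 0 ltac:(lra)) as [H1 H2].
  assert (B : forall n t, t = INR (S n) * h ->
     0 <= sech (2 * t) <= 2 * / (4 * sinh (INR (S n) * h) ^ 2)).
  { intros n t ->; split; [left; apply sech_pos|].
    assert (0 < sinh (INR (S n) * h)).
    { apply sinh_pos, Rmult_lt_0_compat; auto; apply lt_0_INR; lia. }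
    assert (0 < sinh (INR (S n) * h) ^ 2) by now apply pow_lt.
    replace (2 * / (4 * sinh (INR (S n) * h) ^ 2)) with (/ (2 * sinh (INR (S n) * h) ^ 2))
      by (field; lra).
    unfold sech; rewrite cosh_double; apply Rinv_le_contravar; lra. }
  assert (Hex : ex_series (fun n => 2 * / (4 * sinh (INR (S n) * h) ^ 2))).
  { apply (ex_series_scal_l 2 (fun n => / (4 * sinh (INR (S n) * h) ^ 2))).
    now apply ex_series_csch2_even. }
  rewrite Series_incr_1 by auto.
  assert (S1 : Series (fun k => sech (0 + IZR (Z.of_nat (S k)) * (2 * h))) <= 2 * csch2_even h).
  { unfold csch2_even; rewrite <- Series_scal_l; apply Series_le; auto.
    intros n; rewrite <- INR_IZR_INZ.
    replace (0 + INR (S n) * (2 * h)) with (2 * (INR (S n) * h)) by ring; auto. }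
  assert (S2 : Series (fun k => sech (0 + IZR (- Z.of_nat k - 1) * (2 * h))) <= 2 * csch2_even h).
  { unfold csch2_even; rewrite <- Series_scal_l; apply Series_le; auto.
    intros n; rewrite minus_IZR, opp_IZR, <- INR_IZR_INZ, <- sech_opp.
    replace (- (0 + (- INR n - 1) * (2 * h))) with (2 * ((INR n + 1) * h)) by ring.
    apply B; rewrite S_INR; ring. }
  assert (S0 : sech (0 + IZR (Z.of_nat 0) * (2 * h)) = 1).
  { simpl (Z.of_nat 0); rewrite Rmult_0_l, Rplus_0_l; unfold sech; rewrite cosh_0; lra. }
  lra.
Qed.

(** * Limits along repeated doubling of the step *)

Lemma pow2_ge_1 (j : nat) : 1 <= 2 ^ j.
Proof. apply pow_R1_Rle; lra. Qed.

Lemma pow2_mult_pos (h : R) (j : nat) : 0 < h -> 0 < 2 ^ j * h.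
Proof. intros H; apply Rmult_lt_0_compat; auto; apply pow_lt; lra. Qed.

(** The common scheme of the evaluations below: the recursion makes the weighted sequence constant,
    so its limit is already the value at [h]. *)
Lemma doubling_const (f : R -> R) (c l h : R) : 0 < h ->
  (forall h, 0 < h -> c * f (2 * h) = f h) ->
  is_lim_seq (fun j => c ^ j * f (2 ^ j * h)) l -> f h = l.
Proof.
  intros Hh Hf; apply lim_const_unique; intros j.
  induction j as [|j IH]; [simpl; now rewrite !Rmult_1_l|].
  rewrite <- IH, <- (Hf (2 ^ j * h)) by now apply pow2_mult_pos.
  simpl; rewrite !Rmult_assoc; ring.
Qed.

Lemma is_lim_seq_decr (f : R -> R) (h g : R) : 0 < h -> 0 < g < 4 ->
  (forall h, 0 < h -> 0 <= f (2 * h) <= f h / 4) ->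
  is_lim_seq (fun j => g ^ j * f (2 ^ j * h)) 0.
Proof.
  intros Hh Hg Hf.
  assert (Hgj : forall j, 0 < g ^ j) by (intros j; apply pow_lt; lra).
  assert (H2j := pow2_ge_1).
  apply (is_lim_seq_incr_1 (fun j => g ^ j * f (2 ^ j * h))).
  apply is_lim_seq_le_le with (fun _ => 0) (fun j => f h * (g / 4) ^ S j).
  - intros j; split.
    + apply Rmult_le_pos; [left; auto|].
      simpl; rewrite Rmult_assoc; apply Hf; specialize (H2j j); nra.
    + induction (S j) as [|i IH]; [simpl; rewrite !Rmult_1_l; lra|].
      rewrite <- !tech_pow_Rmult, (Rmult_assoc 2).
      destruct (Hf (2 ^ i * h)) as [_ B]; [specialize (H2j i); nra|].
      apply Rle_trans with (g * g ^ i * (f (2 ^ i * h) / 4)).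
      * apply Rmult_le_compat_l; auto.
        specialize (Hgj i); nra.
      * apply Rmult_le_compat_l with (r := g / 4) in IH; lra.
  - apply is_lim_seq_const.
  - apply (is_lim_seq_incr_1 (fun j => f h * (g / 4) ^ j)).
    apply lim_scal0.
    apply lim_geom; lra.
Qed.

(** By [csch2_odd_double], [dn_min h ^ 2] is at most [16 * csch2_odd h], and the latter decays
    faster than [2 ^ j] grows. *)
Lemma is_lim_seq_dn_min2 (h : R) : 0 < h ->
  is_lim_seq (fun j => 2 ^ j * dn_min (2 ^ j * h) ^ 2) 0.
Proof.
  intros Hh.
  apply is_lim_seq_le_le with (fun _ => 0) (fun j => 16 * (2 ^ j * csch2_odd (2 ^ j * h))).
  - intros j; assert (H2 := pow2_ge_1 j); split.
    + apply Rmult_le_pos; [lra | apply pow2_ge_0].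
    + assert (Hj : 0 < 2 ^ j * h) by nra.
      generalize (csch2_odd_double _ Hj) (proj1 (csch2_odd_decr _ Hj)); intros.
      rewrite <- Rmult_assoc, (Rmult_comm 16), Rmult_assoc.
      apply Rmult_le_compat_l; lra.
  - apply is_lim_seq_const.
  - apply lim_scal0.
    apply is_lim_seq_decr; [auto | lra | apply csch2_odd_decr].
Qed.

Lemma is_lim_seq_dn_min (h : R) : 0 < h -> is_lim_seq (fun j => dn_min (2 ^ j * h)) 0.
Proof.
  intros Hh.
  apply is_lim_seq_ext with (fun j => sqrt (dn_min (2 ^ j * h) ^ 2)).
  { intros j; rewrite sqrt_pow2; auto; left; apply dn_min_pos.
    generalize (pow2_ge_1 j); nra. }
  rewrite <- sqrt_0.
  apply (is_lim_seq_continuous sqrt); [apply continuity_pt_sqrt; lra|].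
  apply is_lim_seq_le_le with (fun _ => 0) (fun j => 2 ^ j * dn_min (2 ^ j * h) ^ 2).
  - intros j; split; [apply pow2_ge_0|].
    generalize (pow2_ge_1 j) (pow2_ge_0 (dn_min (2 ^ j * h))); nra.
  - apply is_lim_seq_const.
  - now apply is_lim_seq_dn_min2.
Qed.

Lemma is_lim_seq_csch2_even (h : R) : 0 < h -> is_lim_seq (fun j => csch2_even (2 ^ j * h)) 0.
Proof.
  intros Hh.
  apply is_lim_seq_ext with (fun j => 1 ^ j * csch2_even (2 ^ j * h)).
  - intros j; rewrite pow1; ring.
  - apply is_lim_seq_decr; [auto | lra | apply csch2_even_decr].
Qed.

Lemma is_lim_seq_dn_max (h : R) : 0 < h -> is_lim_seq (fun j => dn_max (2 ^ j * h)) 1.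
Proof.
  intros Hh; apply (is_lim_seq_incr_1 (fun j => dn_max (2 ^ j * h))).
  apply is_lim_seq_le_le with (fun _ => 1) (fun j => 1 + 4 * csch2_even (2 ^ j * h)).
  - intros j; assert (H2 := pow2_ge_1 j); simpl; rewrite Rmult_assoc; split.
    + apply dn_max_ge_1; nra.
    + apply dn_max_le; nra.
  - apply is_lim_seq_const.
  - apply (lim_eq _ (1 + 4 * 0)); [lim; now apply is_lim_seq_csch2_even | ring].
Qed.

Lemma dn_max2_sub_dn_min2 (h : R) : 0 < h ->
  dn_max h ^ 2 - dn_min h ^ 2 = (dn_max (2 * h) - dn_min (2 * h)) ^ 2.
Proof. intros Hh; rewrite dn_min_double, dn_max_double by auto; ring. Qed.

(** Equality at [h] would, by [dn_max2_sub_dn_min2], propagate to all [2 ^ j * h], where the two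
    quantities tend to 0 and 1. *)
Lemma dn_min_lt_dn_max (h : R) : 0 < h -> dn_min h < dn_max h.
Proof.
  intros Hh.
  assert (Hle : forall h, 0 < h -> dn_min h <= dn_max h).
  { intros t Ht; generalize (dn_max2_sub_dn_min2 t Ht) (dn_max_ge_1 t Ht) (dn_min_pos t Ht).
    generalize (pow2_ge_0 (dn_max (2 * t) - dn_min (2 * t))); intros; nra. }
  destruct (Rle_lt_or_eq_dec _ _ (Hle h Hh)) as [|E]; auto; exfalso.
  assert (Hall : forall j, dn_min (2 ^ j * h) = dn_max (2 ^ j * h)).
  { induction j as [|j IH]; [simpl; now rewrite Rmult_1_l|].
    simpl; rewrite Rmult_assoc.
    assert (Hj : 0 < 2 ^ j * h) by (generalize (pow2_ge_1 j); nra).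
    generalize (dn_max2_sub_dn_min2 _ Hj); rewrite IH; intros Q.
    assert (dn_max (2 * (2 ^ j * h)) - dn_min (2 * (2 ^ j * h)) = 0); [|lra].
    apply Rsqr_0_uniq; unfold Rsqr; lra. }
  assert (L := is_lim_seq_dn_min h Hh).
  apply (is_lim_seq_ext _ _ _ Hall) in L.
  generalize (is_lim_seq_unique _ _ L) (is_lim_seq_unique _ _ (is_lim_seq_dn_max h Hh)).
  intros ->; intros Q; injection Q; lra.
Qed.

(** The difference of the two sides is unchanged by doubling: [csch2_even h - csch2_odd h] loses
    [dn_min h ^ 2 / 16], and since [dn_max ^ 2 + dn_min ^ 2] changes by [6 dn_max (2 h) dn_min (2 h)
    = 3 / 2 * dn_min h ^ 2], the divisor must be 24. *)
Lemma csch2_even_eq (h : R) : 0 < h ->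
  csch2_even h = csch2_odd h + (1 - dn_max h ^ 2 - dn_min h ^ 2) / 24.
Proof.
  intros Hh.
  set (v := fun h => csch2_even h - csch2_odd h - (1 - dn_max h ^ 2 - dn_min h ^ 2) / 24).
  assert (L : v h = 0 - 0 - (1 - 1 ^ 2 - 0 ^ 2) / 24); [|unfold v in L; lra].
  apply doubling_const with 1; auto.
  - intros t Ht; unfold v.
    generalize (csch2_even_double t Ht) (csch2_odd_double t Ht) (dn_min_double t Ht).
    rewrite (dn_max_double t Ht); intros; nra.
  - apply is_lim_seq_ext with (fun j => csch2_even (2 ^ j * h) - 1 ^ j * csch2_odd (2 ^ j * h)
      - (1 - dn_max (2 ^ j * h) ^ 2 - dn_min (2 ^ j * h) ^ 2) / 24).
    { intros j; unfold v; rewrite pow1; ring. }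
    assert (H1 := is_lim_seq_csch2_even h Hh); assert (H2 := is_lim_seq_dn_min h Hh).
    assert (H3 := is_lim_seq_dn_max h Hh).
    unfold Rdiv; simpl pow; lim.
    apply is_lim_seq_decr; [auto | lra | apply csch2_odd_decr].
Qed.

(** * Landen's transformation *)

(* [field] does not see through the module structures of Coquelicot. *)
Ltac real_eq := match goal with |- ?a = ?b => change (@eq R a b) end.

(** This and the next few lemmas are restated over [R], so that applying them raises no unification
    of algebraic structures. *)
Lemma ex_derive_cont (f : R -> R) (x : R) : ex_derive f x -> continuous f x.
Proof. exact (ex_derive_continuous f x). Qed.

Lemma ex_RInt_cont (f : R -> R) (a b : R) :
  (forall x, Rmin a b <= x <= Rmax a b -> continuous f x) -> ex_RInt f a b.
Proof. exact (ex_RInt_continuous f a b). Qed.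

Lemma is_RInt_deriv (f df : R -> R) (a b : R) :
  (forall x, Rmin a b <= x <= Rmax a b -> is_derive f x (df x)) ->
  (forall x, Rmin a b <= x <= Rmax a b -> continuous df x) -> is_RInt df a b (f b - f a).
Proof. exact (is_RInt_derive f df a b). Qed.

Lemma RInt_corr (f : R -> R) (a b : R) : ex_RInt f a b -> is_RInt f a b (RInt f a b).
Proof. exact (RInt_correct f a b). Qed.

Lemma is_RInt_rscal (f : R -> R) (a b c l : R) :
  is_RInt f a b l -> is_RInt (fun x => c * f x) a b (c * l).
Proof. exact (is_RInt_scal f a b c l). Qed.

Lemma ex_RInt_ex_derive (f : R -> R) (a b : R) : (forall x, ex_derive f x) -> ex_RInt f a b.
Proof. intros H; apply ex_RInt_cont; intros x _; now apply ex_derive_cont. Qed.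

Lemma sin2_bound (x : R) : 0 <= sin x ^ 2 <= 1.
Proof. generalize (sin_cos_sqr x); intros; nra. Qed.

Lemma ell_radicand (k x : R) : 0 <= k < 1 -> 1 - k ^ 2 <= 1 - k ^ 2 * sin x ^ 2 <= 1.
Proof. intros Hk; generalize (sin2_bound x); intros; assert (0 <= k ^ 2) by nra; nra. Qed.

Lemma ell_radicand_pos (k x : R) : 0 <= k < 1 -> 0 < 1 - k ^ 2 * sin x ^ 2.
Proof. intros Hk; generalize (ell_radicand k x Hk); nra. Qed.

Lemma ex_derive_ellK (k x : R) : 0 <= k < 1 ->
  ex_derive (fun phi => 1 / sqrt (1 - k ^ 2 * sin phi ^ 2)) x.
Proof.
  intros Hk; assert (H := ell_radicand_pos k x Hk); simpl in H.
  auto_derive; repeat split; auto.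
  apply Rgt_not_eq, sqrt_lt_R0; auto.
Qed.

Lemma ex_derive_ellE (k x : R) : 0 <= k < 1 ->
  ex_derive (fun phi => sqrt (1 - k ^ 2 * sin phi ^ 2)) x.
Proof.
  intros Hk; assert (H := ell_radicand_pos k x Hk); simpl in H.
  auto_derive; repeat split; auto.
Qed.

Lemma RInt_0_PI_symm (f : R -> R) : (forall x, ex_derive f x) ->
  (forall x, f (PI - x) = f x) -> RInt f 0 PI = 2 * RInt f 0 (PI / 2).
Proof.
  intros Hf Hs.
  rewrite <- (RInt_Chasles f 0 (PI / 2) PI) by (now apply ex_RInt_ex_derive).
  assert (E : RInt f (PI / 2) PI = RInt f 0 (PI / 2)).
  { rewrite <- (RInt_ext (fun x => scal (-1) ((-1) * f (- 1 * x + PI)))).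
    2: { intros x _; replace (- 1 * x + PI) with (PI - x) by ring.
         rewrite Hs; unfold scal; simpl; unfold mult; simpl; ring. }
    rewrite (RInt_comp_lin (fun x => -1 * f x) (-1) PI) by
      (apply ex_RInt_ex_derive; intros x; apply @ex_derive_scal, Hf).
    replace (- 1 * (PI / 2) + PI) with (PI / 2) by field.
    replace (- 1 * PI + PI) with 0 by ring.
    assert (Esc : RInt (fun x => -1 * f x) (PI / 2) 0 = -1 * RInt f (PI / 2) 0)
      by exact (RInt_scal f _ _ (-1) (ex_RInt_ex_derive _ _ _ Hf)).
    rewrite Esc, <- opp_RInt_swap by (now apply ex_RInt_ex_derive).
    unfold opp; simpl; ring. }
  rewrite E; unfold plus; simpl; ring.
Qed.

Section Landen.
Variable c : R.
Hypothesis Hc : 0 < c < 1.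

Let l := sqrt (1 - c ^ 2).
Let k := (1 - c) / (1 + c).
Let num (p : R) := cos p ^ 2 + c * sin p ^ 2.
Let rad (p : R) := cos p ^ 2 + c ^ 2 * sin p ^ 2.
(** Landen's angle [p + atan (c * tan p)], rewritten by the subtraction formula for [atan] so that
    it is smooth at [PI / 2] as well. *)
Let psi (p : R) := 2 * p - atan ((1 - c) * (sin p * cos p) / num p).

Lemma landen_l : 0 <= l < 1.
Proof.
  unfold l; split; [apply sqrt_pos|].
  rewrite <- sqrt_1 at 2; apply sqrt_lt_1; nra.
Qed.

Lemma landen_k : 0 <= k < 1.
Proof.
  unfold k; split; [apply Rdiv_le_0_compat; lra|].
  apply Rmult_lt_reg_r with (1 + c); [lra|]; field_simplify; lra.
Qed.

Lemma landen_num_pos p : 0 < num p.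
Proof. unfold num; generalize (sin_cos_sqr p); intros; nra. Qed.

Lemma landen_rad_pos p : 0 < rad p.
Proof. unfold rad; generalize (sin_cos_sqr p); intros; assert (0 < c ^ 2) by nra; nra. Qed.

Lemma landen_rad p : 1 - l ^ 2 * sin p ^ 2 = rad p.
Proof.
  unfold l, rad; rewrite pow2_sqrt by nra.
  generalize (sin_cos_sqr p); intros; nra.
Qed.

Lemma landen_num_rad p :
  num p ^ 2 + ((1 - c) * (sin p * cos p)) ^ 2 = rad p.
Proof.
  unfold num, rad; generalize (sin_cos_sqr p); intros H.
  transitivity ((sin p * sin p + cos p * cos p) * (cos p ^ 2 + c ^ 2 * sin p ^ 2)); [ring|].
  rewrite H; ring.
Qed.

(** Behind it is [sin (psi p) = (1 + c) * sin p * cos p / sqrt (rad p)]; only the square is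
    needed. *)
Lemma landen_sin_psi p : 1 - k ^ 2 * sin (psi p) ^ 2 = num p ^ 2 / rad p.
Proof.
  assert (Hn := landen_num_pos p); assert (Hr := landen_rad_pos p).
  assert (Hnr := landen_num_rad p).
  set (t := (1 - c) * (sin p * cos p) / num p).
  assert (Ht : 1 + t² = rad p / num p ^ 2).
  { rewrite <- Hnr; unfold t, Rsqr; field; lra. }
  assert (Hp : 0 < rad p / num p ^ 2) by (apply Rdiv_lt_0_compat; auto; apply pow_lt; auto).
  assert (E : sin (psi p) ^ 2 = ((1 + c) * (sin p * cos p)) ^ 2 / rad p).
  { unfold psi; fold t; rewrite sin_minus, sin_atan, cos_atan.
    replace ((sin (2 * p) * (1 / sqrt (1 + t²)) - cos (2 * p) * (t / sqrt (1 + t²))) ^ 2)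
      with ((sin (2 * p) - cos (2 * p) * t) ^ 2 / sqrt (1 + t²) ^ 2).
    2: { field; apply Rgt_not_eq, sqrt_lt_R0; rewrite Ht; auto. }
    rewrite pow2_sqrt by (rewrite Ht; lra).
    rewrite Ht.
    replace ((1 + c) * (sin p * cos p)) with (num p * (sin (2 * p) - cos (2 * p) * t)).
    { field; lra. }
    unfold t; replace (num p * (sin (2 * p) - cos (2 * p) * ((1 - c) * (sin p * cos p) / num p)))
      with (num p * sin (2 * p) - cos (2 * p) * ((1 - c) * (sin p * cos p))) by (field; lra).
    rewrite sin_2a, cos_2a; unfold num; generalize (sin_cos_sqr p); intros H.
    transitivity ((1 + c) * (sin p * cos p) * (sin p * sin p + cos p * cos p)); [ring|].
    rewrite H; ring. }
  rewrite E; unfold k.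
  apply Rmult_eq_reg_r with (rad p); [|lra].
  transitivity (rad p - ((1 - c) * (sin p * cos p)) ^ 2).
  - field; lra.
  - rewrite <- Hnr at 1; field; lra.
Qed.

Lemma landen_derive_psi p : is_derive psi p ((1 + c) * (num p / rad p)).
Proof.
  assert (Hn := landen_num_pos p); assert (Hr := landen_rad_pos p).
  assert (Hnr := landen_num_rad p).
  unfold psi, num; auto_derive.
  - change (cos p * (cos p * 1) + c * (sin p * (sin p * 1))) with (num p); lra.
  - change (cos p * (cos p * 1) + c * (sin p * (sin p * 1))) with (num p).
    change (cos p ^ 2 + c * sin p ^ 2) with (num p).
    replace (1 + (1 - c) * (sin p * cos p) * / num p * ((1 - c) * (sin p * cos p) * / num p * 1))
      with (rad p / num p ^ 2) by (rewrite <- Hnr; field; lra).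
    transitivity ((2 * rad p - (1 - c) * ((cos p ^ 2 - sin p ^ 2) * num p
       + 2 * (1 - c) * (sin p * cos p) ^ 2)) / rad p).
    { set (N := num p) in *; set (D := rad p) in *; field; lra. }
    assert (H2 : sin p ^ 2 = 1 - cos p ^ 2) by (generalize (sin_cos_sqr p); lra).
    unfold Rdiv; rewrite <- Rmult_assoc; f_equal.
    unfold rad, num; rewrite Rpow_mult_distr, !H2; ring.
Qed.

Lemma landen_psi_bounds : psi 0 = 0 /\ psi (PI / 2) = PI.
Proof.
  unfold psi; rewrite sin_0, cos_0, sin_PI2, cos_PI2.
  replace ((1 - c) * (0 * 1) / num 0) with 0 by (unfold Rdiv; ring).
  replace ((1 - c) * (1 * 0) / num (PI / 2)) with 0 by (unfold Rdiv; ring).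
  rewrite atan_0; split; field.
Qed.

(** The substitution maps a quarter period onto a half period, since [psi] runs from 0 to [PI]; the
    reflection symmetry of [f] then accounts for the factor 2. *)
Lemma landen_subst (f : R -> R) : (forall x, ex_derive f x) -> (forall x, f (PI - x) = f x) ->
  is_RInt (fun p => (1 + c) * (num p / rad p) * f (psi p)) 0 (PI / 2) (2 * RInt f 0 (PI / 2)).
Proof.
  intros Hf Hs; rewrite <- RInt_0_PI_symm by auto.
  destruct landen_psi_bounds as [E1 E2].
  rewrite <- E1 at 2; rewrite <- E2 at 2.
  apply (is_RInt_comp f psi (fun p => (1 + c) * (num p / rad p))).
  - intros x _; now apply ex_derive_cont.
  - intros p _; split; [apply landen_derive_psi|].
    apply ex_derive_cont.
    generalize (landen_rad_pos p); unfold num, rad; intros; auto_derive; simpl in *; lra.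
Qed.

Lemma landen_sqrt p : sqrt (1 - k ^ 2 * sin (psi p) ^ 2) = num p / sqrt (rad p).
Proof.
  rewrite landen_sin_psi, sqrt_div_alt by (apply landen_rad_pos).
  rewrite sqrt_pow2; auto; left; apply landen_num_pos.
Qed.

Theorem ellK_landen : ellK l = 2 / (1 + c) * ellK k.
Proof.
  apply is_RInt_unique.
  replace (2 / (1 + c) * ellK k) with (/ (1 + c) * (2 * ellK k)) by (field; lra).
  apply is_RInt_ext with
    (fun p => / (1 + c) * ((1 + c) * (num p / rad p) * (1 / sqrt (1 - k ^ 2 * sin (psi p) ^ 2)))).
  - intros p _; rewrite landen_sqrt, landen_rad.
    assert (Hn := landen_num_pos p); assert (Hr := sqrt_lt_R0 _ (landen_rad_pos p)).
    rewrite <- (sqrt_sqrt (rad p)) at 1 by (left; apply landen_rad_pos).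
    real_eq; field; repeat split; lra.
  - apply is_RInt_rscal.
    apply (landen_subst (fun x => 1 / sqrt (1 - k ^ 2 * sin x ^ 2))).
    + intros x; apply ex_derive_ellK, landen_k.
    + intros x; do 5 f_equal; rewrite sin_minus, sin_PI, cos_PI; ring.
Qed.

(* Both sides differ by the integral of an exact derivative, of
   [sin * cos / sqrt rad], which vanishes at both ends. *)
Theorem ellE_landen : ellE l + c * ellK l = (1 + c) * ellE k.
Proof.
  assert (H1 : is_RInt (fun p => (1 + c) / 2 * ((1 + c) * (num p / rad p) *
      sqrt (1 - k ^ 2 * sin (psi p) ^ 2))) 0 (PI / 2) ((1 + c) / 2 * (2 * ellE k))).
  { apply is_RInt_rscal.
    apply (landen_subst (fun x => sqrt (1 - k ^ 2 * sin x ^ 2))).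
    - intros x; apply ex_derive_ellE, landen_k.
    - intros x; do 4 f_equal; rewrite sin_minus, sin_PI, cos_PI; ring. }
  set (g := fun p => - ((1 - c ^ 2) / 2) * (sin p * cos p / sqrt (rad p))).
  set (dg := fun p => - ((1 - c ^ 2) / 2) *
    ((cos p ^ 2 - sin p ^ 2) / sqrt (rad p)
     + (1 - c ^ 2) * (sin p * cos p) ^ 2 / (rad p * sqrt (rad p)))).
  assert (Hs : forall p, 0 < sqrt (rad p)) by (intros p; apply sqrt_lt_R0, landen_rad_pos).
  assert (H2 : is_RInt dg 0 (PI / 2) (minus (g (PI / 2)) (g 0))).
  { apply is_RInt_deriv.
    - intros p _; assert (Hr := landen_rad_pos p); assert (Hq := Hs p).
      unfold g, dg, rad; auto_derive.
      + simpl in *; unfold rad in *; simpl in *; repeat split; auto; lra.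
      + change (cos p * (cos p * 1) + c * (c * 1) * (sin p * (sin p * 1))) with (rad p).
        change (cos p ^ 2 + c ^ 2 * sin p ^ 2) with (rad p).
        assert (Q : sqrt (rad p) * sqrt (rad p) = rad p) by (apply sqrt_sqrt; lra).
        set (q := sqrt (rad p)) in *; rewrite <- Q.
        field; lra.
    - intros p _; apply ex_derive_cont; unfold dg.
      assert (Hr := landen_rad_pos p); assert (Hq := Hs p); unfold rad in *.
      auto_derive; simpl in *; repeat split; auto; try lra.
      apply Rmult_integral_contrapositive_currified; lra. }
  assert (H3 : minus (g (PI / 2)) (g 0) = 0).
  { unfold g; rewrite sin_0, cos_PI2, Rmult_0_r, Rmult_0_l.
    unfold minus, plus, opp; simpl; unfold Rdiv; ring. }
  rewrite H3 in H2.
  assert (H4 := is_RInt_minus _ _ _ _ _ _ H1 H2).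
  assert (H5 : is_RInt (fun p => sqrt (1 - l ^ 2 * sin p ^ 2)
       + c * (1 / sqrt (1 - l ^ 2 * sin p ^ 2))) 0 (PI / 2) (ellE l + c * ellK l)).
  { apply (is_RInt_plus (V := R_NormedModule)).
    - apply RInt_corr, ex_RInt_ex_derive; intros x; apply ex_derive_ellE, landen_l.
    - apply is_RInt_rscal.
      apply RInt_corr, ex_RInt_ex_derive; intros x; apply ex_derive_ellK, landen_l. }
  rewrite <- (is_RInt_unique _ _ _ _ H5).
  replace ((1 + c) * ellE k) with (minus ((1 + c) / 2 * (2 * ellE k)) 0)
    by (unfold minus, plus, opp; simpl; field).
  apply is_RInt_unique.
  apply is_RInt_ext with (2 := H4); intros p _.
  unfold minus, plus, opp; simpl plus; simpl opp; cbv beta.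
  rewrite landen_sqrt, landen_rad; unfold dg.
  assert (Hr := landen_rad_pos p); assert (Hq := Hs p).
  assert (Q : sqrt (rad p) * sqrt (rad p) = rad p) by (apply sqrt_sqrt; lra).
  assert (Hnr := landen_num_rad p).
  assert (Hsc := sin_cos_sqr p).
  assert (Hrd : rad p = cos p ^ 2 + c ^ 2 * sin p ^ 2) by reflexivity.
  set (q := sqrt (rad p)) in *.
  change ((1 + c) / 2 * ((1 + c) * (num p / rad p) * (num p / q)) +
    - (- ((1 - c ^ 2) / 2) * ((cos p ^ 2 - sin p ^ 2) / q +
        (1 - c ^ 2) * (sin p * cos p) ^ 2 / (rad p * q))) = q + c * (1 / q)).
  apply Rmult_eq_reg_r with (2 * rad p * q);
    [|repeat apply Rmult_integral_contrapositive_currified; lra].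
  transitivity ((1 + c) ^ 2 * num p ^ 2 + (1 - c ^ 2) * (cos p ^ 2 - sin p ^ 2) * rad p
     + (1 - c ^ 2) ^ 2 * (sin p * cos p) ^ 2).
  { field; repeat split; lra. }
  transitivity (2 * rad p * (q * q) + 2 * c * rad p).
  2: { field; repeat split; lra. }
  rewrite Q.
  replace (num p ^ 2) with (rad p - ((1 - c) * (sin p * cos p)) ^ 2) by lra.
  transitivity (rad p * ((1 + c) ^ 2 + (1 - c ^ 2) * (cos p ^ 2 - sin p ^ 2))); [ring|].
  assert (C2 : cos p ^ 2 = 1 - sin p ^ 2) by nra.
  rewrite Hrd, C2; ring.
Qed.

End Landen.

(** * Bounds, monotonicity and the limit of the elliptic integrals at modulus 0 *)

Lemma ellK_0_bound (k : R) : 0 <= k < 1 -> PI / 2 <= ellK k <= PI / 2 * / sqrt (1 - k ^ 2).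
Proof.
  intros Hk; assert (HP := PI_RGT_0).
  assert (Hr : 0 < 1 - k ^ 2) by nra.
  assert (Hex : ex_RInt (fun phi => 1 / sqrt (1 - k ^ 2 * sin phi ^ 2)) 0 (PI / 2)).
  { apply ex_RInt_ex_derive; intros x; now apply ex_derive_ellK. }
  assert (Hc : forall c, RInt (fun _ : R => c) 0 (PI / 2) = PI / 2 * c).
  { intros d; rewrite RInt_const; unfold scal; simpl; unfold mult; simpl; field. }
  assert (B : forall x, 1 <= 1 / sqrt (1 - k ^ 2 * sin x ^ 2) <= / sqrt (1 - k ^ 2)).
  { intros x; destruct (ell_radicand k x Hk) as [B1 B2].
    unfold Rdiv; rewrite Rmult_1_l; split.
    - rewrite <- Rinv_1, <- sqrt_1 at 1; apply Rinv_le_contravar.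
      + apply sqrt_lt_R0; lra.
      + apply sqrt_le_1; lra.
    - apply Rinv_le_contravar; [apply sqrt_lt_R0; auto | apply sqrt_le_1; lra]. }
  split.
  - rewrite <- (Rmult_1_r (PI / 2)), <- Hc; apply RInt_le; auto; [lra|apply ex_RInt_const|].
    intros x _; apply B.
  - rewrite <- Hc; apply RInt_le; auto; [lra|apply ex_RInt_const|].
    intros x _; apply B.
Qed.

(** The difference of the integrands is [k ^ 2 * sin ^ 2] times that of [K]. The factor [k ^ 2] is
    what lets [K (K - E)] tend to 0 even after multiplication by [2 ^ j]. *)
Lemma ellK_sub_ellE (k : R) : 0 <= k < 1 -> 0 <= ellK k - ellE k <= k ^ 2 * ellK k.
Proof.
  intros Hk; assert (HP := PI_RGT_0).
  assert (HK : ex_RInt (fun phi => 1 / sqrt (1 - k ^ 2 * sin phi ^ 2)) 0 (PI / 2)).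
  { apply ex_RInt_ex_derive; intros x; now apply ex_derive_ellK. }
  assert (HE : ex_RInt (fun phi => sqrt (1 - k ^ 2 * sin phi ^ 2)) 0 (PI / 2)).
  { apply ex_RInt_ex_derive; intros x; now apply ex_derive_ellE. }
  assert (B : forall x, 0 <= 1 / sqrt (1 - k ^ 2 * sin x ^ 2) - sqrt (1 - k ^ 2 * sin x ^ 2)
     <= k ^ 2 * (1 / sqrt (1 - k ^ 2 * sin x ^ 2))).
  { intros x; assert (Hr := ell_radicand_pos k x Hk).
    assert (Hq := sqrt_lt_R0 _ Hr).
    assert (Q : sqrt (1 - k ^ 2 * sin x ^ 2) * sqrt (1 - k ^ 2 * sin x ^ 2)
       = 1 - k ^ 2 * sin x ^ 2) by (apply sqrt_sqrt; lra).
    set (q := sqrt (1 - k ^ 2 * sin x ^ 2)) in *.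
    replace (1 / q - q) with (k ^ 2 * sin x ^ 2 * / q).
    2: { replace (k ^ 2 * sin x ^ 2) with (1 - q * q) by lra; field; lra. }
    assert (Hi := Rinv_0_lt_compat _ Hq).
    generalize (sin2_bound x); intros Hs.
    assert (0 <= k ^ 2) by nra.
    unfold Rdiv; rewrite Rmult_1_l; split.
    - apply Rmult_le_pos; nra.
    - apply Rmult_le_compat_r; nra. }
  assert (E : ellK k - ellE k = RInt (fun x => minus (1 / sqrt (1 - k ^ 2 * sin x ^ 2))
      (sqrt (1 - k ^ 2 * sin x ^ 2))) 0 (PI / 2)).
  { exact (eq_sym (RInt_minus _ _ _ _ HK HE)). }
  assert (Hm := ex_RInt_minus _ _ _ _ HK HE).
  rewrite E; split.
  - apply RInt_ge_0; auto; [lra|]; intros x _; apply B.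
  - assert (Hsc := ex_RInt_scal _ _ _ (k ^ 2) HK).
    replace (k ^ 2 * ellK k) with
      (RInt (fun x => scal (k ^ 2) (1 / sqrt (1 - k ^ 2 * sin x ^ 2))) 0 (PI / 2))
      by exact (RInt_scal _ _ _ (k ^ 2) HK).
    apply RInt_le; auto; [lra|]; intros x _; apply B.
Qed.

Lemma ellK_increasing (k1 k2 : R) : 0 <= k1 < k2 -> k2 < 1 -> ellK k1 < ellK k2.
Proof.
  intros H1 H2; assert (HP := PI_RGT_0).
  apply RInt_lt; [lra| | |].
  - intros x _; apply ex_derive_cont, ex_derive_ellK; lra.
  - intros x _; apply ex_derive_cont, ex_derive_ellK; lra.
  - intros x Hx; unfold Rdiv; rewrite !Rmult_1_l.
    assert (Hr := ell_radicand_pos k2 x ltac:(lra)).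
    assert (Hr1 := ell_radicand_pos k1 x ltac:(lra)).
    assert (Hs : 0 < sin x) by (apply sin_gt_0; lra).
    apply Rinv_lt_contravar.
    + apply Rmult_lt_0_compat; apply sqrt_lt_R0; auto.
    + apply sqrt_lt_1; try lra.
      assert (0 < sin x ^ 2) by (apply pow_lt; auto).
      assert (k1 ^ 2 < k2 ^ 2) by nra; nra.
Qed.

Lemma is_lim_seq_ellK_0 (u : nat -> R) : (forall n, 0 <= u n < 1) -> is_lim_seq u 0 ->
  is_lim_seq (fun n => ellK (u n)) (PI / 2).
Proof.
  intros Hu Hl.
  apply is_lim_seq_le_le with (fun _ => PI / 2) (fun n => PI / 2 * / sqrt (1 - u n ^ 2)).
  - intros n; now apply ellK_0_bound.
  - apply is_lim_seq_const.
  - replace (Finite (PI / 2)) with (Finite (PI / 2 * / sqrt (1 - 0 ^ 2))).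
    2: { f_equal; replace (1 - 0 ^ 2) with 1 by ring; rewrite sqrt_1; field. }
    apply is_lim_seq_mult'; [apply is_lim_seq_const|].
    apply (is_lim_seq_continuous (fun t => / sqrt (1 - t ^ 2)) u 0); auto.
    apply continuity_pt_filterlim.
    apply (ex_derive_cont (fun t => / sqrt (1 - t ^ 2))).
    auto_derive; replace (1 + - (0 * (0 * 1))) with 1 by ring.
    rewrite sqrt_1; lra.
Qed.

(** * Small steps: lattice sums of the hyperbolic secant as Riemann sums *)

Definition gd2 (x : R) : R := 2 * atan (exp x).

(** [gd2] is the Gudermannian function raised by [PI / 2], the primitive of [sech] that increases
    from 0 to [PI]. *)
Lemma is_derive_gd2 (x : R) : is_derive gd2 x (sech x).
Proof.
  unfold gd2; auto_derive; auto.
  unfold sech, cosh; rewrite exp_Ropp; assert (H := exp_pos x).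
  assert (0 < exp x * exp x + 1) by nra.
  field; repeat split; nra.
Qed.

Lemma cosh_increasing (x y : R) : 0 <= x <= y -> cosh x <= cosh y.
Proof.
  intros [H0 [H| ->]]; [|lra].
  replace x with (2 * (x / 2)) by field; replace y with (2 * (y / 2)) by field.
  rewrite !cosh_double.
  assert (sinh (x / 2) < sinh (y / 2)) by (apply sinh_lt; lra).
  assert (0 <= sinh (x / 2)).
  { destruct H0 as [H0| <-]; [left; apply sinh_pos; lra|].
    unfold Rdiv; rewrite Rmult_0_l, sinh_0; lra. }
  nra.
Qed.

Lemma sech_decreasing (x y : R) : 0 <= x <= y -> sech y <= sech x.
Proof.
  intros H; apply Rinv_le_contravar; [generalize (cosh_ge_1 x); lra|].
  now apply cosh_increasing.
Qed.

Lemma sech_le_1 (x : R) : sech x <= 1.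
Proof. unfold sech; rewrite <- Rinv_1; apply Rinv_le_contravar; [lra | apply cosh_ge_1]. Qed.

Lemma gd2_mvt (x y : R) : 0 <= x < y ->
  (y - x) * sech y <= gd2 y - gd2 x <= (y - x) * sech x.
Proof.
  intros H.
  destruct (MVT_gen gd2 x y sech) as [c [Hc E]].
  - intros t _; apply is_derive_gd2.
  - intros t _; apply continuity_pt_filterlim, (ex_derive_cont gd2); exists (sech t).
    apply is_derive_gd2.
  - minmax Hc.
    assert (sech y <= sech c <= sech x) by (split; apply sech_decreasing; lra).
    rewrite E; nra.
Qed.

Lemma gd2_0 : gd2 0 = PI / 2.
Proof. unfold gd2; rewrite exp_0, atan_1; field. Qed.

Lemma is_lim_seq_gd2 (h x : R) : 0 < h -> is_lim_seq (fun n => gd2 (x + INR n * h)) PI.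
Proof.
  intros Hh.
  apply is_lim_seq_ext with (fun n => PI - 2 * atan (exp (- (x + INR n * h)))).
  - intros n; unfold gd2; rewrite exp_Ropp, atan_inv by apply exp_pos.
    field.
  - apply (lim_eq _ (PI - 2 * atan 0)); [lim | rewrite atan_0; ring].
    apply (is_lim_seq_continuous atan).
    + apply continuity_pt_filterlim, (ex_derive_cont atan); auto_derive; auto.
    + now apply is_lim_seq_exp_lin.
Qed.

(** Comparison of a sum with an integral for a decreasing function: the Riemann sum exceeds the
    integral from [x] by at most its first term, which is at most [h], and the integral over
    [[0, x]] is at most [x]. *)
Lemma sech_half_sum_bound (h x : R) : 0 < h -> 0 <= x ->
  ex_series (fun n => sech (x + INR n * h)) ->
  Rabs (h * Series (fun n => sech (x + INR n * h)) - PI / 2) <= h + x.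
Proof.
  intros Hh Hx Hex.
  assert (T := is_series_telescoping _ _ (is_lim_seq_gd2 h x Hh)).
  assert (HT : ex_series (fun n => gd2 (x + INR (S n) * h) - gd2 (x + INR n * h)))
    by (eexists; exact T).
  assert (B : forall n, h * sech (x + INR (S n) * h)
     <= gd2 (x + INR (S n) * h) - gd2 (x + INR n * h) <= h * sech (x + INR n * h)).
  { intros n; assert (Hn := pos_INR n).
    destruct (gd2_mvt (x + INR n * h) (x + INR (S n) * h)) as [B1 B2];
      rewrite S_INR in *.
    - split; nra.
    - replace (x + (INR n + 1) * h - (x + INR n * h)) with h in B1, B2 by ring; lra. }
  assert (Hsc : ex_series (fun n => h * sech (x + INR n * h)))
    by exact (ex_series_scal_l h _ Hex).
  assert (U : PI - gd2 x <= h * Series (fun n => sech (x + INR n * h))).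
  { replace (PI - gd2 x) with (PI - gd2 (x + INR 0 * h)) by (do 2 f_equal; simpl; ring).
    rewrite <- (is_series_unique _ _ T), <- Series_scal_l.
    apply Series_le; auto; intros n; split; [|apply B].
    apply Rle_trans with (2 := proj1 (B n)); apply Rmult_le_pos; [lra|left; apply sech_pos]. }
  assert (L : h * Series (fun n => sech (x + INR n * h)) <= h + (PI - gd2 x)).
  { rewrite Series_incr_1, Rmult_plus_distr_l by auto.
    apply Rplus_le_compat.
    - generalize (sech_le_1 (x + INR 0 * h)); intros; nra.
    - replace (PI - gd2 x) with (PI - gd2 (x + INR 0 * h)) by (do 2 f_equal; simpl; ring).
      rewrite <- (is_series_unique _ _ T), <- Series_scal_l.
      apply Series_le; auto; intros n; split; [|apply B].
      apply Rmult_le_pos; [lra|left; apply sech_pos]. }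
  assert (G : 0 <= gd2 x - PI / 2 <= x).
  { rewrite <- gd2_0; destruct Hx as [Hx| <-]; [|lra].
    destruct (gd2_mvt 0 x ltac:(lra)) as [G1 G2]; generalize (sech_le_1 0) (sech_pos x); nra. }
  apply Rabs_le; lra.
Qed.

Lemma sech_sum_bound (h x : R) : 0 < h -> 0 <= x <= h ->
  Rabs (h * sech_sum h x - PI) <= 3 * h.
Proof.
  intros Hh Hx.
  destruct (ex_zsum_sech h x Hh) as [E1 E2].
  assert (F1 : forall n, sech (x + IZR (Z.of_nat n) * h) = sech (x + INR n * h))
    by (intros n; now rewrite <- INR_IZR_INZ).
  assert (F2 : forall n, sech (x + IZR (- Z.of_nat n - 1) * h) = sech (h - x + INR n * h)).
  { intros n; rewrite minus_IZR, opp_IZR, <- INR_IZR_INZ, <- sech_opp; f_equal; ring. }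
  apply ex_series_ext with (1 := F1) in E1; apply ex_series_ext with (1 := F2) in E2.
  unfold sech_sum, zsum; rewrite (Series_ext _ _ F1), (Series_ext _ _ F2).
  assert (B1 := sech_half_sum_bound h x Hh ltac:(lra) E1).
  assert (B2 := sech_half_sum_bound h (h - x) Hh ltac:(lra) E2).
  apply Rabs_le_between in B1; apply Rabs_le_between in B2; apply Rabs_le; lra.
Qed.

Lemma is_lim_seq_half_pow (h : R) : is_lim_seq (fun j => h / 2 ^ j) 0.
Proof.
  apply is_lim_seq_ext with (fun j => h * (/ 2) ^ j).
  - intros j; now rewrite pow_inv.
  - apply lim_scal0.
    apply lim_geom; lra.
Qed.

Lemma is_lim_seq_sech_sum (h t : R) : 0 < h -> 0 <= t <= 1 ->
  is_lim_seq (fun j => h / 2 ^ j * sech_sum (h / 2 ^ j) (t * (h / 2 ^ j))) PI.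
Proof.
  intros Hh Ht.
  apply is_lim_seq_le_le with (fun j => PI - 3 * (h / 2 ^ j)) (fun j => PI + 3 * (h / 2 ^ j)).
  - intros j.
    assert (Hj : 0 < h / 2 ^ j) by (apply Rdiv_lt_0_compat; auto; apply pow_lt; lra).
    generalize (sech_sum_bound _ (t * (h / 2 ^ j)) Hj ltac:(nra)).
    intros B; apply Rabs_le_between in B; lra.
  - apply (lim_eq _ (PI - 3 * 0)); [lim; apply is_lim_seq_half_pow | ring].
  - apply (lim_eq _ (PI + 3 * 0)); [lim; apply is_lim_seq_half_pow | ring].
Qed.

(** * The modulus attached to a step, and the values of the elliptic integrals *)

(** A function [dn] runs between its complementary modulus and 1, so this is the complementary
    modulus of the [dn] behind [sech_sum h]. Taken as [k], it gives [K' / K = h / PI], the ratio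
    prescribed by [h = PI * alpha]. *)
Definition modulus (h : R) : R := dn_min h / dn_max h.

Lemma modulus_bounds (h : R) : 0 < h -> 0 < modulus h < 1.
Proof.
  intros Hh; assert (H1 := dn_min_pos h Hh); assert (H2 := dn_min_lt_dn_max h Hh).
  unfold modulus; split; [apply Rdiv_lt_0_compat; lra|].
  apply Rmult_lt_reg_r with (dn_max h); [lra|].
  unfold Rdiv; rewrite Rmult_assoc, Rinv_l; lra.
Qed.

Lemma compl_modulus_double (h : R) : 0 < h ->
  compl_modulus (modulus h) = (1 - modulus (2 * h)) / (1 + modulus (2 * h)).
Proof.
  intros Hh; assert (H2 : 0 < 2 * h) by lra.
  assert (M2 := dn_max_ge_1 _ H2); assert (m2 := dn_min_pos _ H2).
  assert (L2 := dn_min_lt_dn_max _ H2); assert (M1 := dn_max_ge_1 _ Hh).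
  unfold compl_modulus.
  replace (1 - modulus h ^ 2) with (((1 - modulus (2 * h)) / (1 + modulus (2 * h))) ^ 2).
  - rewrite sqrt_pow2; auto.
    generalize (modulus_bounds _ H2); intros; apply Rdiv_le_0_compat; lra.
  - unfold modulus.
    replace (1 - (dn_min h / dn_max h) ^ 2) with ((dn_max h ^ 2 - dn_min h ^ 2) / dn_max h ^ 2)
      by (field; lra).
    rewrite dn_max2_sub_dn_min2, (dn_max_double h) by auto; field; lra.
Qed.

Lemma compl_modulus_bounds (k : R) : 0 < k < 1 -> 0 < compl_modulus k < 1.
Proof.
  intros H; unfold compl_modulus; split; [apply sqrt_lt_R0; nra|].
  rewrite <- sqrt_1 at 2; apply sqrt_lt_1; nra.
Qed.

Lemma compl_modulus_invol (k : R) : 0 < k < 1 -> sqrt (1 - compl_modulus k ^ 2) = k.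
Proof.
  intros H; unfold compl_modulus; rewrite pow2_sqrt by nra.
  replace (1 - (1 - k ^ 2)) with (k ^ 2) by ring; apply sqrt_pow2; lra.
Qed.

(** Landen's transformation with [c] the complementary modulus at [h]: then [l] is the modulus at
    [h], and [(1 - c) / (1 + c)] is the one at [2 h]. *)
Lemma ellK_modulus_double (h : R) : 0 < h ->
  ellK (modulus h) = (1 + modulus (2 * h)) * ellK (modulus (2 * h)).
Proof.
  intros Hh.
  assert (Hk := modulus_bounds h Hh); assert (Hk2 := modulus_bounds (2 * h) ltac:(lra)).
  assert (E := ellK_landen _ (compl_modulus_bounds _ Hk)).
  rewrite compl_modulus_invol, compl_modulus_double in E by auto.
  rewrite E; f_equal; [|f_equal]; field; lra.
Qed.

Lemma ellE_modulus_double (h : R) : 0 < h ->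
  (1 + modulus (2 * h)) * ellE (modulus h) =
  2 * ellE (modulus (2 * h)) - (1 - modulus (2 * h) ^ 2) * ellK (modulus (2 * h)).
Proof.
  intros Hh.
  assert (Hk := modulus_bounds h Hh); assert (Hk2 := modulus_bounds (2 * h) ltac:(lra)).
  assert (E := ellE_landen _ (compl_modulus_bounds _ Hk)).
  rewrite compl_modulus_invol, compl_modulus_double, ellK_modulus_double in E by auto.
  set (k2 := modulus (2 * h)) in *.
  (* The map [c -> (1 - c) / (1 + c)] is an involution, so the transformed modulus is [k2] again. *)
  replace ((1 - (1 - k2) / (1 + k2)) / (1 + (1 - k2) / (1 + k2))) with k2 in E by (field; lra).
  apply (f_equal (Rmult (1 + k2))) in E.
  replace ((1 + k2) * ((1 + (1 - k2) / (1 + k2)) * ellE k2)) with (2 * ellE k2) in E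
    by (field; lra).
  rewrite <- E; field; lra.
Qed.

Lemma ellK_compl_double (h : R) : 0 < h ->
  ellK (compl_modulus (modulus (2 * h))) =
  2 / (1 + modulus (2 * h)) * ellK (compl_modulus (modulus h)).
Proof.
  intros Hh; rewrite (compl_modulus_double h Hh).
  apply ellK_landen, modulus_bounds; lra.
Qed.

Lemma is_lim_seq_modulus (h : R) : 0 < h -> is_lim_seq (fun j => modulus (2 ^ j * h)) 0.
Proof.
  intros Hh; unfold modulus.
  replace (Finite 0) with (Finite (0 / 1)) by (f_equal; field).
  apply is_lim_seq_div'; [now apply is_lim_seq_dn_min | now apply is_lim_seq_dn_max | lra].
Qed.

(** The factor [1 + modulus (2 * h)] gained by [K] is also the ratio of [dn_max h] to
    [dn_max (2 * h)]. The quotient is therefore invariant under doubling, and its limit is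
    [K (0) = PI / 2]. *)
Theorem ellK_modulus (h : R) : 0 < h -> ellK (modulus h) = PI / 2 * dn_max h.
Proof.
  intros Hh.
  assert (E : ellK (modulus h) / dn_max h = PI / 2 / 1).
  { apply (doubling_const (fun h => ellK (modulus h) / dn_max h) 1); auto.
    - intros t Ht; assert (M2 := dn_max_ge_1 (2 * t) ltac:(lra)).
      assert (m2 := dn_min_pos (2 * t) ltac:(lra)).
      rewrite (ellK_modulus_double t), (dn_max_double t) by auto.
      unfold modulus; field; lra.
    - apply is_lim_seq_ext with (fun j => ellK (modulus (2 ^ j * h)) / dn_max (2 ^ j * h)).
      { intros j; rewrite pow1; ring. }
      apply is_lim_seq_div'; [|now apply is_lim_seq_dn_max|lra].
      apply is_lim_seq_ellK_0; [|now apply is_lim_seq_modulus].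
      intros n; generalize (modulus_bounds _ (pow2_mult_pos h n Hh)); lra. }
  assert (M := dn_max_ge_1 h Hh).
  replace (PI / 2) with (PI / 2 / 1) by field.
  rewrite <- E; field; lra.
Qed.

(** Here the step is halved: the quotient of [K'] by [h * dn_max h] does not change, while the
    complementary modulus tends to 0, [K'] to [PI / 2] and [h * dn_max h] to the integral [PI] of
    [sech]. *)
Theorem ellK_compl_modulus (h : R) : 0 < h ->
  ellK (compl_modulus (modulus h)) = h / 2 * dn_max h.
Proof.
  intros Hh.
  assert (Hpos : forall j, 0 < h / 2 ^ j).
  { intros j; apply Rdiv_lt_0_compat; auto; apply pow_lt; lra. }
  assert (Hj : forall j,
     ellK (compl_modulus (modulus (h / 2 ^ j))) * h / (h / 2 ^ j * dn_max (h / 2 ^ j))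
     = ellK (compl_modulus (modulus h)) / dn_max h).
  { induction j as [|j IH].
    - assert (M := dn_max_ge_1 h Hh).
      simpl; replace (h / 1) with h by field; field; lra.
    - rewrite <- IH; set (t := h / 2 ^ S j).
      assert (Ht : 0 < t) by apply Hpos.
      assert (E : h / 2 ^ j = 2 * t).
      { unfold t; simpl; field; apply pow_nonzero; lra. }
      rewrite E.
      assert (M2 := dn_max_ge_1 (2 * t) ltac:(lra)).
      assert (m2 := dn_min_pos (2 * t) ltac:(lra)).
      rewrite (ellK_compl_double t), (dn_max_double t) by auto.
      unfold modulus at 2; field; lra. }
  assert (LM : is_lim_seq (fun j => h / 2 ^ j * dn_max (h / 2 ^ j)) PI).
  { apply is_lim_seq_ext with (2 := is_lim_seq_sech_sum h 0 Hh ltac:(lra)).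
    intros j; now rewrite Rmult_0_l. }
  assert (Lm : is_lim_seq (fun j => h / 2 ^ j * dn_min (h / 2 ^ j)) PI).
  { apply is_lim_seq_ext with (2 := is_lim_seq_sech_sum h (/ 2) Hh ltac:(lra)).
    intros j; unfold dn_min; replace (/ 2 * (h / 2 ^ j)) with (h / 2 ^ j / 2) by (unfold Rdiv; ring).
    reflexivity. }
  assert (HP := PI_RGT_0).
  assert (Lk : is_lim_seq (fun j => modulus (h / 2 ^ j)) 1).
  { apply is_lim_seq_ext with
      (fun j => (h / 2 ^ j * dn_min (h / 2 ^ j)) / (h / 2 ^ j * dn_max (h / 2 ^ j))).
    - intros j; generalize (Hpos j) (dn_max_ge_1 _ (Hpos j)).
      set (t := h / 2 ^ j); unfold modulus; intros; field; lra.
    - replace (Finite 1) with (Finite (PI / PI)) by (f_equal; field; lra).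
      apply is_lim_seq_div'; auto; lra. }
  assert (Lc : is_lim_seq (fun j => compl_modulus (modulus (h / 2 ^ j))) 0).
  { unfold compl_modulus; rewrite <- sqrt_0.
    apply (is_lim_seq_continuous sqrt); [apply continuity_pt_sqrt; lra|].
    apply (lim_eq _ (1 - 1 * (1 * 1))); [simpl pow; lim | ring]. }
  assert (L : is_lim_seq (fun j =>
     ellK (compl_modulus (modulus (h / 2 ^ j))) * h / (h / 2 ^ j * dn_max (h / 2 ^ j)))
     (PI / 2 * h / PI)).
  { apply is_lim_seq_div'; auto; [|lra].
    apply is_lim_seq_mult'; [|apply is_lim_seq_const].
    apply is_lim_seq_ellK_0; auto.
    intros n; generalize (compl_modulus_bounds _ (modulus_bounds _ (Hpos n))); lra. }
  assert (E := lim_const_unique _ _ _ Hj L).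
  assert (M := dn_max_ge_1 h Hh).
  replace (h / 2) with (PI / 2 * h / PI) by (field; lra).
  rewrite <- E; field; lra.
Qed.

(** The difference [y] of the two sides satisfies [2 * y (2 h) = y h]. It vanishes because
    [2 ^ j * y (2 ^ j h)] tends to 0: [K (K - E)] is at most [(k K) ^ 2], a multiple of
    [dn_min ^ 2]. *)
Theorem ellE_modulus (h : R) : 0 < h ->
  ellK (modulus h) * (ellK (modulus h) - ellE (modulus h)) = 2 * PI ^ 2 * csch2_odd h.
Proof.
  intros Hh.
  set (y := fun h => ellK (modulus h) * (ellK (modulus h) - ellE (modulus h))
                     - 2 * PI ^ 2 * csch2_odd h).
  assert (L : y h = 0 - 2 * PI ^ 2 * 0); [|unfold y in L; lra].
  apply doubling_const with 2; auto.
  - intros t Ht; unfold y.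
    assert (M2 := dn_max_ge_1 (2 * t) ltac:(lra)).
    assert (Hk2 := modulus_bounds (2 * t) ltac:(lra)).
    assert (E1 := ellE_modulus_double t Ht); assert (E2 := csch2_odd_double t Ht).
    assert (E3 := ellK_modulus (2 * t) ltac:(lra)).
    assert (E4 := dn_min_double t Ht).
    assert (E5 : dn_min (2 * t) = modulus (2 * t) * dn_max (2 * t))
      by (unfold modulus; field; lra).
    rewrite (ellK_modulus_double t) by auto.
    set (k := modulus (2 * t)) in *; set (K := ellK k) in *; set (M := dn_max (2 * t)) in *.
    replace ((1 + k) * K * ((1 + k) * K - ellE (modulus t)))
      with (K * ((1 + k) ^ 2 * K - (1 + k) * ellE (modulus t))) by ring.
    rewrite E1.
    replace (csch2_odd t) with (2 * csch2_odd (2 * t) + dn_min t ^ 2 / 16) by lra.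
    rewrite E4, E5, E3; field.
  - apply is_lim_seq_ext with (fun j =>
      2 ^ j * (ellK (modulus (2 ^ j * h)) * (ellK (modulus (2 ^ j * h)) - ellE (modulus (2 ^ j * h))))
      - 2 * PI ^ 2 * (2 ^ j * csch2_odd (2 ^ j * h))).
    { intros j; unfold y; ring. }
    apply is_lim_seq_minus'.
    2: { apply is_lim_seq_mult'; [apply is_lim_seq_const|].
         apply is_lim_seq_decr; [auto | lra | apply csch2_odd_decr]. }
    apply is_lim_seq_le_le with (fun _ => 0)
      (fun j => (PI / 2) ^ 2 * (2 ^ j * dn_min (2 ^ j * h) ^ 2)).
    + intros j; assert (Hp := pow2_mult_pos h j Hh).
      assert (Hk := modulus_bounds _ Hp); assert (M := dn_max_ge_1 _ Hp).
      destruct (ellK_sub_ellE (modulus (2 ^ j * h)) ltac:(lra)) as [B1 B2].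
      assert (B3 := ellK_modulus _ Hp).
      assert (E5 : dn_min (2 ^ j * h) = modulus (2 ^ j * h) * dn_max (2 ^ j * h))
        by (unfold modulus; field; lra).
      assert (HK : 0 < ellK (modulus (2 ^ j * h)))
        by (rewrite B3; generalize PI_RGT_0; intros; nra).
      assert (H2j := pow2_ge_1 j).
      set (K := ellK (modulus (2 ^ j * h))) in *.
      split.
      * repeat apply Rmult_le_pos; lra.
      * replace ((PI / 2) ^ 2 * (2 ^ j * dn_min (2 ^ j * h) ^ 2))
          with (2 ^ j * (K * (modulus (2 ^ j * h) ^ 2 * K))) by (rewrite B3, E5; ring).
        apply Rmult_le_compat_l; [lra|]; apply Rmult_le_compat_l; lra.
    + apply is_lim_seq_const.
    + apply lim_scal0; now apply is_lim_seq_dn_min2.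
Qed.

(** [K' / K] is strictly decreasing in the modulus, so the prescribed ratio determines it. *)
Theorem modulus_unique (h k : R) : 0 < h -> 0 < k < 1 ->
  ellK (compl_modulus k) / ellK k = h / PI -> k = modulus h.
Proof.
  intros Hh Hk E; assert (HP := PI_RGT_0).
  assert (Hm := modulus_bounds h Hh); assert (M := dn_max_ge_1 h Hh).
  assert (E0 : ellK (compl_modulus (modulus h)) / ellK (modulus h) = h / PI).
  { rewrite ellK_modulus, ellK_compl_modulus by auto; field; lra. }
  assert (Hmono : forall a b, 0 < a < b -> b < 1 ->
     ellK (compl_modulus b) / ellK b < ellK (compl_modulus a) / ellK a).
  { intros a b H1 H2.
    assert (I1 : ellK a < ellK b) by (apply ellK_increasing; lra).
    assert (I2 : ellK (compl_modulus b) < ellK (compl_modulus a)).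
    { destruct (compl_modulus_bounds b ltac:(lra)), (compl_modulus_bounds a ltac:(lra)).
      apply ellK_increasing; auto; split; [lra|].
      unfold compl_modulus; apply sqrt_lt_1; nra. }
    destruct (ellK_0_bound a ltac:(lra)) as [P1 _].
    destruct (ellK_0_bound (compl_modulus b)) as [P2 _].
    { destruct (compl_modulus_bounds b ltac:(lra)); lra. }
    apply Rmult_lt_reg_r with (ellK a * ellK b); [nra|].
    replace (ellK (compl_modulus b) / ellK b * (ellK a * ellK b))
      with (ellK (compl_modulus b) * ellK a) by (field; lra).
    replace (ellK (compl_modulus a) / ellK a * (ellK a * ellK b))
      with (ellK (compl_modulus a) * ellK b) by (field; lra).
    apply Rmult_gt_0_lt_compat; lra. }
  destruct (Rtotal_order k (modulus h)) as [L|[L|L]]; auto; exfalso.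
  - generalize (Hmono k (modulus h) ltac:(lra) ltac:(lra)); lra.
  - generalize (Hmono (modulus h) k ltac:(lra) ltac:(lra)); lra.
Qed.

Theorem csch2_odd_ell (h k : R) : 0 < h -> 0 < k < 1 ->
  ellK (compl_modulus k) / ellK k = h / PI ->
  csch2_odd h = ellK k * (ellK k - ellE k) / (2 * PI ^ 2).
Proof.
  intros Hh Hk E; rewrite (modulus_unique h k Hh Hk E), ellE_modulus by auto.
  field; apply PI_neq0.
Qed.

Theorem csch2_even_ell (h k : R) : 0 < h -> 0 < k < 1 ->
  ellK (compl_modulus k) / ellK k = h / PI ->
  csch2_even h = / 24 - ellK k * (3 * ellE k - (2 - k ^ 2) * ellK k) / (6 * PI ^ 2).
Proof.
  intros Hh Hk E.
  rewrite csch2_even_eq, (csch2_odd_ell h k) by auto.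
  assert (HK : ellK k = PI / 2 * dn_max h)
    by (rewrite (modulus_unique h k Hh Hk E); now apply ellK_modulus).
  assert (M := dn_max_ge_1 h Hh); assert (HP := PI_RGT_0).
  assert (E1 : dn_max h = 2 * ellK k / PI) by (rewrite HK; field; lra).
  assert (E2 : dn_min h = k * dn_max h)
    by (rewrite (modulus_unique h k Hh Hk E); unfold modulus; field; lra).
  rewrite E2, E1; field; lra.
Qed.

(** * The complex exponential and estimates of moduli *)

Definition cexp (z : C) : C := (exp (Re z) * cos (Im z), exp (Re z) * sin (Im z)).

Lemma Cmod_cexp (z : C) : Cmod (cexp z) = exp (Re z).
Proof.
  unfold cexp, Cmod; simpl fst; simpl snd.
  replace ((exp (Re z) * cos (Im z)) ^ 2 + (exp (Re z) * sin (Im z)) ^ 2)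
    with (exp (Re z) ^ 2 * (sin (Im z) * sin (Im z) + cos (Im z) * cos (Im z))) by ring.
  rewrite (sin_cos_sqr (Im z)); rewrite Rmult_1_r.
  apply sqrt_pow2; left; apply exp_pos.
Qed.

Lemma C_eq (z w : C) : Re z = Re w -> Im z = Im w -> z = w.
Proof. destruct z, w; unfold Re, Im; simpl; intros -> ->; reflexivity. Qed.

Lemma im_le_Cmod (z : C) : Rabs (Im z) <= Cmod z.
Proof. apply Rle_trans with (2 := Rmax_Cmod z); apply Rmax_r. Qed.

Lemma Cmod_le_re_im (z : C) : Cmod z <= Rabs (Re z) + Rabs (Im z).
Proof.
  unfold Cmod; apply Rsqr_incr_0_var.
  - rewrite Rsqr_sqrt.
    + unfold Rsqr, Re, Im; rewrite <- (pow2_abs (fst z)), <- (pow2_abs (snd z)).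
      generalize (Rabs_pos (fst z)) (Rabs_pos (snd z)); intros; nra.
    + generalize (pow2_ge_0 (fst z)) (pow2_ge_0 (snd z)); lra.
  - generalize (Rabs_pos (Re z)) (Rabs_pos (Im z)); lra.
Qed.

Lemma norm2_neq_0 (z : C) : z <> 0 -> Re z ^ 2 + Im z ^ 2 <> 0.
Proof.
  intros H E; apply H, C_eq; simpl; generalize (pow2_ge_0 (Re z)) (pow2_ge_0 (Im z)); nra.
Qed.

(** * Continuity and differentiability of complex functions, componentwise *)

Definition ccont {T : UniformSpace} (f : T -> C) (t : T) : Prop :=
  continuous (fun s => Re (f s)) t /\ continuous (fun s => Im (f s)) t.

Section Ccont.
Context {T : UniformSpace}.

Lemma continuous_comp_derivable (f : R -> R) (g : T -> R) (t : T) :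
  (forall x, ex_derive f x) -> continuous g t -> continuous (fun s => f (g s)) t.
Proof. intros Hf Hg; apply continuous_comp; auto; now apply ex_derive_cont. Qed.

Lemma continuous_Rmult (f g : T -> R) (t : T) :
  continuous f t -> continuous g t -> continuous (fun s => f s * g s) t.
Proof. exact (continuous_mult (K := R_AbsRing) f g t). Qed.

Lemma continuous_Rplus (f g : T -> R) (t : T) :
  continuous f t -> continuous g t -> continuous (fun s => f s + g s) t.
Proof. exact (continuous_plus (V := R_NormedModule) f g t). Qed.

Lemma continuous_Rminus (f g : T -> R) (t : T) :
  continuous f t -> continuous g t -> continuous (fun s => f s - g s) t.
Proof. exact (continuous_minus (V := R_NormedModule) f g t). Qed.

Lemma continuous_Ropp (f : T -> R) (t : T) :
  continuous f t -> continuous (fun s => - f s) t.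
Proof. exact (continuous_opp (V := R_NormedModule) f t). Qed.

Lemma ccont_const (c : C) (t : T) : ccont (fun _ => c) t.
Proof. split; apply continuous_const. Qed.

Lemma ccont_plus (f g : T -> C) (t : T) :
  ccont f t -> ccont g t -> ccont (fun s => Cplus (f s) (g s)) t.
Proof. intros [F1 F2] [G1 G2]; split; now apply continuous_Rplus. Qed.

Lemma ccont_mult (f g : T -> C) (t : T) :
  ccont f t -> ccont g t -> ccont (fun s => Cmult (f s) (g s)) t.
Proof.
  intros [F1 F2] [G1 G2]; split.
  - apply continuous_Rminus; now apply continuous_Rmult.
  - apply continuous_Rplus; now apply continuous_Rmult.
Qed.

Lemma ccont_opp (f : T -> C) (t : T) : ccont f t -> ccont (fun s => Copp (f s)) t.
Proof. intros [F1 F2]; split; now apply continuous_Ropp. Qed.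

Lemma ccont_inv (f : T -> C) (t : T) :
  f t <> 0 -> ccont f t -> ccont (fun s => Cinv (f s)) t.
Proof.
  intros H [F1 F2].
  assert (D : continuous (fun s => / (Re (f s) ^ 2 + Im (f s) ^ 2)) t).
  { apply (continuous_comp (fun s => Re (f s) ^ 2 + Im (f s) ^ 2) Rinv).
    - apply continuous_Rplus;
        apply (continuous_comp_derivable (fun x => x ^ 2)); auto; intros; auto_derive; auto.
    - now apply continuous_Rinv, norm2_neq_0. }
  split; apply (continuous_Rmult _ _ t); auto; now apply continuous_Ropp.
Qed.

Lemma ccont_cexp (f : T -> C) (t : T) : ccont f t -> ccont (fun s => cexp (f s)) t.
Proof.
  intros [F1 F2]; split; apply (continuous_Rmult _ _ t).
  - apply (continuous_comp_derivable exp); auto; intros; auto_derive; auto.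
  - apply (continuous_comp_derivable cos); auto; intros; auto_derive; auto.
  - apply (continuous_comp_derivable exp); auto; intros; auto_derive; auto.
  - apply (continuous_comp_derivable sin); auto; intros; auto_derive; auto.
Qed.

End Ccont.

Notation C_US := (prod_UniformSpace R_UniformSpace R_UniformSpace).

Lemma ccont_comp {T : UniformSpace} (F : C -> C) (g : T -> C) (t : T) :
  ccont (T := C_US) F (g t) -> ccont g t -> ccont (fun s => F (g s)) t.
Proof.
  intros [F1 F2] [G1 G2]; split.
  - apply continuous_ext with (fun s => Re (F (fst (g s), snd (g s)))).
    { intros s; now rewrite <- surjective_pairing. }
    apply (continuous_comp_2 (fun s => fst (g s)) (fun s => snd (g s)) (fun a b => Re (F (a, b))));
      auto.
    rewrite <- surjective_pairing.
    apply continuous_ext with (2 := F1); intros s; now rewrite <- surjective_pairing.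
  - apply continuous_ext with (fun s => Im (F (fst (g s), snd (g s)))).
    { intros s; now rewrite <- surjective_pairing. }
    apply (continuous_comp_2 (fun s => fst (g s)) (fun s => snd (g s)) (fun a b => Im (F (a, b))));
      auto.
    rewrite <- surjective_pairing.
    apply continuous_ext with (2 := F2); intros s; now rewrite <- surjective_pairing.
Qed.

Definition cder (c : R -> C) (t : R) (d : C) : Prop :=
  is_derive (fun s => Re (c s)) t (Re d) /\ is_derive (fun s => Im (c s)) t (Im d).

Lemma is_derive_eq (f : R -> R) (x a b : R) : is_derive f x a -> a = b -> is_derive f x b.
Proof. intros H <-; exact H. Qed.

Lemma is_derive_Rmult (f g : R -> R) (x df dg : R) :
  is_derive f x df -> is_derive g x dg ->
  is_derive (fun t => f t * g t) x (df * g x + f x * dg).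
Proof. intros Hf Hg; apply (is_derive_mult f g x df dg Hf Hg Rmult_comm). Qed.

Lemma is_derive_Rplus (f g : R -> R) (x df dg : R) :
  is_derive f x df -> is_derive g x dg -> is_derive (fun t => f t + g t) x (df + dg).
Proof. intros Hf Hg; exact (is_derive_plus f g x df dg Hf Hg). Qed.

Lemma is_derive_Rminus (f g : R -> R) (x df dg : R) :
  is_derive f x df -> is_derive g x dg -> is_derive (fun t => f t - g t) x (df - dg).
Proof. intros Hf Hg; exact (is_derive_minus f g x df dg Hf Hg). Qed.

Lemma is_derive_Rcomp (f g : R -> R) (x df dg : R) :
  is_derive f (g x) df -> is_derive g x dg -> is_derive (fun t => f (g t)) x (dg * df).
Proof. intros Hf Hg; exact (is_derive_comp f g x df dg Hf Hg). Qed.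

Lemma cder_const (z : C) (t : R) : cder (fun _ => z) t 0.
Proof. split; apply @is_derive_const. Qed.

Lemma cder_plus (f g : R -> C) (t : R) (df dg : C) :
  cder f t df -> cder g t dg -> cder (fun s => Cplus (f s) (g s)) t (Cplus df dg).
Proof. intros [F1 F2] [G1 G2]; split; now apply is_derive_Rplus. Qed.

Lemma cder_mult (f g : R -> C) (t : R) (df dg : C) :
  cder f t df -> cder g t dg ->
  cder (fun s => Cmult (f s) (g s)) t (Cplus (Cmult df (g t)) (Cmult (f t) dg)).
Proof.
  intros [F1 F2] [G1 G2]; split.
  - eapply is_derive_eq; [apply is_derive_Rminus; apply is_derive_Rmult; eassumption|].
    unfold Cplus, Cmult, Re, Im; simpl; ring.
  - eapply is_derive_eq; [apply is_derive_Rplus; apply is_derive_Rmult; eassumption|].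
    unfold Cplus, Cmult, Re, Im; simpl; ring.
Qed.

Lemma cder_inv (f : R -> C) (t : R) (df : C) : f t <> 0 ->
  cder f t df -> cder (fun s => Cinv (f s)) t (Copp (Cmult df (Cmult (Cinv (f t)) (Cinv (f t))))).
Proof.
  intros H [F1 F2].
  assert (Hn := norm2_neq_0 _ H).
  assert (D : is_derive (fun s => Re (f s) ^ 2 + Im (f s) ^ 2) t
     (2 * Re (f t) * Re df + 2 * Im (f t) * Im df)).
  { eapply is_derive_eq.
    - apply is_derive_Rplus; apply (is_derive_Rcomp (fun x => x ^ 2)); try eassumption;
        auto_derive; auto.
    - simpl; ring. }
  assert (DI : is_derive (fun s => / (Re (f s) ^ 2 + Im (f s) ^ 2)) t
     ((2 * Re (f t) * Re df + 2 * Im (f t) * Im df) * - / (Re (f t) ^ 2 + Im (f t) ^ 2) ^ 2)).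
  { apply (is_derive_Rcomp Rinv); auto.
    auto_derive; auto; real_eq; field; auto. }
  split.
  - eapply is_derive_eq; [apply is_derive_Rmult; eassumption|].
    unfold Copp, Cinv, Cmult, Re, Im in *; simpl fst; simpl snd; cbv beta; field;
      intros Q; apply Hn; rewrite <- Q; ring.
  - eapply is_derive_eq;
      [apply is_derive_Rmult; [apply (is_derive_Rcomp Ropp); [auto_derive; auto|] |]; eassumption|].
    unfold Copp, Cinv, Cmult, Re, Im in *; simpl fst; simpl snd; cbv beta; field;
      intros Q; apply Hn; rewrite <- Q; ring.
Qed.

Lemma cder_cexp (f : R -> C) (t : R) (df : C) :
  cder f t df -> cder (fun s => cexp (f s)) t (Cmult (cexp (f t)) df).
Proof.
  intros [F1 F2]; split.
  - eapply is_derive_eq.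
    + apply is_derive_Rmult;
        [apply (is_derive_Rcomp exp) | apply (is_derive_Rcomp cos)]; try eassumption;
        auto_derive; auto.
    + unfold cexp, Cmult, Re, Im; simpl; ring.
  - eapply is_derive_eq.
    + apply is_derive_Rmult;
        [apply (is_derive_Rcomp exp) | apply (is_derive_Rcomp sin)]; try eassumption;
        auto_derive; auto.
    + unfold cexp, Cmult, Re, Im; simpl; ring.
Qed.

(** Differentiability is stated as a chain rule along every differentiable curve. Closure under
    products and inverses then reduces to real derivatives of components, and the curves [gam] can
    be inserted in either variable. Continuity of [F'] is required for differentiation under the
    integral sign. *)
Definition hol (F F' : C -> C) (z : C) : Prop :=
  (forall (c : R -> C) t d, c t = z -> cder c t d -> cder (fun s => F (c s)) t (Cmult (F' z) d))
  /\ ccont (T := C_US) F z /\ ccont (T := C_US) F' z.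

Definition hol_on (D : C -> Prop) (F : C -> C) : Prop :=
  exists F', forall z, D z -> hol F F' z.

Lemma cder_eq (c : R -> C) (t : R) (d e : C) : cder c t d -> d = e -> cder c t e.
Proof. intros H <-; exact H. Qed.

Section HolOn.
Variable D : C -> Prop.

Lemma hol_on_const (a : C) : hol_on D (fun _ => a).
Proof.
  exists (fun _ => RtoC 0); intros z _; split; [|split; apply ccont_const].
  intros c t d _ _; apply (cder_eq _ _ _ _ (cder_const a t)); ring.
Qed.

Lemma hol_on_plus (F G : C -> C) :
  hol_on D F -> hol_on D G -> hol_on D (fun z => Cplus (F z) (G z)).
Proof.
  intros [F' HF] [G' HG]; exists (fun z => Cplus (F' z) (G' z)); intros z Hz.
  destruct (HF z Hz) as [F1 [F2 F3]], (HG z Hz) as [G1 [G2 G3]].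
  split; [|split; now apply @ccont_plus].
  intros c t d E Hc; eapply cder_eq; [apply cder_plus; [apply F1 | apply G1]; eassumption|].
  ring.
Qed.

Lemma hol_on_mult (F G : C -> C) :
  hol_on D F -> hol_on D G -> hol_on D (fun z => Cmult (F z) (G z)).
Proof.
  intros [F' HF] [G' HG].
  exists (fun z => Cplus (Cmult (F' z) (G z)) (Cmult (F z) (G' z))); intros z Hz.
  destruct (HF z Hz) as [F1 [F2 F3]], (HG z Hz) as [G1 [G2 G3]].
  split; [|split; [|apply @ccont_plus]; now apply @ccont_mult].
  intros c t d E Hc; eapply cder_eq; [apply cder_mult; [apply F1 | apply G1]; eassumption|].
  cbv beta; rewrite E; ring.
Qed.

Lemma hol_on_inv (F : C -> C) :
  (forall z, D z -> F z <> 0) -> hol_on D F -> hol_on D (fun z => Cinv (F z)).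
Proof.
  intros H0 [F' HF].
  exists (fun z => Copp (Cmult (F' z) (Cmult (Cinv (F z)) (Cinv (F z))))); intros z Hz.
  destruct (HF z Hz) as [F1 [F2 F3]].
  assert (F z <> 0) by auto.
  split; [|split].
  - intros c t d E Hc; eapply cder_eq; [apply cder_inv; [rewrite E; auto|]; apply F1; eassumption|].
    cbv beta; rewrite E; ring.
  - now apply @ccont_inv.
  - apply @ccont_opp, @ccont_mult; auto; apply @ccont_mult; now apply @ccont_inv.
Qed.

Lemma hol_on_cexp (a : C) : hol_on D (fun z => cexp (Cmult a z)).
Proof.
  assert (Hid : forall z : C_US, ccont (T := C_US) (fun z => z) z).
  { intros [x y]; split; [apply @continuous_fst | apply @continuous_snd]. }
  assert (He : forall z : C_US, ccont (T := C_US) (fun z => cexp (Cmult a z)) z).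
  { intros z; apply @ccont_cexp, @ccont_mult; auto; apply @ccont_const. }
  exists (fun z => Cmult a (cexp (Cmult a z))); intros z _; split; [|split].
  - intros c t d E Hc; eapply cder_eq.
    + apply cder_cexp, cder_mult; [apply cder_const | eassumption].
    + cbv beta; rewrite E; ring.
  - apply He.
  - apply @ccont_mult; auto; apply @ccont_const.
Qed.

End HolOn.

(** * Translating the contour *)

(* [gam tau x = ln (1 + e^(2 i x)) - tau] for [- PI / 2 < x < PI / 2]. *)
Definition gam (tau x : R) : C := (ln (2 * cos x) - tau, x).
Definition dgam (x : R) : C := (- tan x, 1).
(** The imaginary part of [F dz] along the curve. With it, the fluxes through the ends are values of
    [Im F], which vanish where [F] is real. *)
Definition pull (F : C -> C) (tau x : R) : R := Im (Cmult (F (gam tau x)) (dgam x)).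
Definition upper (z : C) : Prop := 0 < Im z < PI / 2.

Lemma cos_pos_lt (x : R) : - (PI / 2) < x < PI / 2 -> 0 < cos x.
Proof. intros H; apply cos_gt_0; lra. Qed.

Lemma is_derive_ln_2cos (x : R) : - (PI / 2) < x < PI / 2 ->
  is_derive (fun x => ln (2 * cos x)) x (- tan x).
Proof.
  intros H; assert (Hc := cos_pos_lt x H).
  auto_derive; [lra|]; unfold tan; field; lra.
Qed.

Lemma cder_gam_x (tau x : R) : - (PI / 2) < x < PI / 2 ->
  cder (fun x => gam tau x) x (dgam x).
Proof.
  intros H; split; unfold gam, dgam, Re, Im; simpl.
  - eapply is_derive_eq; [apply is_derive_Rminus|].
    + now apply is_derive_ln_2cos.
    + apply @is_derive_const.
    + unfold zero; simpl; ring.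
  - apply @is_derive_id.
Qed.

Lemma cder_gam_tau (tau x : R) : cder (fun tau => gam tau x) tau (- (1))%C.
Proof.
  split; unfold gam, Re, Im; simpl.
  - auto_derive; auto; ring.
  - replace (- 0) with 0 by ring; apply @is_derive_const.
Qed.

Lemma ccont_gam_x (tau x : R) : - (PI / 2) < x < PI / 2 ->
  ccont (T := R_UniformSpace) (gam tau) x.
Proof.
  intros H; destruct (cder_gam_x tau x H) as [H1 H2].
  split; [apply (ex_derive_cont (fun x => Re (gam tau x))) |
          apply (ex_derive_cont (fun x => Im (gam tau x)))]; eexists; eassumption.
Qed.

Lemma ccont_dgam (x : R) : - (PI / 2) < x < PI / 2 ->
  ccont (T := R_UniformSpace) dgam x.
Proof.
  intros H; assert (Hc := cos_pos_lt x H).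
  split; unfold dgam, Re, Im; simpl; [|apply continuous_const].
  apply (ex_derive_cont (fun x => - tan x)); unfold tan; auto_derive; lra.
Qed.

Lemma ccont_gam2 (tau x : R) : - (PI / 2) < x < PI / 2 ->
  ccont (T := C_US) (fun p => gam (fst p) (snd p)) (tau, x).
Proof.
  intros H; split; unfold gam, Re, Im; simpl.
  - apply @continuous_Rminus; [|apply @continuous_fst].
    apply (continuous_comp snd (fun x => ln (2 * cos x))); [apply @continuous_snd|].
    apply ex_derive_cont; eexists; now apply is_derive_ln_2cos.
  - apply @continuous_snd.
Qed.

Lemma ccont_pull (F : C -> C) (tau x : R) : - (PI / 2) < x < PI / 2 ->
  ccont (T := C_US) F (gam tau x) -> continuous (pull F tau) x.
Proof.
  intros H HF.
  apply (ccont_mult (T := R_UniformSpace) (fun x => F (gam tau x)) dgam x).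
  - apply ccont_comp; auto; now apply ccont_gam_x.
  - now apply ccont_dgam.
Qed.

Lemma ccont_pull2 (F : C -> C) (tau x : R) : - (PI / 2) < x < PI / 2 ->
  ccont (T := C_US) F (gam tau x) ->
  continuity_2d_pt (fun tau x => pull F tau x) tau x.
Proof.
  intros H HF; apply continuity_2d_pt_filterlim.
  apply (ccont_mult (T := C_US) (fun p => F (gam (fst p) (snd p))) (fun p => dgam (snd p)) (tau, x)).
  - apply ccont_comp; auto; now apply ccont_gam2.
  - destruct (ccont_dgam x H) as [D1 D2]; split.
    + apply (continuous_comp snd (fun x => Re (dgam x))); auto; apply @continuous_snd.
    + apply (continuous_comp snd (fun x => Im (dgam x))); auto; apply @continuous_snd.
Qed.

Lemma ex_RInt_pull (F : C -> C) (tau a b : R) :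
  - (PI / 2) < a -> a <= b -> b < PI / 2 ->
  (forall x, a <= x <= b -> ccont (T := C_US) F (gam tau x)) -> ex_RInt (pull F tau) a b.
Proof.
  intros Ha Hab Hb HF; apply ex_RInt_cont.
  intros x Hx; minmax Hx.
  apply ccont_pull; [lra | auto].
Qed.

Lemma upper_gam (tau x : R) : 0 < x < PI / 2 -> upper (gam tau x).
Proof. intros H; exact H. Qed.

Lemma is_derive_pull_tau (F F' : C -> C) (tau x : R) : hol F F' (gam tau x) ->
  is_derive (fun tau => pull F tau x) tau (- pull F' tau x).
Proof.
  intros [H _].
  assert (Hd := H (fun tau => gam tau x) tau _ eq_refl (cder_gam_tau tau x)).
  destruct (cder_mult _ _ _ _ _ Hd (cder_const (dgam x) tau)) as [_ H2].
  eapply is_derive_eq; [exact H2|].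
  unfold pull, Cmult, Cplus, Copp, Re, Im; simpl; ring.
Qed.

Lemma is_derive_im_gam (F F' : C -> C) (tau x : R) : - (PI / 2) < x < PI / 2 ->
  hol F F' (gam tau x) -> is_derive (fun x => Im (F (gam tau x))) x (pull F' tau x).
Proof.
  intros Hx [H _].
  exact (proj2 (H (fun x => gam tau x) x _ eq_refl (cder_gam_x tau x Hx))).
Qed.

Lemma is_RInt_pull_derive (F F' : C -> C) (tau a b : R) :
  - (PI / 2) < a -> a <= b -> b < PI / 2 ->
  (forall x, a <= x <= b -> hol F F' (gam tau x)) ->
  is_RInt (pull F' tau) a b (Im (F (gam tau b)) - Im (F (gam tau a))).
Proof.
  intros Ha Hab Hb H.
  apply (is_RInt_deriv (fun x => Im (F (gam tau x))));
    intros x Hx; minmax Hx.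
  - apply is_derive_im_gam; [lra | auto].
  - apply ccont_pull; [lra|]; apply (H x Hx).
Qed.

(** Cauchy's theorem in differentiated form. Translation by [tau] turns the integrand [F dz] into
    [- F' dz], which is the exact derivative of [- F] along the curve, so only end values
    survive. *)
Lemma is_derive_shift (F F' : C -> C) (d X tau : R) :
  0 < d -> d <= X -> X < PI / 2 -> (forall z, upper z -> hol F F' z) ->
  is_derive (fun tau => RInt (pull F tau) d X) tau
    (Im (F (gam tau d)) - Im (F (gam tau X))).
Proof.
  intros Hd HdX HX H.
  assert (HP := PI_RGT_0).
  assert (Hder : forall t x, 0 < x < PI / 2 ->
     is_derive (fun tau => pull F tau x) t (- pull F' t x))
    by (intros t x Hx; now apply is_derive_pull_tau, H).
  assert (E : RInt (fun x => Derive (fun u => pull F u x) tau) d X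
     = Im (F (gam tau d)) - Im (F (gam tau X))).
  { transitivity (RInt (fun x => opp (pull F' tau x)) d X).
    - apply RInt_ext; intros x Hx; minmax Hx.
      apply is_derive_unique, Hder; lra.
    - assert (Hex : ex_RInt (pull F' tau) d X)
        by (apply ex_RInt_pull; try lra; intros x Hx; apply H, upper_gam; lra).
      transitivity (opp (RInt (pull F' tau) d X)); [exact (RInt_opp _ _ _ Hex)|].
      rewrite (is_RInt_unique _ _ _ _ (is_RInt_pull_derive F F' tau d X ltac:(lra) HdX HX
        (fun x Hx => H _ (upper_gam tau x ltac:(lra))))).
      unfold opp; simpl; ring. }
  rewrite <- E.
  apply (is_derive_RInt_param (fun tau x => pull F tau x)).
  - apply filter_forall; intros t x Hx; minmax Hx.
    eexists; apply Hder; lra.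
  - intros x Hx; minmax Hx.
    apply continuity_2d_pt_ext_loc with (fun u v => - pull F' u v).
    + assert (Hdd : 0 < Rmin x (PI / 2 - x)) by (apply Rmin_pos; lra).
      exists (mkposreal _ Hdd); simpl; intros u v _ Hv.
      symmetry; apply is_derive_unique, Hder.
      apply Rabs_lt_between in Hv.
      generalize (Rmin_l x (PI / 2 - x)) (Rmin_r x (PI / 2 - x)); lra.
    + apply continuity_2d_pt_opp, ccont_pull2; [lra|].
      apply H, upper_gam; lra.
  - apply filter_forall; intros t; apply ex_RInt_pull; try lra.
    intros x Hx; apply H, upper_gam; lra.
Qed.

Lemma ccont_im_gam_tau (F : C -> C) (tau x : R) :
  ccont (T := C_US) F (gam tau x) -> continuous (fun tau => Im (F (gam tau x))) tau.
Proof.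
  intros HF.
  apply (ccont_comp (T := R_UniformSpace) F (fun tau => gam tau x) tau HF).
  destruct (cder_gam_tau tau x) as [H1 H2].
  split; [apply (ex_derive_cont (fun tau => Re (gam tau x))) |
          apply (ex_derive_cont (fun tau => Im (gam tau x)))]; eexists; eassumption.
Qed.

Lemma shift_difference (F F' : C -> C) (d X L : R) :
  0 < d -> d <= X -> X < PI / 2 -> 0 < L -> (forall z, upper z -> hol F F' z) ->
  RInt (pull F L) d X - RInt (pull F 0) d X =
  RInt (fun tau => Im (F (gam tau d))) 0 L - RInt (fun tau => Im (F (gam tau X))) 0 L.
Proof.
  intros Hd HdX HX HL H.
  assert (Hc : forall x, 0 < x < PI / 2 -> forall tau, continuous (fun tau => Im (F (gam tau x))) tau).
  { intros x Hx tau; now apply ccont_im_gam_tau, H, upper_gam. }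
  assert (Hex : forall x, 0 < x < PI / 2 -> ex_RInt (fun tau => Im (F (gam tau x))) 0 L).
  { intros x Hx; apply ex_RInt_cont; intros t _.
    now apply Hc. }
  symmetry.
  transitivity (RInt (fun tau => minus (Im (F (gam tau d))) (Im (F (gam tau X)))) 0 L).
  { symmetry; apply (RInt_minus (V := R_CompleteNormedModule)); apply Hex; lra. }
  apply is_RInt_unique.
  apply (is_RInt_deriv (fun tau => RInt (pull F tau) d X)).
  - intros t _; now apply is_derive_shift with F'.
  - intros t _; apply (continuous_minus (V := R_NormedModule)); apply Hc; lra.
Qed.

Lemma continuous_eps (f : R -> R) (x eps : R) : continuous f x -> 0 < eps ->
  exists d, 0 < d /\ forall y, Rabs (y - x) < d -> Rabs (f y - f x) < eps.
Proof.
  intros Hf He.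
  destruct (proj1 (filterlim_locally _ _) Hf (mkposreal eps He)) as [d Hd].
  exists d; split; [apply cond_pos | exact Hd].
Qed.

Ltac rmin := first [apply Rle_refl
  | solve [eapply Rle_trans; [apply Rmin_l | rmin]] | solve [eapply Rle_trans; [apply Rmin_r | rmin]]].

(* Translating the contour through a removable singularity at [0] costs only the
   flux through its far end. *)
Theorem shift_crossing (F : C -> C) (X L r K B : R) :
  ln 2 < L -> 0 < X < PI / 2 -> 0 < r ->
  hol_on (fun z => upper z \/ (Im z = 0 /\ ln 2 - L <= Re z <= ln 2 /\ Re z <> 0)) F ->
  (forall u, ln 2 - L <= u <= ln 2 -> u <> 0 -> Im (F (u, 0)) = 0) ->
  (forall z, upper z -> Cmod z <= r -> Cmod (F z) <= K) ->
  (forall tau, 0 <= tau <= L -> Cmod (F (gam tau X)) <= B) ->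
  Rabs (RInt (pull F L) 0 X - RInt (pull F 0) 0 X) <= L * B.
Proof.
  intros HL HX Hr [F' HF] Hreal HK HB.
  assert (HP := PI_RGT_0).
  assert (Hln : 0 < ln 2) by (rewrite <- ln_1; apply ln_increasing; lra).
  assert (HK0 : 0 <= K).
  { assert (Hm : 0 < Rmin r (PI / 4)) by (apply Rmin_pos; lra).
    assert (Hl := Rmin_l r (PI / 4)); assert (Hl2 := Rmin_r r (PI / 4)).
    apply Rle_trans with (2 := HK (0, Rmin r (PI / 4)) ltac:(unfold upper, Im; simpl; lra)
      ltac:(apply Rle_trans with (1 := Cmod_le_re_im _); unfold Re, Im; simpl;
            rewrite Rabs_R0, Rabs_pos_eq; lra)).
    apply Cmod_ge_0. }
  assert (Hup : forall z, upper z -> hol F F' z) by (intros; apply HF; now left).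
  assert (Hre : forall tau, 0 <= tau <= L -> tau <> ln 2 ->
     ccont (T := C_US) F (gam tau 0) /\ Im (F (gam tau 0)) = 0).
  { intros t Ht Hne; unfold gam; rewrite cos_0, Rmult_1_r; split.
    - apply HF; right; unfold Re, Im; simpl; lra.
    - apply Hreal; lra. }
  assert (Hcont : forall tau, tau = 0 \/ tau = L -> forall x, 0 <= x <= X ->
     ccont (T := C_US) F (gam tau x)).
  { intros t Ht x [[Hx| <-] Hx2].
    - apply Hup, upper_gam; lra.
    - apply Hre; lra. }
  assert (Hex : forall tau, tau = 0 \/ tau = L -> forall a b, 0 <= a -> a <= b -> b <= X ->
     ex_RInt (pull F tau) a b).
  { intros t Ht a b Ha Hab Hb; apply ex_RInt_pull; try lra.
    intros x Hx; apply Hcont; auto; lra. }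
  assert (Harc : forall tau, tau = 0 \/ tau = L -> forall eps, 0 < eps ->
     exists d, 0 < d /\ forall x, 0 < x <= d -> x <= X -> Rabs (RInt (pull F tau) 0 x) <= eps).
  { intros t Ht eps Heps.
    assert (Hc0 : continuous (pull F t) 0) by (apply ccont_pull; [lra | apply Hcont; auto; lra]).
    destruct (continuous_eps _ _ 1 Hc0 Rlt_0_1) as [d1 [Hp1 Hd1]].
    set (M := Rabs (pull F t 0) + 1).
    assert (HM : 0 < M) by (unfold M; generalize (Rabs_pos (pull F t 0)); lra).
    exists (Rmin (d1 / 2) (eps / M)); split.
    { apply Rmin_pos; [lra | now apply Rdiv_lt_0_compat]. }
    intros x Hx HxX.
    assert (B1 := Rmin_l (d1 / 2) (eps / M)); assert (B2 := Rmin_r (d1 / 2) (eps / M)).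
    apply Rle_trans with ((x - 0) * M).
    - apply abs_RInt_le_const; [lra | apply Hex; auto; lra|].
      intros y Hy; assert (Q := Hd1 y ltac:(apply Rabs_lt_between; lra)).
      unfold M; generalize (Rabs_triang_inv (pull F t y) (pull F t 0)); lra.
    - rewrite Rminus_0_r; apply Rle_trans with (eps / M * M); [nra|].
      right; field; lra. }
  (* On the real axis [Im F] vanishes except at [0], near which [F] is bounded. *)
  assert (Hflux : forall eps, 0 < eps -> exists d, 0 < d /\ forall x, 0 < x <= d -> x <= X ->
     Rabs (RInt (fun tau => Im (F (gam tau x))) 0 L) <= eps).
  { intros eps Heps.
    (* The bound [r / 4] keeps the window of width [2 eta] around the singularity inside the disc
       where [F] is bounded by [K]; the bound by [K + 1] makes the window contribute at most
       [eps / 4]; the last two keep it away from the ends 0 and [L]. *)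
    set (eta := Rmin (Rmin (r / 4) (eps / (8 * (K + 1)))) (Rmin (ln 2 / 2) ((L - ln 2) / 2))).
    assert (Heta : 0 < eta).
    { unfold eta; repeat apply Rmin_pos; try lra; apply Rdiv_lt_0_compat; lra. }
    assert (E1 : eta <= r / 4) by rmin.
    assert (E2 : eta <= eps / (8 * (K + 1))) by rmin.
    assert (E3 : eta <= ln 2 / 2) by rmin.
    assert (E4 : eta <= (L - ln 2) / 2) by rmin.
    assert (E5 : eta * K <= eps / 8).
    { apply Rle_trans with (eps / (8 * (K + 1)) * (K + 1)); [nra|right; field; lra]. }
    assert (Hunif : forall a b, 0 <= a -> a <= b -> b <= L -> (b < ln 2 \/ ln 2 < a) ->
      exists d, 0 < d /\ forall x tau, 0 < x <= d -> a <= tau <= b ->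
        Rabs (Im (F (gam tau x))) <= eps / (4 * L)).
    { intros a b Ha Hab Hb Hside.
      assert (Heps2 : 0 < eps / (4 * L)) by (apply Rdiv_lt_0_compat; lra).
      destruct (uniform_continuity_2d_1d (fun tau x => Im (F (gam tau x))) a b 0)
        with (eps := mkposreal _ Heps2) as [d Hd].
      - intros t Ht; apply continuity_2d_pt_filterlim.
        apply (ccont_comp (T := C_US) F (fun p => gam (fst p) (snd p)) (t, 0)).
        + apply (Hre t); destruct Hside; lra.
        + apply ccont_gam2; lra.
      - exists d; split; [apply cond_pos|].
        intros x t Hx Ht.
        assert (Q := Hd t 0 t x Ht ltac:(generalize (cond_pos d); lra) Ht ltac:(lra)
          ltac:(rewrite Rminus_diag, Rabs_R0; apply cond_pos)).
        simpl in Q; rewrite (proj2 (Hre t ltac:(lra) ltac:(destruct Hside; lra))), Rminus_0_r in Q; lra. }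
    destruct (Hunif 0 (ln 2 - eta)) as [d1 [Hd1 U1]]; try lra.
    destruct (Hunif (ln 2 + eta) L) as [d2 [Hd2 U2]]; try lra.
    assert (Hln0 : continuous (fun x => ln (2 * cos x)) 0).
    { apply ex_derive_cont; eexists; apply is_derive_ln_2cos; lra. }
    destruct (continuous_eps _ _ eta Hln0 Heta) as [d3 [Hp3 Hd3]].
    exists (Rmin (Rmin d1 d2) (Rmin (d3 / 2) (Rmin (r / 2) (X / 2)))); split.
    { repeat apply Rmin_pos; lra. }
    intros x Hx HxX.
    set (m := Rmin (Rmin d1 d2) (Rmin (d3 / 2) (Rmin (r / 2) (X / 2)))) in *.
    assert (X1 : m <= d1) by rmin.
    assert (X2 : m <= d2) by rmin.
    assert (X3 : m <= d3 / 2) by rmin.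
    assert (X4 : m <= r / 2) by rmin.
    assert (Hxu : 0 < x < PI / 2) by lra.
    assert (Hexx : forall a b, ex_RInt (fun tau => Im (F (gam tau x))) a b).
    { intros a b; apply ex_RInt_cont; intros t _.
      now apply ccont_im_gam_tau, Hup, upper_gam. }
    rewrite <- (RInt_Chasles _ 0 (ln 2 - eta) L) by auto.
    rewrite <- (RInt_Chasles _ (ln 2 - eta) (ln 2 + eta) L) by auto.
    assert (I1 : Rabs (RInt (fun tau => Im (F (gam tau x))) 0 (ln 2 - eta)) <=
      (ln 2 - eta - 0) * (eps / (4 * L)))
      by (apply abs_RInt_le_const; [lra | apply Hexx | intros t Ht; apply U1; lra]).
    assert (I3 : Rabs (RInt (fun tau => Im (F (gam tau x))) (ln 2 + eta) L) <=
      (L - (ln 2 + eta)) * (eps / (4 * L)))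
      by (apply abs_RInt_le_const; [lra | apply Hexx | intros t Ht; apply U2; lra]).
    assert (I2 : Rabs (RInt (fun tau => Im (F (gam tau x))) (ln 2 - eta) (ln 2 + eta)) <=
      (ln 2 + eta - (ln 2 - eta)) * K).
    { apply abs_RInt_le_const; auto; [lra|].
      intros t Ht; apply Rle_trans with (1 := im_le_Cmod _).
      apply HK; [now apply upper_gam|].
      apply Rle_trans with (1 := Cmod_le_re_im _); unfold gam, Re, Im; simpl.
      rewrite (Rabs_pos_eq x) by lra.
      assert (Q := Hd3 x ltac:(apply Rabs_lt_between; lra)).
      rewrite cos_0, Rmult_1_r in Q; apply Rabs_lt_between in Q.
      assert (Rabs (ln (2 * cos x) - t) <= 2 * eta) by (apply Rabs_le; lra); lra. }
    assert (Heps4 : 0 < eps / (4 * L)) by (apply Rdiv_lt_0_compat; lra).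
    assert (HepsL : L * (eps / (4 * L)) = eps / 4) by (field; lra).
    unfold plus; simpl.
    eapply Rle_trans; [apply Rabs_triang|].
    eapply Rle_trans; [apply Rplus_le_compat_l, Rabs_triang|].
    nra. }
  (* The curves are cut at a small height [d]. The two pieces below it and the flux through height
     [d] cost at most [eps / 4] each; above it [shift_difference] applies. *)
  apply le_epsilon; intros eps Heps.
  destruct (Harc 0 ltac:(auto) (eps / 4)) as [d1 [Hd1 A1]]; [lra|].
  destruct (Harc L ltac:(auto) (eps / 4)) as [d2 [Hd2 A2]]; [lra|].
  destruct (Hflux (eps / 4)) as [d3 [Hd3 A3]]; [lra|].
  set (d := Rmin (Rmin d1 d2) (Rmin d3 X)).
  assert (Hd : 0 < d) by (unfold d; repeat apply Rmin_pos; lra).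
  assert (D1 : d <= d1) by rmin.
  assert (D2 : d <= d2) by rmin.
  assert (D3 : d <= d3) by rmin.
  assert (D4 : d <= X) by rmin.
  assert (Q0 := A1 d ltac:(lra) D4); assert (QL := A2 d ltac:(lra) D4).
  assert (QF := A3 d ltac:(lra) D4).
  assert (S := shift_difference F F' d X L Hd D4 (proj2 HX) ltac:(lra) Hup).
  assert (QB : Rabs (RInt (fun tau => Im (F (gam tau X))) 0 L) <= (L - 0) * B).
  { apply abs_RInt_le_const; [lra| |].
    - apply ex_RInt_cont; intros t _.
      apply ccont_im_gam_tau, Hup, upper_gam; lra.
    - intros t Ht; apply Rle_trans with (1 := im_le_Cmod _); auto. }
  rewrite <- (RInt_Chasles (pull F L) 0 d X) by (apply Hex; auto; lra).
  rewrite <- (RInt_Chasles (pull F 0) 0 d X) by (apply Hex; auto; lra).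
  unfold plus; simpl.
  apply Rabs_le_between in Q0; apply Rabs_le_between in QL.
  apply Rabs_le_between in QF; apply Rabs_le_between in QB.
  apply Rabs_le; lra.
Qed.

(** * Expansions of the exponential and of coth at 0 with explicit constants *)

Lemma mvt_abs_le (f df : R -> R) (M t : R) : 0 <= t <= 1 -> f 0 = 0 ->
  (forall s, 0 <= s <= 1 -> is_derive f s (df s)) ->
  (forall s, 0 <= s <= 1 -> Rabs (df s) <= M) -> Rabs (f t) <= M.
Proof.
  intros Ht H0 Hd HM.
  destruct (MVT_gen f 0 t df) as [c [Hc E]].
  - intros s Hs; minmax Hs; apply Hd; lra.
  - intros s Hs; minmax Hs.
    apply continuity_pt_filterlim, (ex_derive_cont f); exists (df s); apply Hd; lra.
  - minmax Hc.
    rewrite H0, !Rminus_0_r in E; rewrite E, Rabs_mult, (Rabs_pos_eq t) by lra.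
    generalize (HM c ltac:(lra)) (Rabs_pos (df c)); intros; nra.
Qed.

(** The factor 2 comes from applying the mean value theorem to the real and imaginary parts
    separately. *)
Lemma cder_bound (f df : R -> C) (M t : R) : 0 <= t <= 1 -> f 0 = 0%C ->
  (forall s, 0 <= s <= 1 -> cder f s (df s)) ->
  (forall s, 0 <= s <= 1 -> Cmod (df s) <= M) -> Cmod (f t) <= 2 * M.
Proof.
  intros Ht H0 Hd HM; apply Rle_trans with (1 := Cmod_le_re_im _).
  assert (Rabs (Re (f t)) <= M).
  { apply (mvt_abs_le (fun s => Re (f s)) (fun s => Re (df s))); auto.
    - now rewrite H0.
    - intros s Hs; apply (Hd s Hs).
    - intros s Hs; apply Rle_trans with (1 := re_le_Cmod _); auto. }
  assert (Rabs (Im (f t)) <= M); [|lra].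
  apply (mvt_abs_le (fun s => Im (f s)) (fun s => Im (df s))); auto.
  - now rewrite H0.
  - intros s Hs; apply (Hd s Hs).
  - intros s Hs; apply Rle_trans with (1 := im_le_Cmod _); auto.
Qed.

Section Taylor.
Open Scope C_scope.

Let two : C := 1 + 1.
Let three : C := 1 + two.

Lemma cexp_0 : cexp 0 = 1.
Proof. unfold cexp, Re, Im; simpl; rewrite exp_0, cos_0, sin_0; apply C_eq; simpl; ring. Qed.

Lemma cder_lin (X : C) (t : R) : cder (fun s => RtoC s * X) t X.
Proof.
  assert (Hid : cder (fun s => RtoC s) t 1).
  { split; unfold Re, Im; simpl; [apply @is_derive_id | apply @is_derive_const]. }
  apply (cder_eq _ _ _ _ (cder_mult _ _ _ _ _ Hid (cder_const X t))); cbv beta; ring.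
Qed.

(** The successive remainders [r1] to [r4] each have the previous one, times [X] and an integer, as
    derivative along the segment from 0 to [X]. Starting from the bound 3 for the exponential, each
    integration costs a factor 2, which yields [6], [12], [48] and [288]. *)
Lemma cexp_taylor (X : C) : (Cmod X <= 1)%R ->
  (Cmod (cexp X - 1 - X) <= 12 * Cmod X ^ 2)%R /\
  (Cmod (two * three * (cexp X - 1 - X) - three * X * X - X * X * X) <= 288 * Cmod X ^ 4)%R.
Proof.
  intros HX.
  set (y := fun t : R => RtoC t * X).
  assert (Hy : forall t, cder y t X) by (intros; apply cder_lin).
  assert (He : forall t, cder (fun s => cexp (y s)) t (cexp (y t) * X))
    by (intros; now apply cder_cexp).
  assert (P := Cmod_ge_0 X).
  assert (Y0 : y 0%R = 0) by (unfold y; ring).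
  assert (Y1 : y 1%R = X) by (unfold y; ring).
  set (r1 := fun t => cexp (y t) + (- (1))).
  set (r2 := fun t => r1 t + (- (1)) * y t).
  set (r3 := fun t => two * r2 t + (- (1)) * (y t * y t)).
  set (r4 := fun t => three * r3 t + (- (1)) * (y t * y t * y t)).
  assert (D1 : forall s, cder r1 s (cexp (y s) * X)).
  { intros s; apply (cder_eq _ _ _ _ (cder_plus _ _ _ _ _ (He s) (cder_const _ s))); ring. }
  assert (D2 : forall s, cder r2 s (r1 s * X)).
  { intros s; apply (cder_eq _ _ _ _ (cder_plus _ _ _ _ _ (D1 s)
      (cder_mult _ _ _ _ _ (cder_const _ s) (Hy s)))); unfold r1; ring. }
  assert (Hyy : forall s, cder (fun s => y s * y s) s (X * y s + y s * X))
    by (intros s; exact (cder_mult _ _ _ _ _ (Hy s) (Hy s))).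
  assert (D3 : forall s, cder r3 s (two * r2 s * X)).
  { intros s; apply (cder_eq _ _ _ _ (cder_plus _ _ _ _ _
      (cder_mult _ _ _ _ _ (cder_const two s) (D2 s))
      (cder_mult _ _ _ _ _ (cder_const _ s) (Hyy s)))); unfold r2, two; ring. }
  assert (D4 : forall s, cder r4 s (three * r3 s * X)).
  { intros s; apply (cder_eq _ _ _ _ (cder_plus _ _ _ _ _
      (cder_mult _ _ _ _ _ (cder_const three s) (D3 s))
      (cder_mult _ _ _ _ _ (cder_const _ s) (cder_mult _ _ _ _ _ (Hyy s) (Hy s)))));
      unfold r3, three, two; ring. }
  assert (B : forall (f df : R -> C) M, f 0%R = 0 -> (forall s, cder f s (df s * X)) ->
    (forall s, 0 <= s <= 1 -> Cmod (df s) <= M)%R ->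
    forall t, (0 <= t <= 1 -> Cmod (f t) <= 2 * (M * Cmod X))%R).
  { intros f df M H0 Hf HM t Ht.
    apply (cder_bound f (fun s => df s * X) (M * Cmod X)); [exact Ht | exact H0 | now intros |].
    intros s Hs; rewrite Cmod_mult; apply Rmult_le_compat_r; auto. }
  assert (T2 : Cmod two = 2%R).
  { unfold two; rewrite <- RtoC_plus, Cmod_R; apply Rabs_pos_eq; lra. }
  assert (T3 : Cmod three = 3%R).
  { unfold three, two; rewrite <- !RtoC_plus, Cmod_R; rewrite Rabs_pos_eq; lra. }
  assert (B0 : forall s, (0 <= s <= 1)%R -> (Cmod (cexp (y s)) <= 3)%R).
  { intros s Hs; rewrite Cmod_cexp.
    apply Rle_trans with (2 := exp_le_3).
    assert (Re (y s) <= 1)%R.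
    { unfold y; apply Rle_trans with (1 := Rle_abs _).
      apply Rle_trans with (1 := re_le_Cmod _).
      rewrite Cmod_mult, Cmod_R, Rabs_pos_eq by lra; nra. }
    destruct H as [H|H]; [left; now apply exp_increasing | rewrite H; lra]. }
  assert (Z1 : r1 0%R = 0) by (unfold r1; rewrite Y0, cexp_0; ring).
  assert (Z2 : r2 0%R = 0) by (unfold r2; rewrite Y0, Z1; ring).
  assert (Z3 : r3 0%R = 0) by (unfold r3; rewrite Y0, Z2; ring).
  assert (Z4 : r4 0%R = 0) by (unfold r4; rewrite Y0, Z3; ring).
  assert (B1 := B r1 _ _ Z1 D1 B0).
  assert (B2 := B r2 _ _ Z2 D2 B1).
  assert (B3 := B r3 (fun s => two * r2 s) (2 * (2 * (2 * (3 * Cmod X) * Cmod X)))%R Z3 D3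
    ltac:(intros s Hs; cbv beta; rewrite Cmod_mult, T2; generalize (B2 s Hs); lra)).
  assert (B4 := B r4 (fun s => three * r3 s)
    (3 * (2 * (2 * (2 * (2 * (3 * Cmod X) * Cmod X)) * Cmod X)))%R Z4 D4
    ltac:(intros s Hs; cbv beta; rewrite Cmod_mult, T3; generalize (B3 s Hs); lra)).
  specialize (B2 1%R ltac:(lra)); specialize (B4 1%R ltac:(lra)).
  unfold r4, r3, r2, r1 in B2, B4; rewrite Y1 in B2, B4.
  split.
  - replace (cexp X - 1 - X) with (cexp X + (- (1)) + (- (1)) * X) by ring.
    eapply Rle_trans; [exact B2|]; right; ring.
  - replace (two * three * (cexp X - 1 - X) - three * X * X - X * X * X)
      with (three * (two * (cexp X + (- (1)) + (- (1)) * X) + (- (1)) * (X * X))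
            + (- (1)) * (X * X * X)) by ring.
    eapply Rle_trans; [exact B4|]; right; ring.
Qed.

(* [coth (X / 2)] *)
Definition coth_half (X : C) : C := (cexp X + 1) / (cexp X - 1).

Lemma cexp_sub_1_ge (X : C) : (Cmod X <= / 24)%R -> (Cmod X / 2 <= Cmod (cexp X - 1))%R.
Proof.
  intros HX; assert (P := Cmod_ge_0 X).
  destruct (cexp_taylor X ltac:(lra)) as [T _].
  assert (Q := Cmod_triangle (cexp X - 1) (- (cexp X - 1 - X))).
  replace (cexp X - 1 + - (cexp X - 1 - X)) with X in Q by ring.
  rewrite Cmod_opp in Q; nra.
Qed.

(** A quadratic error is enough, since it will be multiplied by a double pole; the constant 1000 is
    generous. *)
Lemma coth_half_laurent (X : C) : X <> 0 -> (Cmod X <= / 24)%R ->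
  (Cmod (coth_half X - (2 / X + X / 6)) <= 1000 * Cmod X ^ 2)%R.
Proof.
  intros HX0 HX; assert (P := proj1 (Cmod_gt_0 X) HX0).
  assert (H1 := cexp_sub_1_ge X HX).
  destruct (cexp_taylor X ltac:(lra)) as [_ T].
  assert (HE : cexp X - 1 <> 0) by (apply Cmod_gt_0; lra).
  assert (C2 : RtoC 2 = two) by (unfold two; rewrite <- RtoC_plus; f_equal; ring).
  assert (C6 : RtoC 6 = two * three).
  { unfold three, two; rewrite <- !RtoC_plus, <- RtoC_mult; f_equal; ring. }
  assert (N2 : two <> 0) by (rewrite <- C2; intros Q; injection Q; lra).
  assert (N3 : three <> 0).
  { unfold three, two; rewrite <- !RtoC_plus; intros Q; injection Q; lra. }
  set (rest := two * three * (cexp X - 1 - X) - three * X * X - X * X * X) in *.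
  (* Clearing denominators by [36 * X * (cexp X - 1)] leaves only terms of order at least 4 on the
     right. The factor on the left has modulus at least [18 * Cmod X ^ 2], so the quotient is
     quadratic. *)
  assert (E : two * three * (two * three) * X * (cexp X - 1) * (coth_half X - (2 / X + X / 6))
     = three * X * X * X * X - X * X * X * X * X
       + (two * three * X - two * (two * three) - X * X) * rest).
  { transitivity (two * three * (two * three * X * (cexp X + 1)
       - (two * (two * three) + X * X) * (cexp X - 1))).
    - rewrite C2, C6; unfold coth_half; field; repeat split; auto.
    - unfold rest, three, two; ring. }
  assert (M6 : Cmod (two * three) = 6%R).
  { rewrite <- C6, Cmod_R; apply Rabs_pos_eq; lra. }
  assert (M2 : Cmod two = 2%R) by (rewrite <- C2, Cmod_R; apply Rabs_pos_eq; lra).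
  assert (M3 : Cmod three = 3%R).
  { unfold three, two; rewrite <- !RtoC_plus, Cmod_R; rewrite Rabs_pos_eq; lra. }
  set (D := coth_half X - (2 / X + X / 6)) in *.
  apply (f_equal Cmod) in E; rewrite 4!Cmod_mult, M6 in E.
  set (x := Cmod X) in *.
  assert (U : (Cmod (three * X * X * X * X - X * X * X * X * X
       + (two * three * X - two * (two * three) - X * X) * rest)
       <= 3 * x ^ 4 + x ^ 5 + (6 * x + 12 + x ^ 2) * (288 * x ^ 4))%R).
  { eapply Rle_trans; [apply Cmod_triangle|]; apply Rplus_le_compat.
    - eapply Rle_trans; [apply Cmod_triangle|]; apply Rplus_le_compat.
      + rewrite !Cmod_mult, M3; fold x; right; ring.
      + rewrite Cmod_opp, !Cmod_mult; fold x; right; ring.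
    - rewrite Cmod_mult; apply Rmult_le_compat; try apply Cmod_ge_0; auto.
      eapply Rle_trans; [apply Cmod_triangle|]; apply Rplus_le_compat.
      + eapply Rle_trans; [apply Cmod_triangle|]; apply Rplus_le_compat.
        * rewrite Cmod_mult, M6; fold x; lra.
        * rewrite Cmod_opp, Cmod_mult, M2, M6; lra.
      + rewrite Cmod_opp, Cmod_mult; fold x; right; ring. }
  rewrite <- E in U; clear E.
  assert (PD := Cmod_ge_0 D).
  assert (L : (18 * x ^ 2 * Cmod D <= 6 * 6 * x * Cmod (cexp X - 1) * Cmod D)%R).
  { apply Rmult_le_compat_r; auto; nra. }
  assert (x4 : (0 < x ^ 2)%R) by (apply pow_lt; auto).
  assert (V : (3 * x ^ 4 + x ^ 5 + (6 * x + 12 + x ^ 2) * (288 * x ^ 4)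
     <= x ^ 2 * (18 * 1000 * x ^ 2))%R).
  { replace (3 * x ^ 4 + x ^ 5 + (6 * x + 12 + x ^ 2) * (288 * x ^ 4))%R
      with (x ^ 4 * (3 + x + (6 * x + 12 + x ^ 2) * 288))%R by ring.
    replace (x ^ 2 * (18 * 1000 * x ^ 2))%R with (x ^ 4 * (18 * 1000))%R by ring.
    apply Rmult_le_compat_l; [left; apply pow_lt; auto|].
    assert (x ^ 2 <= 1)%R by nra; lra. }
  apply Rmult_le_reg_l with (18 * x ^ 2)%R; [lra|].
  lra.
Qed.

End Taylor.

Lemma im_plus_0 (z w : C) : Im z = 0 -> Im w = 0 -> Im (z + w)%C = 0.
Proof. unfold Im; simpl; intros; lra. Qed.

Lemma im_mult_0 (z w : C) : Im z = 0 -> Im w = 0 -> Im (z * w)%C = 0.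
Proof. unfold Im; simpl; intros -> ->; ring. Qed.

Lemma im_opp_0 (z : C) : Im z = 0 -> Im (- z)%C = 0.
Proof. unfold Im; simpl; intros ->; ring. Qed.

Lemma im_inv_0 (z : C) : Im z = 0 -> Im (/ z)%C = 0.
Proof. unfold Im; simpl; intros ->; unfold Rdiv; ring. Qed.

Lemma hol_on_ext (D : C -> Prop) (F G : C -> C) :
  (forall z, F z = G z) -> hol_on D F -> hol_on D G.
Proof.
  intros E [F' HF]; exists F'; intros z Hz.
  destruct (HF z Hz) as [H1 [[H2 H3] H4]].
  split; [|split; [split|exact H4]].
  - intros c t d Hc Hd; destruct (H1 c t d Hc Hd) as [D1 D2].
    split; [apply is_derive_ext with (2 := D1) | apply is_derive_ext with (2 := D2)];
      intros s; now rewrite E.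
  - apply continuous_ext with (2 := H2); intros s; now rewrite E.
  - apply continuous_ext with (2 := H3); intros s; now rewrite E.
Qed.

Lemma hol_on_cexp_id (D : C -> Prop) : hol_on D cexp.
Proof.
  apply hol_on_ext with (2 := hol_on_cexp D 1); intros z; f_equal; ring.
Qed.

Lemma Cmod_triangle_inv (z w : C) : Cmod z - Cmod w <= Cmod (z + w)%C.
Proof.
  assert (Q := Cmod_triangle (z + w) (- w)); rewrite Cmod_opp in Q.
  replace (z + w + - w)%C with z in Q by ring; lra.
Qed.

Lemma Cmod_sub_1_ge (z : C) : 1 - Cmod z <= Cmod (z - 1)%C.
Proof.
  assert (A := Cmod_triangle_inv (- (1))%C z); rewrite Cmod_opp, Cmod_1 in A.
  now replace (z - 1)%C with (- (1) + z)%C by ring.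
Qed.

Lemma Cmod_inv_le (z : C) (d : R) : 0 < d -> d <= Cmod z -> Cmod (/ z)%C <= / d.
Proof.
  intros Hd H; rewrite Cmod_inv by (apply Cmod_gt_0; lra).
  apply Rinv_le_contravar; auto.
Qed.

Lemma Cmod_Rpos (x : R) : 0 <= x -> Cmod (RtoC x) = x.
Proof. intros H; rewrite Cmod_R; now apply Rabs_pos_eq. Qed.

(** * The cotangent kernel *)

(* On the contour, [w = e^z = 1 + e^(2 i x)] and [amp 1 w dz = 4 i cos (2 x) dx];
   translating [z] by [ln s] replaces [amp 1] by [amp s]. *)
Definition amp (s : R) (w : C) : C := (s * w * (1 + / (s * w - 1) * / (s * w - 1)))%C.
Definition simple_pole (w : C) : C := (w * / (w - 1))%C.
Definition triple_pole (w : C) : C := (w * (w + 1) * (/ (w - 1) * / (w - 1) * / (w - 1)))%C.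

Section Kernel.
Variable alpha : R.
Hypothesis Halpha : 0 < alpha.

Let period := 2 * PI * alpha.

(* [cot (z / (2 alpha))] *)
Definition cot_ker (z : C) : C := (Ci * coth_half (Ci * RtoC (/ alpha) * z))%C.

(** The value of [amp s] at [w = 1], that is at [z = 0]. As [cot_ker] has residue [2 * alpha] there,
    the product has residue [2 * alpha * amp_at_1 s]. *)
Definition amp_at_1 (s : R) : R := s * (1 + / (s - 1) ^ 2).
(** The residue of [amp 1 (e^z) * cot (z / (2 alpha))] at 0. The summand [w] of the weight gives
    [2 alpha]; the rest is the coefficient of [1 / z] in [(1 / z ^ 2 - 1 / 12) * (2 alpha / z - z /
    (6 alpha))]. *)
Definition residue_0 : R := 2 * alpha - (/ (6 * alpha) + alpha / 6).

(* With [s = 1], the factor [amp] is itself singular at [0], whence the triple pole. *)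
Definition reduced (s a b : R) (z : C) : C :=
  (amp s (cexp z) * cot_ker z + RtoC a * simple_pole (cexp z) + RtoC b * triple_pole (cexp z))%C.

(** The strip containing the interiors of all translated curves, together with the real segment
    traced by their starting points, without the pole 0. *)
Definition dom (z : C) : Prop :=
  upper z \/ (Im z = 0 /\ ln 2 - period <= Re z <= ln 2 /\ Re z <> 0).

Hypothesis Hperiod : ln 2 < period.

Lemma cexp_im_pos (z : C) : upper z -> 0 < Im (cexp z).
Proof.
  intros H; unfold cexp, Im at 1; simpl.
  apply Rmult_lt_0_compat; [apply exp_pos|].
  unfold upper in H; apply sin_gt_0; generalize PI_RGT_0; lra.
Qed.

Lemma cexp_real (z : C) : Im z = 0 -> cexp z = RtoC (exp (Re z)).
Proof. intros H; unfold cexp; rewrite H, cos_0, sin_0; apply C_eq; unfold Re, Im; simpl; ring. Qed.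

Lemma dom_neq_1 (z : C) : dom z -> (cexp z - 1)%C <> 0.
Proof.
  intros [H|[H1 [H2 H3]]] E.
  - assert (P := cexp_im_pos z H); apply (f_equal Im) in E.
    unfold Im, Cminus, Cplus, Copp in *; simpl in *; lra.
  - rewrite cexp_real in E by auto; apply (f_equal Re) in E.
    unfold Re in *; simpl in *; apply H3.
    apply exp_inv; rewrite exp_0; lra.
Qed.

Lemma exp_period_lt : exp (- period) < / 2.
Proof.
  rewrite <- (exp_ln (/ 2)) by lra; apply exp_increasing; rewrite ln_Rinv; lra.
Qed.

(** For these [s] the weight is singular only where [e^z = 1 / s > 2], to the right of the
    region. *)
Lemma dom_neq_s (s : R) (z : C) : 0 < s <= exp (- period) -> dom z -> (s * cexp z - 1)%C <> 0.
Proof.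
  intros Hs [H|[H1 [H2 H3]]] E.
  - assert (P := cexp_im_pos z H); apply (f_equal Im) in E.
    unfold Im, Cminus, Cplus, Copp, Cmult in *; simpl in *; nra.
  - rewrite cexp_real in E by auto; apply (f_equal Re) in E.
    unfold Re in *; simpl in *.
    assert (exp (fst z) <= 2).
    { destruct (proj2 H2) as [Q| ->]; [|rewrite exp_ln; lra].
      left; rewrite <- (exp_ln 2) by lra; now apply exp_increasing. }
    generalize exp_period_lt (exp_pos (fst z)); intros; nra.
Qed.

Lemma ker_arg (z : C) : (Ci * RtoC (/ alpha) * z)%C = (- Im z / alpha, Re z / alpha).
Proof. apply C_eq; unfold Re, Im; simpl; unfold Rdiv; ring. Qed.

Lemma Cmod_ker_exp (z : C) : Cmod (cexp (Ci * RtoC (/ alpha) * z)) = exp (- Im z / alpha).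
Proof. now rewrite Cmod_cexp, ker_arg. Qed.

(** The zeros are the real multiples of [period]. In the strip the exponential has modulus below 1,
    and the real segment lies strictly between [- period] and [period], so 0 is the only multiple on
    it. *)
Lemma dom_neq_ker (z : C) : dom z -> (cexp (Ci * RtoC (/ alpha) * z) - 1)%C <> 0.
Proof.
  intros [H|[H1 [H2 H3]]] E.
  - assert (Q : cexp (Ci * RtoC (/ alpha) * z) = RtoC 1).
    { replace (cexp (Ci * RtoC (/ alpha) * z)) with (cexp (Ci * RtoC (/ alpha) * z) - 1 + 1)%C by ring.
      rewrite E; ring. }
    apply (f_equal Cmod) in Q; rewrite Cmod_ker_exp, Cmod_1 in Q.
    assert (0 < Im z / alpha) by (apply Rdiv_lt_0_compat; auto; apply H).
    rewrite <- exp_0 in Q; apply exp_inv in Q; unfold Rdiv in *; lra.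
  - rewrite ker_arg, H1 in E; apply (f_equal Re) in E.
    unfold Re, cexp, Im in E; simpl in E.
    replace (- 0 / alpha) with 0 in E by (unfold Rdiv; ring).
    rewrite exp_0 in E.
    set (t := fst z / alpha) in *.
    assert (Hc : cos (2 * (t / 2)) = 1) by (replace (2 * (t / 2)) with t by field; lra).
    rewrite cos_2a_sin in Hc.
    assert (Hln : 0 < ln 2) by (rewrite <- ln_1; apply ln_increasing; lra).
    assert (Hz : - period < fst z < period) by (unfold Re in H2; lra).
    assert (Hz0 : fst z <> 0) by exact H3.
    assert (Ht : fst z = t * alpha) by (unfold t; field; lra).
    rewrite Ht in Hz, Hz0; unfold period in Hz.
    assert (t < 2 * PI /\ - (2 * PI) < t) by nra.
    assert (t <> 0) by (intros Q; apply Hz0; rewrite Q; ring).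
    destruct (Rtotal_order t 0) as [L|[L|L]]; [|contradiction|].
    + assert (0 < sin (- (t / 2))) by (apply sin_gt_0; lra).
      rewrite sin_neg in *; nra.
    + assert (0 < sin (t / 2)) by (apply sin_gt_0; lra); nra.
Qed.

(* Syntactic on purpose: letting [apply] unify the function does not terminate. *)
Ltac hol_tac := unfold Cminus, Cdiv; cbv beta;
  lazymatch goal with
  | |- hol_on ?D (fun _ => ?a) => exact (hol_on_const D a)
  | |- hol_on ?D (fun z => Cplus (@?F z) (@?G z)) => apply (hol_on_plus D F G); hol_tac
  | |- hol_on ?D (fun z => Cmult (@?F z) (@?G z)) => apply (hol_on_mult D F G); hol_tac
  | |- hol_on ?D (fun z => Cinv (@?F z)) => apply (hol_on_inv D F); [|hol_tac]
  | |- hol_on ?D (fun z => cexp z) => exact (hol_on_cexp_id D)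
  | |- hol_on ?D (fun z => cexp (Cmult ?a z)) => exact (hol_on_cexp D a)
  end.

Lemma hol_on_cot_ker : hol_on dom cot_ker.
Proof. unfold cot_ker, coth_half; hol_tac; exact dom_neq_ker. Qed.

Lemma hol_on_simple_pole : hol_on dom (fun z => simple_pole (cexp z)).
Proof. unfold simple_pole; hol_tac; exact dom_neq_1. Qed.

Lemma hol_on_triple_pole : hol_on dom (fun z => triple_pole (cexp z)).
Proof. unfold triple_pole; hol_tac; exact dom_neq_1. Qed.

Lemma hol_on_amp (s : R) : s = 1 \/ 0 < s <= exp (- period) ->
  hol_on dom (fun z => amp s (cexp z)).
Proof.
  intros Hs.
  assert (H0 : forall z, dom z -> (s * cexp z - 1)%C <> 0).
  { intros z Hz; destruct Hs as [->|Hs]; [|now apply dom_neq_s].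
    replace (RtoC 1 * cexp z)%C with (cexp z) by ring; now apply dom_neq_1. }
  unfold amp; hol_tac; exact H0.
Qed.

Lemma hol_on_reduced (s a b : R) : s = 1 \/ 0 < s <= exp (- period) ->
  hol_on dom (reduced s a b).
Proof.
  intros Hs; apply hol_on_plus; [apply hol_on_plus|]; apply hol_on_mult.
  - now apply hol_on_amp.
  - exact hol_on_cot_ker.
  - exact (hol_on_const dom _).
  - exact hol_on_simple_pole.
  - exact (hol_on_const dom _).
  - exact hol_on_triple_pole.
Qed.

Lemma im_cot_ker_real (u : R) : Im (cot_ker (u, 0)) = 0.
Proof.
  assert (H : forall c s : R, s * s + c * c = 1 ->
    Im (Ci * (((c, s) + 1) / ((c, s) - 1)))%C = 0).
  { intros c s Q; unfold Im, Cdiv, Cinv, Cminus; simpl.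
    set (d := (c + - (1)) * ((c + - (1)) * 1) + (s + - 0) * ((s + - 0) * 1)).
    transitivity ((s * s + c * c - 1) * / d); [unfold Rdiv; ring | rewrite Q; ring]. }
  assert (E : cexp (Ci * RtoC (/ alpha) * (u, 0)) = (cos (u / alpha), sin (u / alpha))).
  { rewrite ker_arg; unfold cexp; simpl.
    replace (- 0 / alpha) with 0 by (unfold Rdiv; ring).
    now rewrite exp_0, !Rmult_1_l. }
  unfold cot_ker, coth_half; rewrite E; apply H, sin2_cos2.
Qed.

Lemma im_cexp_real (u : R) : Im (cexp (u, 0)) = 0.
Proof. rewrite cexp_real by reflexivity; reflexivity. Qed.

Ltac im_tac := unfold Cminus;
  lazymatch goal with
  | |- Im (Cplus _ _) = 0 => apply im_plus_0; im_tac
  | |- Im (Cmult _ _) = 0 => apply im_mult_0; im_tac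
  | |- Im (Copp _) = 0 => apply im_opp_0; im_tac
  | |- Im (Cinv _) = 0 => apply im_inv_0; im_tac
  | |- Im (RtoC _) = 0 => reflexivity
  | |- Im (cexp _) = 0 => apply im_cexp_real
  | |- Im (cot_ker _) = 0 => apply im_cot_ker_real
  end.

Lemma im_reduced_real (s a b u : R) : Im (reduced s a b (u, 0)) = 0.
Proof. unfold reduced, amp, simple_pole, triple_pole; im_tac. Qed.

(** * Boundedness of the reduced kernel near 0 *)

Definition laurent_radius : R := Rmin (/ 24) (alpha / 24).

Let kappa := - (/ (6 * alpha) + alpha / 6).
Let K1 := 1000 * (/ alpha ^ 2 + alpha).
(** [alpha * coth (z / 2)] has the same pole [2 alpha / z] as the cotangent and is rational in
    [e^z]. The difference is regular, with linear coefficient [kappa] at 0. *)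
Let hreg (z : C) : C := (cot_ker z - RtoC alpha * coth_half z)%C.

Lemma laurent_radius_pos : 0 < laurent_radius.
Proof. unfold laurent_radius; apply Rmin_pos; lra. Qed.

Lemma K1_pos : 0 < K1.
Proof.
  unfold K1; assert (0 < / alpha ^ 2) by (apply Rinv_0_lt_compat, pow_lt; auto); lra.
Qed.

(** Two instances of [coth_half_laurent], at [z] and at [i z / alpha]; [laurent_radius] keeps both
    arguments within its disc. The polar terms cancel. *)
Lemma hreg_bound (z : C) : z <> 0 -> Cmod z <= laurent_radius ->
  Cmod (hreg z - RtoC kappa * z)%C <= K1 * Cmod z ^ 2.
Proof.
  intros Hz Hr; assert (P := proj1 (Cmod_gt_0 z) Hz).
  assert (R1 := Rmin_l (/ 24) (alpha / 24)); assert (R2 := Rmin_r (/ 24) (alpha / 24)).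
  fold laurent_radius in R1, R2.
  set (lam := (Ci * RtoC (/ alpha))%C).
  assert (Hi : 0 < / alpha) by now apply Rinv_0_lt_compat.
  assert (HCi : Ci <> 0) by (intros Q; apply (f_equal Im) in Q; unfold Im in Q; simpl in Q; lra).
  assert (Ha : RtoC alpha <> 0) by (intros Q; injection Q; lra).
  assert (Hl : lam <> 0).
  { apply Cmult_neq_0; auto; intros Q; injection Q; lra. }
  assert (Ml : Cmod lam = / alpha).
  { unfold lam; rewrite Cmod_mult, Cmod_Ci, Cmod_Rpos by lra; ring. }
  assert (Mlz : Cmod (lam * z)%C = / alpha * Cmod z) by (now rewrite Cmod_mult, Ml).
  assert (T1 := coth_half_laurent z Hz ltac:(lra)).
  assert (T2 := coth_half_laurent (lam * z)%C ltac:(now apply Cmult_neq_0)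
    ltac:(rewrite Mlz; apply Rmult_le_reg_l with alpha; auto; field_simplify; lra)).
  rewrite Mlz in T2.
  assert (H6 : RtoC 6 <> 0) by (intros Q; injection Q; lra).
  assert (E : (hreg z - RtoC kappa * z)%C =
     (Ci * (coth_half (lam * z) - (2 / (lam * z) + lam * z / 6))
      + - (RtoC alpha * (coth_half z - (2 / z + z / 6))))%C).
  { unfold hreg, cot_ker; fold lam.
    assert (EC : (Ci * Ci)%C = (- (1))%C) by (apply C_eq; unfold Re, Im; simpl; ring).
    assert (Ek : RtoC kappa = (- (/ (RtoC 6 * RtoC alpha) + RtoC alpha / RtoC 6))%C).
    { unfold kappa; rewrite RtoC_opp, RtoC_plus, RtoC_inv, RtoC_mult, RtoC_div by
        (try apply Rmult_integral_contrapositive_currified; lra); reflexivity. }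
    assert (El : (Ci * (2 / (lam * z) + lam * z / 6) =
                  RtoC 2 * RtoC alpha / z - z / (RtoC 6 * RtoC alpha))%C).
    { unfold lam; rewrite RtoC_inv by lra.
      transitivity (RtoC 2 * RtoC alpha / z + (Ci * Ci) * (z / (RtoC 6 * RtoC alpha)))%C.
      - field; repeat split; auto.
      - rewrite EC; unfold Cminus; ring. }
    rewrite Ek.
    transitivity (Ci * coth_half (lam * z) - RtoC alpha * coth_half z
      - (RtoC 2 * RtoC alpha / z - z / (RtoC 6 * RtoC alpha))
      + RtoC alpha * (RtoC 2 / z + z / RtoC 6))%C.
    - field; repeat split; auto.
    - rewrite <- El; ring. }
  rewrite E; eapply Rle_trans; [apply Cmod_triangle|].
  rewrite Cmod_opp, !Cmod_mult, Cmod_Ci, Cmod_Rpos by lra.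
  unfold K1; replace (/ alpha ^ 2) with ((/ alpha) ^ 2) by (field; lra).
  replace (1000 * ((/ alpha) ^ 2 + alpha) * Cmod z ^ 2) with
    (1 * (1000 * (/ alpha * Cmod z) ^ 2) + alpha * (1000 * Cmod z ^ 2)) by ring.
  apply Rplus_le_compat; apply Rmult_le_compat_l; lra.
Qed.

Lemma cexp_near_0 (z : C) : z <> 0 -> Cmod z <= / 24 ->
  (cexp z - 1)%C <> 0 /\ Cmod (/ (cexp z - 1))%C <= 2 / Cmod z /\
  Cmod (cexp z) <= 17 / 16 /\ Cmod (cexp z - 1 - z)%C <= 12 * Cmod z ^ 2.
Proof.
  intros Hz Hr; assert (P := proj1 (Cmod_gt_0 z) Hz).
  assert (G := cexp_sub_1_ge z Hr).
  destruct (cexp_taylor z ltac:(lra)) as [T _].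
  split; [apply Cmod_gt_0; lra|split; [|split; auto]].
  - replace (2 / Cmod z) with (/ (Cmod z / 2)) by (field; lra).
    apply Cmod_inv_le; lra.
  - replace (cexp z) with (1 + (z + (cexp z - 1 - z)))%C by ring.
    assert (A := Cmod_triangle 1 (z + (cexp z - 1 - z))%C).
    assert (B := Cmod_triangle z (cexp z - 1 - z)%C).
    rewrite Cmod_1 in A; nra.
Qed.

Lemma hreg_le (z : C) : z <> 0 -> Cmod z <= laurent_radius -> Cmod (hreg z) <= Rabs kappa + K1.
Proof.
  intros Hz Hr; assert (Q := hreg_bound z Hz Hr).
  assert (R1 := Rmin_l (/ 24) (alpha / 24)); fold laurent_radius in R1.
  replace (hreg z) with ((hreg z - RtoC kappa * z) + RtoC kappa * z)%C by ring.
  assert (A := Cmod_triangle (hreg z - RtoC kappa * z)%C (RtoC kappa * z)%C).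
  rewrite Cmod_mult, Cmod_R in A.
  assert (HK := K1_pos); assert (P := Cmod_ge_0 z).
  assert (Cmod z ^ 2 <= 1) by nra.
  assert (K1 * Cmod z ^ 2 <= K1 * 1) by (apply Rmult_le_compat_l; lra).
  assert (Rabs kappa * Cmod z <= Rabs kappa * 1)
    by (apply Rmult_le_compat_l; [apply Rabs_pos | lra]).
  lra.
Qed.

Lemma reduced_1_bounded : exists K, forall z : C, z <> 0 -> Cmod z <= laurent_radius ->
  Cmod (reduced 1 (- residue_0) (- alpha) z) <= K.
Proof.
  exists (17 / 16 * ((Rabs kappa + K1) + alpha) + 17 / 16 * 4 * (K1 + 12 * Rabs kappa)).
  intros z Hz Hr; assert (P := proj1 (Cmod_gt_0 z) Hz).
  assert (R1 := Rmin_l (/ 24) (alpha / 24)); fold laurent_radius in R1.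
  destruct (cexp_near_0 z Hz ltac:(lra)) as [E1 [E2 [E3 E4]]].
  assert (H1 := hreg_bound z Hz Hr); assert (H2 := hreg_le z Hz Hr).
  (* The cubic terms cancel identically in [w]. The double pole that remains multiplies
     [hreg z - kappa (w - 1)], which vanishes to second order. *)
  assert (E : reduced 1 (- residue_0) (- alpha) z = (cexp z * (hreg z + RtoC alpha)
     + cexp z * (/ (cexp z - 1) * / (cexp z - 1)) *
       ((hreg z - RtoC kappa * z) + - (RtoC kappa * (cexp z - 1 - z))))%C).
  { unfold reduced, amp, simple_pole, triple_pole, hreg, coth_half.
    replace (- residue_0) with (- (alpha + alpha + kappa))
      by (unfold residue_0, kappa; ring).
    rewrite !RtoC_opp, !RtoC_plus.
    replace (RtoC 1 * cexp z)%C with (cexp z) by ring.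
    set (w := cexp z) in *.
    field; auto. }
  rewrite E; eapply Rle_trans; [apply Cmod_triangle|].
  apply Rplus_le_compat.
  - rewrite Cmod_mult; apply Rmult_le_compat; try apply Cmod_ge_0; auto.
    eapply Rle_trans; [apply Cmod_triangle|]; rewrite Cmod_Rpos by lra; lra.
  - assert (Q : Cmod ((hreg z - RtoC kappa * z) + - (RtoC kappa * (cexp z - 1 - z)))%C
       <= (K1 + 12 * Rabs kappa) * Cmod z ^ 2).
    { eapply Rle_trans; [apply Cmod_triangle|].
      rewrite Cmod_opp, (Cmod_mult (RtoC kappa)), Cmod_R.
      generalize (Rabs_pos kappa); intros; nra. }
    rewrite 3!Cmod_mult.
    apply Rle_trans with (17 / 16 * (2 / Cmod z * (2 / Cmod z)) *
      ((K1 + 12 * Rabs kappa) * Cmod z ^ 2)); [|right; field; lra].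
    assert (G := Cmod_ge_0 (/ (cexp z - 1))%C).
    apply Rmult_le_compat; try apply Cmod_ge_0; auto.
    + repeat apply Rmult_le_pos; apply Cmod_ge_0.
    + apply Rmult_le_compat; try apply Cmod_ge_0; auto.
      * apply Rmult_le_pos; auto.
      * apply Rmult_le_compat; auto.
Qed.

(** The simple pole is removed because [amp s w - amp_at_1 s * w] vanishes at [w = 1]; its quotient
    by [w - 1] is computed explicitly. *)
Lemma reduced_bounded (s : R) : 0 < s <= / 2 ->
  exists K, forall z : C, z <> 0 -> Cmod z <= laurent_radius ->
  Cmod (reduced s (- (2 * alpha * amp_at_1 s)) 0 z) <= K.
Proof.
  intros Hs.
  exists (1 * (17 / 16) * (1 + 4 * 4) * ((Rabs kappa + K1) + alpha)
    + (2 * alpha * s ^ 2 * / (s - 1) ^ 2) * (17 / 16 * (4 * 4) * (17 / 16 + 3))).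
  intros z Hz Hr; assert (P := proj1 (Cmod_gt_0 z) Hz).
  assert (R1 := Rmin_l (/ 24) (alpha / 24)); fold laurent_radius in R1.
  destruct (cexp_near_0 z Hz ltac:(lra)) as [E1 [E2 [E3 E4]]].
  assert (H2 := hreg_le z Hz Hr).
  assert (Hs1 : RtoC (s - 1) <> 0) by (intros Q; injection Q; lra).
  (* Near 0 the modulus of [s * e^z] is at most [1 / 2 * 17 / 16 = 17 / 32]. *)
  assert (G : / 4 <= Cmod (s * cexp z - 1)%C).
  { assert (A := Cmod_sub_1_ge (s * cexp z)%C); rewrite Cmod_mult, Cmod_Rpos in A by lra.
    generalize (Cmod_ge_0 (cexp z)); intros; nra. }
  assert (G0 : (s * cexp z - 1)%C <> 0) by (apply Cmod_gt_0; lra).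
  assert (GI : Cmod (/ (s * cexp z - 1))%C <= 4).
  { rewrite <- (Rinv_inv 4); apply Cmod_inv_le; lra. }
  assert (E : reduced s (- (2 * alpha * amp_at_1 s)) 0 z = (amp s (cexp z) * (hreg z + RtoC alpha)
     + RtoC (- (2 * alpha * s ^ 2 * / (s - 1) ^ 2)) *
       (cexp z * (/ (s * cexp z - 1) * / (s * cexp z - 1)) * (s * cexp z + RtoC (s - 2))))%C).
  { unfold reduced, amp, simple_pole, hreg, coth_half, amp_at_1.
    set (w := cexp z) in *.
    replace (- (2 * alpha * (s * (1 + / (s - 1) ^ 2))))
      with (- ((alpha + alpha) * (s * (1 + / (s - 1) * / (s - 1))))) by (field; lra).
    replace (- (2 * alpha * s ^ 2 * / (s - 1) ^ 2))
      with (- ((alpha + alpha) * (s * s) * (/ (s - 1) * / (s - 1)))) by (field; lra).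
    replace (s - 2) with (s - 1 - 1) by ring.
    rewrite !RtoC_opp, !RtoC_mult, !RtoC_plus, !RtoC_mult, RtoC_inv, !RtoC_minus by lra.
    rewrite RtoC_minus in Hs1.
    rewrite Cmult_0_l, Cplus_0_r; field; repeat split; auto. }
  rewrite E; eapply Rle_trans; [apply Cmod_triangle|].
  apply Rplus_le_compat.
  - rewrite Cmod_mult; apply Rmult_le_compat; try apply Cmod_ge_0.
    + unfold amp; rewrite !Cmod_mult, Cmod_Rpos by lra.
      apply Rmult_le_compat; try apply Cmod_ge_0.
      * apply Rmult_le_pos; [lra | apply Cmod_ge_0].
      * apply Rmult_le_compat; try apply Cmod_ge_0; lra.
      * eapply Rle_trans; [apply Cmod_triangle|]; rewrite Cmod_1, Cmod_mult.
        apply Rplus_le_compat_l, Rmult_le_compat; try apply Cmod_ge_0; auto.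
    + eapply Rle_trans; [apply Cmod_triangle|]; rewrite Cmod_Rpos by lra; lra.
  - assert (C0 : 0 <= 2 * alpha * s ^ 2 * / (s - 1) ^ 2).
    { apply Rmult_le_pos; [nra|]; left; apply Rinv_0_lt_compat; nra. }
    rewrite Cmod_mult, RtoC_opp, Cmod_opp, Cmod_Rpos by auto.
    apply Rmult_le_compat_l; auto.
    rewrite !Cmod_mult.
    assert (G1 := Cmod_ge_0 (/ (s * cexp z - 1))%C).
    assert (G2 := Cmod_ge_0 (cexp z)).
    apply Rmult_le_compat; try apply Cmod_ge_0.
    + repeat apply Rmult_le_pos; auto.
    + apply Rmult_le_compat; auto; [apply Rmult_le_pos; auto|].
      apply Rmult_le_compat; auto.
    + eapply Rle_trans; [apply Cmod_triangle|].
      rewrite Cmod_mult, Cmod_Rpos, Cmod_R by lra.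
      assert (Rabs (s - 2) <= 3) by (apply Rabs_le; lra); nra.
Qed.

(** * Decay towards the far end of the curve *)

Definition cot_bound : R := (1 + exp (- / alpha)) / (1 - exp (- / alpha)).

Lemma cot_bound_pos : 0 < cot_bound.
Proof.
  assert (Hi : 0 < / alpha) by now apply Rinv_0_lt_compat.
  destruct (exp_opp_lt_1 _ Hi); apply Rdiv_lt_0_compat; lra.
Qed.

Lemma cot_ker_le (z : C) : 1 <= Im z -> Cmod (cot_ker z) <= cot_bound.
Proof.
  intros Hz; unfold cot_ker, coth_half.
  assert (Hi : 0 < / alpha) by now apply Rinv_0_lt_compat.
  assert (Hf := exp_opp_lt_1 _ Hi).
  assert (M := Cmod_ker_exp z).
  assert (L : exp (- Im z / alpha) <= exp (- / alpha)).
  { assert (- Im z / alpha <= - / alpha) by (unfold Rdiv; nra).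
    destruct H as [H|H]; [left; now apply exp_increasing | rewrite H; lra]. }
  set (F := cexp (Ci * RtoC (/ alpha) * z)) in *.
  assert (G : 1 - exp (- / alpha) <= Cmod (F - 1)%C).
  { assert (A := Cmod_sub_1_ge F); lra. }
  unfold Cdiv; rewrite !Cmod_mult, Cmod_Ci, Rmult_1_l.
  unfold cot_bound, Rdiv; apply Rmult_le_compat; try apply Cmod_ge_0.
  - eapply Rle_trans; [apply Cmod_triangle|]; rewrite Cmod_1; lra.
  - apply Cmod_inv_le; lra.
Qed.

Lemma amp_le (s : R) (w : C) : 0 <= s <= 1 -> Cmod w <= / 2 -> Cmod (amp s w) <= 5 * s * Cmod w.
Proof.
  intros Hs Hw; assert (P := Cmod_ge_0 w).
  assert (G : / 2 <= Cmod (s * w - 1)%C).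
  { assert (A := Cmod_sub_1_ge (s * w)%C); rewrite Cmod_mult, Cmod_Rpos in A by lra; nra. }
  assert (GI := Cmod_inv_le _ (/ 2) ltac:(lra) G); rewrite Rinv_inv in GI.
  assert (G0 := Cmod_ge_0 (/ (s * w - 1))%C).
  unfold amp; rewrite !Cmod_mult, Cmod_Rpos by lra.
  replace (5 * s * Cmod w) with (s * Cmod w * 5) by ring.
  apply Rmult_le_compat_l; [apply Rmult_le_pos; lra|].
  eapply Rle_trans; [apply Cmod_triangle|]; rewrite Cmod_1, Cmod_mult; nra.
Qed.

Lemma pole_inv_le (w : C) : Cmod w <= / 2 -> Cmod (/ (w - 1))%C <= 2.
Proof.
  intros Hw; rewrite <- (Rinv_inv 2); apply Cmod_inv_le; [lra|].
  assert (A := Cmod_sub_1_ge w); lra.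
Qed.

Lemma simple_pole_le (w : C) : Cmod w <= / 2 -> Cmod (simple_pole w) <= 2 * Cmod w.
Proof.
  intros Hw; unfold simple_pole; rewrite Cmod_mult.
  generalize (pole_inv_le w Hw) (Cmod_ge_0 w) (Cmod_ge_0 (/ (w - 1))%C); intros; nra.
Qed.

Lemma triple_pole_le (w : C) : Cmod w <= / 2 -> Cmod (triple_pole w) <= 16 * Cmod w.
Proof.
  intros Hw; unfold triple_pole; rewrite !Cmod_mult.
  assert (P := Cmod_ge_0 w); assert (G := pole_inv_le w Hw).
  assert (G0 := Cmod_ge_0 (/ (w - 1))%C).
  assert (A := Cmod_triangle w 1); rewrite Cmod_1 in A.
  assert (A0 := Cmod_ge_0 (w + 1)%C).
  replace (16 * Cmod w) with (Cmod w * 2 * (2 * 2 * 2)) by ring.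
  apply Rmult_le_compat.
  - apply Rmult_le_pos; auto.
  - repeat apply Rmult_le_pos; auto.
  - apply Rmult_le_compat_l; lra.
  - apply Rmult_le_compat; auto; [apply Rmult_le_pos; auto|].
    apply Rmult_le_compat; auto.
Qed.

Lemma Cmod_cexp_gam (tau x : R) : 0 < cos x -> Cmod (cexp (gam tau x)) = 2 * cos x * exp (- tau).
Proof.
  intros Hx; rewrite Cmod_cexp; unfold gam, Re; simpl; unfold Rminus.
  rewrite exp_plus, exp_ln; lra.
Qed.

Lemma Cmod_cexp_gam_le (tau x : R) : 0 < cos x -> 0 <= tau ->
  Cmod (cexp (gam tau x)) <= 2 * cos x.
Proof.
  intros Hx Ht; rewrite Cmod_cexp_gam by auto.
  assert (exp (- tau) <= 1).
  { destruct Ht as [Ht| <-]; [left; now apply exp_opp_lt_1 | rewrite Ropp_0, exp_0; lra]. }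
  nra.
Qed.

(** Every summand carries a factor [w = e^z], of modulus [2 cos X * exp (- tau)], while the
    cotangent stays bounded at height at least 1. The flux through the far end thus vanishes as [X]
    tends to [PI / 2]. *)
Lemma reduced_far (s a b X tau : R) : 0 < s <= 1 -> 1 <= X < PI / 2 ->
  2 * cos X <= / 2 -> 0 <= tau ->
  Cmod (reduced s a b (gam tau X)) <=
  2 * (5 * cot_bound + Rabs a * 2 + Rabs b * 16) * cos X.
Proof.
  intros Hs HX Hc Ht.
  assert (Hcp : 0 < cos X) by (apply cos_gt_0; lra).
  assert (Q := Cmod_cexp_gam_le tau X Hcp Ht).
  set (w := cexp (gam tau X)) in *.
  assert (P := Cmod_ge_0 w).
  assert (A1 := amp_le s w ltac:(lra) ltac:(lra)).
  assert (A2 := simple_pole_le w ltac:(lra)).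
  assert (A4 := triple_pole_le w ltac:(lra)).
  assert (A3 := cot_ker_le (gam tau X) ltac:(unfold gam, Im; simpl; lra)).
  assert (CB := cot_bound_pos); assert (Pa := Rabs_pos a); assert (Pb := Rabs_pos b).
  unfold reduced; fold w.
  eapply Rle_trans; [apply Cmod_triangle|].
  eapply Rle_trans; [apply Rplus_le_compat_r, Cmod_triangle|].
  rewrite !Cmod_mult, !Cmod_R.
  apply Rle_trans with ((5 * cot_bound + Rabs a * 2 + Rabs b * 16) * Cmod w).
  - assert (Cmod (amp s w) * Cmod (cot_ker (gam tau X)) <= 5 * Cmod w * cot_bound).
    { apply Rmult_le_compat; try apply Cmod_ge_0; auto; nra. }
    apply Rmult_le_compat_l with (1 := Pa) in A2.
    apply Rmult_le_compat_l with (1 := Pb) in A4; lra.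
  - replace (2 * (5 * cot_bound + Rabs a * 2 + Rabs b * 16) * cos X)
      with ((5 * cot_bound + Rabs a * 2 + Rabs b * 16) * (2 * cos X)) by ring.
    apply Rmult_le_compat_l; lra.
Qed.

(** * Riemann integrals of functions without a limit at the upper end *)

Lemma is_RInt_Riemann_sum (f : R -> R) (a b l eps : R) : a < b -> 0 < eps ->
  is_RInt f a b l -> Riemann_fine a b (fun ptd => Rabs (Riemann_sum f ptd - l) < eps).
Proof.
  intros Hab Heps Hf.
  assert (H := proj1 (filterlim_locally _ _) Hf (mkposreal eps Heps)).
  apply filter_imp with (2 := H); intros ptd.
  unfold ball; simpl; unfold AbsRing_ball, abs, minus, plus, opp, scal; simpl.
  unfold mult; simpl; rewrite sign_eq_1, Rmult_1_l by lra; auto.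
Qed.

(** Riemann sums of [f] and [g] over the same subdivision differ by at most the corresponding sum of
    [h], so the integral of [f] is obtained together with its existence. *)
Lemma is_RInt_squeeze (f : R -> R) (a b l : R) : a < b ->
  (forall eps, 0 < eps -> exists g h lg lh, is_RInt g a b lg /\ is_RInt h a b lh /\
     (forall t, a <= t <= b -> Rabs (f t - g t) <= h t) /\ Rabs (lg - l) < eps /\ lh < eps) ->
  is_RInt f a b l.
Proof.
  intros Hab H; apply filterlim_locally; intros eps.
  destruct (H (eps / 4)) as [g [h [lg [lh [Hg [Hh [Hfg [Hlg Hlh]]]]]]]].
  { generalize (cond_pos eps); lra. }
  assert (He : 0 < eps / 4) by (generalize (cond_pos eps); lra).
  assert (Ng := is_RInt_Riemann_sum g a b lg _ Hab He Hg).
  assert (Nh := is_RInt_Riemann_sum h a b lh _ Hab He Hh).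
  assert (Nd : Riemann_fine a b (fun ptd => pointed_subdiv ptd /\ SF_h ptd = Rmin a b /\
     seq.last (SF_h ptd) (SF_lx ptd) = Rmax a b)).
  { unfold Riemann_fine, within; apply filter_forall; auto. }
  assert (N := filter_and _ _ Nd (filter_and _ _ Ng Nh)).
  apply filter_imp with (2 := N); intros ptd [[P1 [P2 P3]] [Q1 Q2]].
  rewrite Rmin_left in P2 by lra; rewrite Rmax_right in P3 by lra.
  assert (D : Rabs (Riemann_sum (fun t => f t - g t) ptd) <= Riemann_sum h ptd).
  { apply (Riemann_sum_norm (V := R_NormedModule) (fun t => f t - g t) h ptd P1).
    intros t Ht; rewrite P3, P2 in Ht; apply Hfg; lra. }
  assert (S : Riemann_sum (fun t => f t - g t) ptd = Riemann_sum f ptd - Riemann_sum g ptd)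
    by exact (Riemann_sum_minus f g ptd).
  rewrite S in D.
  change (Rabs (sign (b - a) * Riemann_sum f ptd - l) < eps).
  rewrite sign_eq_1, Rmult_1_l by lra.
  change (Rabs (Riemann_sum g ptd - lg) < eps / 4) in Q1.
  change (Rabs (Riemann_sum h ptd - lh) < eps / 4) in Q2.
  change (Rabs (Riemann_sum f ptd - Riemann_sum g ptd) <= Riemann_sum h ptd) in D.
  apply Rabs_le_between in D; apply Rabs_lt_between in Q1.
  apply Rabs_lt_between in Q2; apply Rabs_lt_between in Hlg.
  apply Rabs_lt_between; lra.
Qed.

Lemma is_RInt_glue (f g : R -> R) (a c b lf lg : R) : a < c < b ->
  is_RInt f a c lf -> is_RInt g c b lg ->
  is_RInt (fun x => if Rle_dec x c then f x else g x) a b (lf + lg).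
Proof.
  intros H Hf Hg; apply (is_RInt_Chasles (V := R_NormedModule)) with c.
  - apply is_RInt_ext with (2 := Hf); intros x Hx; minmax Hx.
    destruct (Rle_dec x c); auto; lra.
  - apply is_RInt_ext with (2 := Hg); intros x Hx; minmax Hx.
    destruct (Rle_dec x c); auto; lra.
Qed.

(** A bounded function continuous on [[a, b)] is a proper Riemann integrand, whatever its value at
    [b]. It is approximated by its truncation at [u n], the error being at most a constant on
    [(u n, b]]. *)
Lemma is_RInt_limit_upper (f : R -> R) (a b l M : R) (u : nat -> R) :
  a < b -> (forall x, a <= x < b -> continuous f x) ->
  (forall x, a <= x < b -> Rabs (f x) <= M) ->
  (forall n, a < u n < b) -> is_lim_seq u b ->
  is_lim_seq (fun n => RInt f a (u n)) l -> is_RInt f a b l.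
Proof.
  intros Hab Hc HM Hu Lu Li; apply is_RInt_squeeze; auto; intros eps Heps.
  set (M' := Rmax M (Rabs (f b))).
  assert (HM' : 0 <= M') by (apply Rle_trans with (2 := Rmax_r _ _), Rabs_pos).
  assert (Hall : forall x, a <= x <= b -> Rabs (f x) <= M').
  { intros x Hx; destruct (proj2 Hx) as [Hlt| ->].
    - apply Rle_trans with (2 := Rmax_l _ _); apply HM; lra.
    - apply Rmax_r. }
  assert (Hd : 0 < eps / (M' + 1)) by (apply Rdiv_lt_0_compat; lra).
  apply is_lim_seq_spec in Lu; apply is_lim_seq_spec in Li.
  destruct (Lu (mkposreal _ Hd)) as [N1 H1], (Li (mkposreal _ Heps)) as [N2 H2].
  set (n := (N1 + N2)%nat); specialize (H1 n ltac:(unfold n; lia)).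
  specialize (H2 n ltac:(unfold n; lia)); simpl in H1, H2.
  destruct (Hu n) as [U1 U2]; set (c := u n) in *.
  assert (Hk : forall v x y : R, is_RInt (fun _ : R => v) x y ((y - x) * v))
    by (intros; apply (is_RInt_const (V := R_NormedModule))).
  exists (fun x => if Rle_dec x c then f x else 0).
  exists (fun x => if Rle_dec x c then 0 else M').
  exists (RInt f a c), ((b - c) * M').
  split; [|split; [|split; [|split]]].
  - replace (RInt f a c) with (RInt f a c + (b - c) * 0) by ring.
    apply is_RInt_glue; auto; apply RInt_corr, ex_RInt_cont.
    intros x Hx; minmax Hx; apply Hc; lra.
  - replace ((b - c) * M') with ((c - a) * 0 + (b - c) * M') by ring.
    apply is_RInt_glue; auto.
  - intros t Ht; destruct (Rle_dec t c).
    + rewrite Rminus_diag, Rabs_R0; lra.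
    + rewrite Rminus_0_r; auto.
  - auto.
  - apply Rle_lt_trans with ((b - c) * (M' + 1)); [nra|].
    apply Rabs_lt_between in H1.
    apply Rlt_le_trans with (eps / (M' + 1) * (M' + 1)); [nra|right; field; lra].
Qed.

Lemma hol_on_ccont (D : C -> Prop) (F : C -> C) (z : C) :
  hol_on D F -> D z -> ccont (T := C_US) F z.
Proof. intros [F' H] Hz; apply (H z Hz). Qed.

Lemma RInt_plus_scal (f g : R -> R) (c a b : R) : ex_RInt f a b -> ex_RInt g a b ->
  RInt (fun x => f x + c * g x) a b = RInt f a b + c * RInt g a b.
Proof.
  intros Hf Hg; apply is_RInt_unique.
  apply (is_RInt_plus (V := R_NormedModule) f (fun x => c * g x)).
  - now apply RInt_corr.
  - apply is_RInt_rscal.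
    now apply RInt_corr.
Qed.

(** * Integrals of the subtracted poles and translation by one period *)

Lemma pull_plus_scal (F G : C -> C) (c tau x : R) :
  pull (fun z => F z + RtoC c * G z)%C tau x = pull F tau x + c * pull G tau x.
Proof. unfold pull, Im; simpl; ring. Qed.

Lemma cexp_gam (tau x : R) : 0 < cos x ->
  cexp (gam tau x) = (exp (- tau) * (1 + cos (2 * x)), exp (- tau) * sin (2 * x)).
Proof.
  intros Hx; unfold cexp, gam, Re, Im; simpl fst; simpl snd.
  unfold Rminus; rewrite exp_plus, exp_ln, sin_2a, cos_2a_cos by lra.
  f_equal; ring.
Qed.

Lemma cexp_gam_dgam (tau x : R) : 0 < cos x ->
  (cexp (gam tau x) * dgam x)%C =
  (- (2 * exp (- tau) * sin (2 * x)), 2 * exp (- tau) * cos (2 * x)).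
Proof.
  intros Hx; rewrite cexp_gam by auto; unfold dgam, tan.
  apply C_eq; unfold Re, Im; simpl fst; simpl snd.
  - rewrite cos_2a_cos, sin_2a; field; lra.
  - rewrite cos_2a_cos, sin_2a.
    transitivity (2 * exp (- tau) * (cos x * cos x - sin x * sin x)); [field; lra|].
    generalize (sin_cos_sqr x); intros Q.
    replace (sin x * sin x) with (1 - cos x * cos x) by lra; ring.
Qed.

Lemma pull_simple_pole (tau x : R) : 0 < cos x ->
  (cexp (gam tau x) - 1)%C <> 0 ->
  let t := exp (- tau) in
  pull (fun z => simple_pole (cexp z)) tau x =
  2 * t * (t * sin (2 * x) ^ 2 + cos (2 * x) * (t + t * cos (2 * x) - 1))
  / ((t + t * cos (2 * x) - 1) ^ 2 + (t * sin (2 * x)) ^ 2).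
Proof.
  intros Hx Hn t; apply norm2_neq_0 in Hn.
  unfold pull, simple_pole.
  replace (cexp (gam tau x) * / (cexp (gam tau x) - 1) * dgam x)%C
    with (cexp (gam tau x) * dgam x * / (cexp (gam tau x) - 1))%C by ring.
  rewrite cexp_gam_dgam, cexp_gam in * by auto; fold t in Hn |- *.
  unfold Re, Im, Cminus, Cplus, Copp, RtoC in *; simpl fst in *; simpl snd in *.
  unfold Cmult, Cinv; simpl fst; simpl snd.
  assert (Hd : (t + t * cos (2 * x) - 1) ^ 2 + (t * sin (2 * x)) ^ 2 <> 0).
  { intros Q; apply Hn; etransitivity; [|exact Q]; ring. }
  replace ((t * (1 + cos (2 * x)) + - (1)) ^ 2 + (t * sin (2 * x) + - 0) ^ 2)
    with ((t + t * cos (2 * x) - 1) ^ 2 + (t * sin (2 * x)) ^ 2) by ring.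
  field; exact Hd.
Qed.

(** As [w / (w - 1) dz] is the differential of [ln (w - 1)], this is the change of the argument of
    [w - 1] along the curve. *)
Definition pole_flux (tau X : R) : R := RInt (pull (fun z => simple_pole (cexp z)) tau) 0 X.

(** Starting from 4 ensures height at least 1, as [cot_ker_le] requires, and [2 cos <= 1 / 2], as
    the bounds on the poles require. *)
Definition approach (j : nat) : R := PI / 2 - / (INR j + 4).

Lemma approach_bounds (j : nat) :
  1 <= approach j < PI / 2 /\ 2 * cos (approach j) <= / 2 /\ 0 < cos (approach j).
Proof.
  assert (HP := PI2_3_2); unfold PI2 in HP.
  assert (Hj := pos_INR j).
  assert (I : 0 < / (INR j + 4)) by (apply Rinv_0_lt_compat; lra).
  assert (I4 : / (INR j + 4) <= / 4) by (apply Rinv_le_contravar; lra).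
  unfold approach; split; [lra|].
  rewrite <- sin_shift; replace (PI / 2 - (PI / 2 - / (INR j + 4))) with (/ (INR j + 4)) by ring.
  split.
  - assert (Q := sin_lt_x _ I); lra.
  - apply sin_gt_0; lra.
Qed.

Lemma is_lim_seq_approach : is_lim_seq approach (PI / 2).
Proof.
  unfold approach; replace (Finite (PI / 2)) with (Finite (PI / 2 - 0)) by (f_equal; ring).
  apply is_lim_seq_minus'; [apply is_lim_seq_const|].
  replace (Finite 0) with (Rbar_inv p_infty) by reflexivity.
  apply is_lim_seq_inv; [|discriminate].
  apply is_lim_seq_plus with p_infty 4; [apply is_lim_seq_INR | apply is_lim_seq_const|].
  reflexivity.
Qed.

Lemma is_lim_seq_approach_comp (f : R -> R) (l : R) : f (PI / 2) = l ->
  ex_derive f (PI / 2) -> is_lim_seq (fun j => f (approach j)) l.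
Proof.
  intros <- Hf; apply (is_lim_seq_continuous f approach (PI / 2)).
  - now apply continuity_pt_filterlim, ex_derive_cont.
  - apply is_lim_seq_approach.
Qed.

Lemma is_lim_seq_cos_approach : is_lim_seq (fun j => cos (approach j)) 0.
Proof.
  apply is_lim_seq_approach_comp; [apply cos_PI2 | auto_derive; auto].
Qed.

Let q := exp (- period).

Definition amp_cot (s : R) (z : C) : C := (amp s (cexp z) * cot_ker z)%C.
Definition transported (s X : R) : R := RInt (pull (amp_cot s) 0) 0 X.

Lemma ln_2_pos : 0 < ln 2.
Proof. rewrite <- ln_1; apply ln_increasing; lra. Qed.

Lemma q_bounds : 0 < q < / 2.
Proof. split; [apply exp_pos | now apply exp_period_lt]. Qed.

Lemma dom_gam (tau x : R) : tau = 0 \/ tau = period -> 0 <= x < PI / 2 ->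
  dom (gam tau x).
Proof.
  intros Ht [[Hx| <-] Hx2]; [left; now apply upper_gam|].
  right; generalize ln_2_pos; intros; fold period.
  unfold gam, Re, Im; simpl; rewrite cos_0, Rmult_1_r; fold period; destruct Ht; lra.
Qed.

Lemma ex_RInt_pull_dom (F : C -> C) (tau X : R) : hol_on dom F ->
  tau = 0 \/ tau = period -> 0 <= X < PI / 2 -> ex_RInt (pull F tau) 0 X.
Proof.
  intros HF Ht HX; apply ex_RInt_pull; try lra.
  intros x Hx; apply hol_on_ccont with (1 := HF), dom_gam; auto; lra.
Qed.

Lemma hol_on_amp_cot (s : R) : s = 1 \/ 0 < s <= q -> hol_on dom (amp_cot s).
Proof.
  intros Hs; apply hol_on_mult; [now apply hol_on_amp | now apply hol_on_cot_ker].
Qed.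

(** Translation by the period multiplies [e^z] by [q], which the parameter [s] absorbs, and leaves
    the cotangent unchanged. The translated integral is again one over the original curve. *)
Lemma amp_cot_period (s x : R) : amp_cot s (gam period x) = amp_cot (s * q) (gam 0 x).
Proof.
  unfold amp_cot; f_equal.
  - assert (E : cexp (gam period x) = (RtoC q * cexp (gam 0 x))%C).
    { unfold gam, cexp, Re, Im, q; simpl fst; simpl snd.
      replace (ln (2 * cos x) - period) with (- period + (ln (2 * cos x) - 0)) by ring.
      rewrite exp_plus; apply C_eq; unfold Re, Im; simpl; ring. }
    unfold amp; rewrite E, RtoC_mult.
    replace (RtoC s * (RtoC q * cexp (gam 0 x)))%C with (RtoC s * RtoC q * cexp (gam 0 x))%C by ring.
    reflexivity.
  - unfold cot_ker, coth_half.
    assert (E : cexp (Ci * RtoC (/ alpha) * gam period x) = cexp (Ci * RtoC (/ alpha) * gam 0 x)).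
    { rewrite !ker_arg; unfold cexp, gam, Re, Im; simpl fst; simpl snd.
      replace ((ln (2 * cos x) - 0) / alpha)
        with ((ln (2 * cos x) - period) / alpha + 2 * INR 1 * PI)
        by (unfold period; simpl; field; lra).
      now rewrite cos_period, sin_period. }
    now rewrite E.
Qed.

Lemma transported_period (s X : R) :
  RInt (pull (amp_cot s) period) 0 X = transported (s * q) X.
Proof.
  unfold transported; apply RInt_ext; intros x _; unfold pull; now rewrite amp_cot_period.
Qed.

(** On the original curve [w - 1 = e^(2 i x)], whose argument grows at rate 2. *)
Lemma pole_flux_0 (X : R) : 0 <= X < PI / 2 ->
  pole_flux 0 X = 2 * X.
Proof.
  intros HX; transitivity (RInt (fun _ => 2) 0 X).
  - apply RInt_ext; intros x Hx; minmax Hx.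
    rewrite pull_simple_pole.
    + rewrite Ropp_0, exp_0.
      replace (2 * 1 * (1 * sin (2 * x) ^ 2 + cos (2 * x) * (1 + 1 * cos (2 * x) - 1)))
        with (2 * (sin (2 * x) * sin (2 * x) + cos (2 * x) * cos (2 * x))) by ring.
      replace ((1 + 1 * cos (2 * x) - 1) ^ 2 + (1 * sin (2 * x)) ^ 2)
        with (sin (2 * x) * sin (2 * x) + cos (2 * x) * cos (2 * x)) by ring.
      rewrite (sin_cos_sqr (2 * x)); real_eq; field.
    + apply cos_gt_0; lra.
    + apply dom_neq_1, dom_gam; auto; lra.
  - rewrite RInt_const; unfold scal; simpl; unfold mult; simpl; ring.
Qed.

(** On the translated curve [w - 1 = q * (e^(2 i x) - b)] with [b = / q - 1 > 1]. It stays in the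
    left half plane, so one branch of [atan] gives the change of argument throughout. *)
Lemma pole_flux_period (X : R) : 0 <= X < PI / 2 ->
  pole_flux period X =
  atan (sin (2 * X) / (cos (2 * X) - (/ q - 1))).
Proof.
  intros HX; assert (Hq := q_bounds).
  assert (Hb : 1 < / q - 1).
  { assert (/ / 2 < / q) by (apply Rinv_lt_contravar; nra); rewrite Rinv_inv in *; lra. }
  set (b := / q - 1) in *.
  assert (Hcb : forall x, cos (2 * x) - b < 0) by (intros x; generalize (COS_bound (2 * x)); lra).
  set (F := fun x => atan (sin (2 * x) / (cos (2 * x) - b))).
  set (dF := fun x => 2 * (sin (2 * x) ^ 2 + cos (2 * x) * (cos (2 * x) - b))
     / ((cos (2 * x) - b) ^ 2 + sin (2 * x) ^ 2)).
  assert (Hd : forall x, 0 < (cos (2 * x) - b) ^ 2 + sin (2 * x) ^ 2).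
  { intros x; generalize (Hcb x) (pow2_ge_0 (sin (2 * x))); intros; nra. }
  assert (HI : is_RInt dF 0 X (minus (F X) (F 0))).
  { apply (is_RInt_deriv); intros x _.
    - unfold F, dF; assert (H1 := Hcb x); assert (H2 := Hd x).
      auto_derive; [lra|].
      field; split; simpl in H2; [|lra].
      apply Rgt_not_eq; nra.
    - apply ex_derive_cont; unfold dF; assert (H2 := Hd x); auto_derive; simpl in H2; lra. }
  replace (atan (sin (2 * X) / (cos (2 * X) - b))) with (minus (F X) (F 0)).
  2: { unfold F, minus, plus, opp; simpl; rewrite Rmult_0_r, sin_0; unfold Rdiv.
       rewrite Rmult_0_l, atan_0; ring. }
  rewrite <- (is_RInt_unique _ _ _ _ HI).
  apply RInt_ext; intros x Hx; minmax Hx.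
  rewrite pull_simple_pole.
  - fold q; unfold dF; assert (H2 := Hd x).
    assert (Eb : q + q * cos (2 * x) - 1 = q * (cos (2 * x) - b)) by (unfold b; field; lra).
    rewrite Eb.
    real_eq.
    replace ((q * (cos (2 * x) - b)) ^ 2 + (q * sin (2 * x)) ^ 2)
      with (q ^ 2 * ((cos (2 * x) - b) ^ 2 + sin (2 * x) ^ 2)) by ring.
    field; lra.
  - apply cos_gt_0; lra.
  - apply dom_neq_1, dom_gam; auto; lra.
Qed.

(** A primitive of the triple pole with respect to [z]. The triple pole therefore has no residue and
    contributes only an end term, which vanishes in the limit. *)
Definition double_pole (w : C) : C := (- (1) * (w * (/ (w - 1) * / (w - 1))))%C.

Lemma is_derive_double_pole (tau x : R) : - (PI / 2) < x < PI / 2 ->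
  (cexp (gam tau x) - 1)%C <> 0 ->
  is_derive (fun x => Im (double_pole (cexp (gam tau x)))) x
    (pull (fun z => triple_pole (cexp z)) tau x).
Proof.
  intros Hx Hn.
  assert (D := cder_cexp _ _ _ (cder_gam_x tau x Hx)).
  assert (D1 : cder (fun x => (cexp (gam tau x) - 1)%C) x (cexp (gam tau x) * dgam x)%C).
  { apply (cder_eq _ _ _ _ (cder_plus _ _ _ _ _ D (cder_const (- (1))%C x))); ring. }
  assert (DI := cder_inv _ _ _ Hn D1); cbv beta in DI.
  destruct (cder_mult _ _ _ _ _ (cder_const (- (1))%C x)
    (cder_mult _ _ _ _ _ D (cder_mult _ _ _ _ _ DI DI))) as [_ H]; cbv beta in H.
  eapply is_derive_eq; [exact H|].
  unfold pull, triple_pole; set (w := cexp (gam tau x)) in *.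
  f_equal; field; auto.
Qed.

Lemma RInt_triple_pole (tau X : R) : tau = 0 \/ tau = period -> 0 <= X < PI / 2 ->
  RInt (pull (fun z => triple_pole (cexp z)) tau) 0 X =
  Im (double_pole (cexp (gam tau X))).
Proof.
  intros Ht HX; assert (HP := PI_RGT_0).
  assert (Hdom : forall x, 0 <= x <= X -> dom (gam tau x))
    by (intros x Hx; apply dom_gam; auto; lra).
  assert (E0 : Im (double_pole (cexp (gam tau 0))) = 0).
  { unfold gam, double_pole; assert (R0 := im_cexp_real (ln (2 * cos 0) - tau)).
    unfold Cminus; repeat first [exact R0 | reflexivity | apply im_inv_0 | apply im_plus_0
      | apply im_mult_0 | apply im_opp_0]. }
  apply is_RInt_unique.
  replace (Im (double_pole (cexp (gam tau X))))
    with (Im (double_pole (cexp (gam tau X))) - Im (double_pole (cexp (gam tau 0))))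
    by (rewrite E0; ring).
  apply (is_RInt_deriv (fun x => Im (double_pole (cexp (gam tau x))))); intros x Hx; minmax Hx.
  - apply is_derive_double_pole; [lra | apply dom_neq_1; auto].
  - apply ccont_pull; [lra|].
    apply hol_on_ccont with dom; auto; apply hol_on_triple_pole.
Qed.

Lemma triple_pole_far (tau X : R) : 0 <= tau -> 0 < cos X -> 2 * cos X <= / 2 ->
  Rabs (Im (double_pole (cexp (gam tau X)))) <= 8 * cos X.
Proof.
  intros Ht Hc Hc2; apply Rle_trans with (1 := im_le_Cmod _).
  assert (Q := Cmod_cexp_gam_le tau X Hc Ht).
  set (w := cexp (gam tau X)) in *.
  unfold double_pole; rewrite !Cmod_mult, Cmod_m1, Rmult_1_l.
  assert (G := pole_inv_le w ltac:(lra)).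
  assert (G0 := Cmod_ge_0 (/ (w - 1))%C); assert (G1 := Cmod_ge_0 w).
  replace (8 * cos X) with (2 * cos X * (2 * 2)) by ring.
  apply Rmult_le_compat; auto; [apply Rmult_le_pos; auto|].
  apply Rmult_le_compat; auto.
Qed.

Lemma period_pos : 0 < period.
Proof. generalize ln_2_pos; lra. Qed.

Lemma upper_neq_0 (z : C) : upper z -> z <> 0.
Proof. intros [H _] E; rewrite E in H; unfold Im in H; simpl in H; lra. Qed.

Lemma is_lim_seq_pole_flux : is_lim_seq (fun j =>
  pole_flux 0 (approach j) -
  pole_flux period (approach j)) PI.
Proof.
  assert (Hq := q_bounds).
  assert (Hb : 1 < / q - 1).
  { assert (/ / 2 < / q) by (apply Rinv_lt_contravar; nra); rewrite Rinv_inv in *; lra. }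
  apply is_lim_seq_ext with
    (fun j => 2 * approach j - atan (sin (2 * approach j) / (cos (2 * approach j) - (/ q - 1)))).
  - intros j; destruct (approach_bounds j) as [H1 [H2 H3]].
    rewrite pole_flux_0, pole_flux_period by (auto; lra).
    reflexivity.
  - apply (is_lim_seq_approach_comp
      (fun x => 2 * x - atan (sin (2 * x) / (cos (2 * x) - (/ q - 1))))).
    + replace (2 * (PI / 2)) with PI by field; rewrite sin_PI.
      unfold Rdiv; rewrite Rmult_0_l, atan_0; ring.
    + auto_derive; replace (2 * (PI / 2)) with PI by field; rewrite cos_PI; lra.
Qed.

(** * Summation over all translations *)

(** The reduced kernel contributes nothing in the limit by [shift_crossing], nor does the triple
    pole. What remains is [- a] times the difference of the two changes of argument, which tends to
    [PI]. *)
Lemma transported_step_gen (s a b K : R) : s = 1 \/ 0 < s <= q ->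
  (forall z : C, z <> 0 -> Cmod z <= laurent_radius -> Cmod (reduced s a b z) <= K) ->
  is_lim_seq (fun j => transported s (approach j) - transported (s * q) (approach j))
    (- a * PI).
Proof.
  intros Hs HK.
  assert (Hq := q_bounds).
  set (B := period * (2 * (5 * cot_bound + Rabs a * 2 + Rabs b * 16)) + 16 * Rabs b).
  set (v := fun j => - a * (pole_flux 0 (approach j) - pole_flux period (approach j))).
  assert (Lv : is_lim_seq v (- a * PI)) by (unfold v; lim; apply is_lim_seq_pole_flux).
  apply is_lim_seq_le_le with (fun j => v j - B * cos (approach j)) (fun j => v j + B * cos (approach j)).
  2, 3: assert (LB := lim_scal0 _ B is_lim_seq_cos_approach).
  2: apply (lim_eq _ (- a * PI - 0)); [lim | ring].
  2: apply (lim_eq _ (- a * PI + 0)); [lim | ring].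
  intros j; destruct (approach_bounds j) as [H1 [H2 H3]]; unfold v.
  set (X := approach j) in *.
  assert (Hp := period_pos).
  assert (HC := shift_crossing (reduced s a b) X period laurent_radius K _
    Hperiod ltac:(lra) laurent_radius_pos
    (hol_on_reduced s a b Hs)
    (fun u _ _ => im_reduced_real s a b u)
    (fun z Hz Hr => HK z (upper_neq_0 z Hz) Hr)
    (fun tau Ht => reduced_far s a b X tau ltac:(lra) H1 H2 (proj1 Ht))).
  assert (Ex : forall tau, tau = 0 \/ tau = period ->
    RInt (pull (reduced s a b) tau) 0 X =
    RInt (pull (amp_cot s) tau) 0 X + a * pole_flux tau X
    + b * Im (double_pole (cexp (gam tau X)))).
  { intros tau Ht; rewrite <- RInt_triple_pole by (auto; lra).
    assert (E : forall F, hol_on dom F -> ex_RInt (pull F tau) 0 X).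
    { intros F HF; apply (ex_RInt_pull_dom); auto; lra. }
    assert (E1 := E _ (hol_on_amp_cot s Hs)).
    assert (E2 := E _ hol_on_simple_pole).
    assert (E3 := E _ hol_on_triple_pole).
    unfold pole_flux; rewrite <- !RInt_plus_scal; auto.
    - apply RInt_ext; intros x _; unfold reduced.
      now rewrite (pull_plus_scal (fun z => amp s (cexp z) * cot_ker z +
        RtoC a * simple_pole (cexp z))%C (fun z => triple_pole (cexp z))),
        (pull_plus_scal (fun z => amp s (cexp z) * cot_ker z)%C
        (fun z => simple_pole (cexp z))).
    - apply (ex_RInt_plus (V := R_NormedModule)); auto.
      now apply (ex_RInt_scal (V := R_NormedModule)). }
  rewrite !Ex in HC by auto.
  rewrite (transported_period s X) in HC.
  fold (transported s X) in HC.
  assert (T : forall tau, 0 <= tau ->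
    Rabs (b * Im (double_pole (cexp (gam tau X)))) <= Rabs b * (8 * cos X)).
  { intros tau Ht; rewrite Rabs_mult; apply Rmult_le_compat_l; [apply Rabs_pos|].
    now apply triple_pole_far. }
  assert (T0 := T 0 ltac:(lra)); assert (T1 := T period ltac:(lra)).
  apply Rabs_le_between in T0; apply Rabs_le_between in T1.
  apply Rabs_le_between in HC; unfold B; lra.
Qed.

Lemma transported_step (s : R) : 0 < s <= q ->
  is_lim_seq (fun j => transported s (approach j) - transported (s * q) (approach j))
    (2 * alpha * amp_at_1 s * PI).
Proof.
  intros Hs; assert (Hq := q_bounds).
  destruct (reduced_bounded s ltac:(lra)) as [K HK].
  rewrite <- (Ropp_involutive (2 * alpha * amp_at_1 s)).
  apply transported_step_gen with (2 := HK); auto.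
Qed.

Lemma transported_step_0 :
  is_lim_seq (fun j => transported 1 (approach j) - transported (1 * q) (approach j))
    (residue_0 * PI).
Proof.
  destruct reduced_1_bounded as [K HK].
  rewrite <- (Ropp_involutive residue_0).
  apply transported_step_gen with (2 := HK); auto.
Qed.

Lemma cot_ker_bounded : exists M, forall x, 0 <= x < PI / 2 -> Cmod (cot_ker (gam 0 x)) <= M.
Proof.
  set (g := fun x => Rabs (Re (cot_ker (gam 0 x))) + Rabs (Im (cot_ker (gam 0 x)))).
  assert (HP := PI2_3_2); unfold PI2 in HP.
  destruct (continuity_ab_maj g 0 1) as [m [Hm _]]; [lra| |].
  - intros x Hx; apply continuity_pt_filterlim.
    assert (Hc : ccont (T := R_UniformSpace) (fun x => cot_ker (gam 0 x)) x).
    { apply (ccont_comp (T := R_UniformSpace) (cot_ker) (gam 0)).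
      - apply hol_on_ccont with dom; [now apply hol_on_cot_ker|].
        apply dom_gam; auto; lra.
      - apply ccont_gam_x; lra. }
    destruct Hc as [C1 C2].
    apply (continuous_Rplus (T := R_UniformSpace));
      apply (continuous_comp _ Rabs); auto; apply continuous_Rabs.
  - exists (Rmax (g m) cot_bound); intros x Hx.
    destruct (Rle_dec x 1) as [H|H].
    + apply Rle_trans with (2 := Rmax_l _ _); apply Rle_trans with (1 := Cmod_le_re_im _).
      apply (Hm x); lra.
    + apply Rle_trans with (2 := Rmax_r _ _); apply cot_ker_le; auto.
      unfold gam, Im; simpl; lra.
Qed.

(** [dgam] is unbounded near [PI / 2], but its product with [e^z] has constant modulus 2. *)
Lemma Cmod_amp_dgam_le (s x : R) : 0 < s <= q -> 0 <= x < PI / 2 ->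
  Cmod (amp s (cexp (gam 0 x)) * dgam x)%C <= s * (2 * (1 + / (1 - 2 * q) ^ 2)).
Proof.
  intros Hs Hx; assert (Hq := q_bounds).
  assert (Hc : 0 < cos x) by (apply cos_gt_0; lra).
  assert (HE : Cmod (cexp (gam 0 x)) <= 2).
  { apply Rle_trans with (1 := Cmod_cexp_gam_le 0 x Hc (Rle_refl 0)).
    generalize (COS_bound x); lra. }
  assert (HD : Cmod (cexp (gam 0 x) * dgam x)%C = 2).
  { rewrite cexp_gam_dgam by auto; rewrite Ropp_0, exp_0; unfold Cmod; simpl fst; simpl snd.
    replace ((- (2 * 1 * sin (2 * x))) ^ 2 + (2 * 1 * cos (2 * x)) ^ 2)
      with (2 ^ 2 * (sin (2 * x) * sin (2 * x) + cos (2 * x) * cos (2 * x))) by ring.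
    rewrite (sin_cos_sqr (2 * x)); rewrite Rmult_1_r.
    apply sqrt_pow2; lra. }
  set (w := cexp (gam 0 x)) in *.
  assert (G : 1 - 2 * q <= Cmod (s * w - 1)%C).
  { assert (A := Cmod_sub_1_ge (s * w)%C); rewrite Cmod_mult, Cmod_Rpos in A by lra.
    generalize (Cmod_ge_0 w); intros; nra. }
  assert (GI := Cmod_inv_le _ (1 - 2 * q) ltac:(lra) G).
  unfold amp.
  replace (s * w * (1 + / (s * w - 1) * / (s * w - 1)) * dgam x)%C
    with (s * (w * dgam x * (1 + / (s * w - 1) * / (s * w - 1))))%C by ring.
  rewrite Cmod_mult, Cmod_Rpos by lra; apply Rmult_le_compat_l; [lra|].
  rewrite Cmod_mult, HD; apply Rmult_le_compat_l; [lra|].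
  eapply Rle_trans; [apply Cmod_triangle|]; rewrite Cmod_1, Cmod_mult.
  apply Rplus_le_compat_l.
  replace (/ (1 - 2 * q) ^ 2) with (/ (1 - 2 * q) * / (1 - 2 * q)) by (field; lra).
  apply Rmult_le_compat; auto; apply Cmod_ge_0.
Qed.

(** The bound is uniform in [j]; this uniformity justifies exchanging the limits in [j] and in the
    number of translations. *)
Lemma transported_small : exists M, forall s j, 0 < s <= q ->
  Rabs (transported s (approach j)) <= M * s.
Proof.
  destruct cot_ker_bounded as [M HM].
  assert (Hq := q_bounds).
  exists (PI / 2 * ((2 * (1 + / (1 - 2 * q) ^ 2)) * M)).
  intros s j Hs; destruct (approach_bounds j) as [H1 [H2 H3]].
  set (A := 2 * (1 + / (1 - 2 * q) ^ 2)).
  assert (HA : 0 <= A).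
  { unfold A; assert (0 < / (1 - 2 * q) ^ 2) by (apply Rinv_0_lt_compat, pow_lt; lra); lra. }
  assert (HM0 : 0 <= M) by (apply Rle_trans with (2 := HM 0 ltac:(lra)), Cmod_ge_0).
  apply Rle_trans with ((approach j - 0) * (s * A * M)).
  - apply abs_RInt_le_const; [lra| |].
    + apply (ex_RInt_pull_dom); auto; [|lra]; apply hol_on_amp_cot; auto.
    + intros x Hx; unfold pull, amp_cot; apply Rle_trans with (1 := im_le_Cmod _).
      replace (amp s (cexp (gam 0 x)) * cot_ker (gam 0 x) * dgam x)%C
        with (amp s (cexp (gam 0 x)) * dgam x * cot_ker (gam 0 x))%C by ring.
      rewrite Cmod_mult; apply Rmult_le_compat; try apply Cmod_ge_0.
      * apply Cmod_amp_dgam_le; auto; lra.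
      * apply HM; lra.
  - rewrite Rminus_0_r.
    replace (PI / 2 * (A * M) * s) with (PI / 2 * (s * A * M)) by ring.
    apply Rmult_le_compat_r; [|lra].
    apply Rmult_le_pos; [apply Rmult_le_pos|]; auto; lra.
Qed.

(** The translation from [1] to [q] has the special residue [residue_0]; the others start at [q ^ 1]
    up to [q ^ N]. The last term is subtracted because [sum_n] also includes index [N]; at [N = 0]
    this leaves the empty sum. *)
Lemma transported_finite (N : nat) :
  is_lim_seq (fun j => transported 1 (approach j) - transported (q ^ S N) (approach j))
    (PI * (residue_0 + 2 * alpha * (sum_n (fun n => amp_at_1 (q ^ S n)) N - amp_at_1 (q ^ S N)))).
Proof.
  assert (Hq := q_bounds).
  induction N as [|N IH].
  - rewrite sum_O.
    replace (PI * (residue_0 + 2 * alpha * (amp_at_1 (q ^ 1) - amp_at_1 (q ^ 1))))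
      with (residue_0 * PI) by ring.
    apply is_lim_seq_ext with (2 := transported_step_0); intros j; now rewrite pow_1, Rmult_1_l.
  - assert (Hs : 0 < q ^ S N <= q).
    { split; [apply pow_lt; lra|].
      assert (q ^ N <= 1) by (rewrite <- (pow1 N); apply pow_incr; lra).
      simpl; nra. }
    assert (L := is_lim_seq_plus' _ _ _ _ IH (transported_step _ Hs)).
    rewrite sum_Sn.
    replace (PI * (residue_0 + 2 * alpha *
      (plus (sum_n (fun n => amp_at_1 (q ^ S n)) N) (amp_at_1 (q ^ S (S N))) - amp_at_1 (q ^ S (S N)))))
      with (PI * (residue_0 + 2 * alpha *
       (sum_n (fun n => amp_at_1 (q ^ S n)) N - amp_at_1 (q ^ S N)))
       + 2 * alpha * amp_at_1 (q ^ S N) * PI)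
      by (unfold plus; simpl; ring).
    apply is_lim_seq_ext with (2 := L); intros j.
    replace (q ^ S (S N)) with (q ^ S N * q) by (simpl; ring); ring.
Qed.

(** With [q = exp (- 2 h)] and [h = PI * alpha], the identity [q ^ n / (1 - q ^ n) ^ 2 = 1 / (4 sinh
    (n h) ^ 2)] splits each term into a geometric one and a squared cosecant. *)
Lemma is_series_amp_at_1 :
  is_series (fun n => amp_at_1 (q ^ S n)) (q / (1 - q) + csch2_even (PI * alpha)).
Proof.
  assert (Hq := q_bounds).
  assert (HP := PI_RGT_0).
  assert (Hh : 0 < PI * alpha) by (apply Rmult_lt_0_compat; lra).
  apply is_series_ext with
    (fun n => plus (q * q ^ n) (/ (4 * sinh (INR (S n) * (PI * alpha)) ^ 2))).
  - intros n.
    assert (Hn : 0 < INR (S n) * (PI * alpha))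
      by (apply Rmult_lt_0_compat; auto; apply lt_0_INR; lia).
    rewrite <- (proj2 (inv_csch _ Hn)).
    replace (- (2 * (INR (S n) * (PI * alpha)))) with (INR (S n) * - period)
      by (unfold period; ring).
    rewrite exp_INR_mult; fold q.
    assert (Hs : q ^ S n < 1).
    { simpl; assert (q ^ n <= 1) by (rewrite <- (pow1 n); apply pow_incr; lra).
      assert (0 < q ^ n) by (apply pow_lt; lra); nra. }
    unfold amp_at_1, plus; simpl plus; simpl (q ^ S n) in *.
    real_eq; change (q * q ^ n + q * q ^ n / (1 - q * q ^ n) ^ 2
       = q * q ^ n * (1 + / (q * q ^ n - 1) ^ 2)).
    field; split; lra.
  - apply (is_series_plus (V := R_NormedModule)).
    + apply (is_series_scal_l q (fun n => q ^ n)); apply is_series_geom.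
      rewrite Rabs_pos_eq; lra.
    + apply Series_correct, ex_series_csch2_even; auto.
Qed.

Theorem is_lim_seq_transported : is_lim_seq (fun j => transported 1 (approach j))
  (PI * (residue_0 + 2 * alpha * (q / (1 - q) + csch2_even (PI * alpha)))).
Proof.
  assert (Hq := q_bounds).
  assert (Hs : forall N, 0 < q ^ S N <= q).
  { intros N; split; [apply pow_lt; lra|].
    assert (q ^ N <= 1) by (rewrite <- (pow1 N); apply pow_incr; lra).
    simpl; nra. }
  destruct transported_small as [M HM].
  assert (HS := is_series_amp_at_1).
  set (total := q / (1 - q) + csch2_even (PI * alpha)) in *.
  set (part := fun N => PI * (residue_0 +
    2 * alpha * (sum_n (fun n => amp_at_1 (q ^ S n)) N - amp_at_1 (q ^ S N)))).
  assert (LP : is_lim_seq part (PI * (residue_0 + 2 * alpha * (total - 0)))).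
  { lim; apply ex_series_lim_0; eexists; exact HS. }
  rewrite Rminus_0_r in LP.
  assert (LM : is_lim_seq (fun N => M * q ^ S N) 0).
  { apply lim_scal0.
    apply (is_lim_seq_incr_1 (fun n => q ^ n)).
    apply lim_geom; lra. }
  (* Three errors of [eps / 3]: the tail of the series of residues, the integral left after all
     translations, and the limit in [j] for the chosen [N]. *)
  apply is_lim_seq_spec; intros eps.
  assert (He : 0 < eps / 3) by (generalize (cond_pos eps); lra).
  apply is_lim_seq_spec in LP; apply is_lim_seq_spec in LM.
  destruct (LP (mkposreal _ He)) as [N1 H1], (LM (mkposreal _ He)) as [N2 H2].
  set (N := (N1 + N2)%nat).
  specialize (H1 N ltac:(unfold N; lia)); specialize (H2 N ltac:(unfold N; lia)).
  assert (LF := transported_finite N); apply is_lim_seq_spec in LF.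
  destruct (LF (mkposreal _ He)) as [J HJ].
  exists J; intros j Hj; specialize (HJ j Hj); cbn [pos] in H1, H2, HJ.
  fold (part N) in HJ.
  specialize (HM (q ^ S N) j (Hs N)).
  apply Rabs_lt_between in H1; apply Rabs_lt_between in H2; apply Rabs_lt_between in HJ.
  apply Rabs_le_between in HM; apply Rabs_lt_between.
  lra.
Qed.

(** * Return to the real integrals *)

Lemma pull_amp_cot_1 (x : R) : 0 <= x < PI / 2 ->
  pull (amp_cot 1) 0 x = 4 * (cos (2 * x) * Re (cot_ker (gam 0 x))).
Proof.
  intros Hx; assert (Hc : 0 < cos x) by (apply cos_gt_0; lra).
  assert (Hn := dom_neq_1 _ (dom_gam 0 x (or_introl eq_refl) Hx)).
  unfold pull, amp_cot, amp.
  set (w := cexp (gam 0 x)) in *.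
  assert (Hw : (w - 1)%C = (cos (2 * x), sin (2 * x))).
  { unfold w; rewrite cexp_gam by auto; rewrite Ropp_0, exp_0.
    apply C_eq; unfold Re, Im; simpl; ring. }
  (* [w - 1 = e^(2 i x)] has modulus 1, so its inverse is its conjugate. With
     [w dz = 2 i e^(2 i x) dx] the weight becomes [2 i (e^(2 i x) + e^(- 2 i x)) dx]. *)
  assert (HI : (/ (w - 1))%C = (cos (2 * x), (- sin (2 * x))%R)).
  { assert (HC : ((w - 1) * (cos (2 * x), (- sin (2 * x))%R))%C = 1).
    { rewrite Hw; generalize (sin_cos_sqr (2 * x)); intros Q.
      apply C_eq; unfold Re, Im; simpl; lra. }
    transitivity (/ (w - 1) * ((w - 1) * (cos (2 * x), (- sin (2 * x))%R)))%C.
    - rewrite HC; ring.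
    - field; auto. }
  replace (1 * w * (1 + / (1 * w - 1) * / (1 * w - 1)) * cot_ker (gam 0 x) * dgam x)%C
    with (w * dgam x * (1 + / (w - 1) * / (w - 1)) * cot_ker (gam 0 x))%C.
  2: { replace (1 * w)%C with w by ring; ring. }
  rewrite HI; unfold w; rewrite cexp_gam_dgam by auto; rewrite Ropp_0, exp_0.
  replace (((- (2 * 1 * sin (2 * x)))%R, (2 * 1 * cos (2 * x))%R) *
    (1 + (cos (2 * x), (- sin (2 * x))%R) * (cos (2 * x), (- sin (2 * x))%R)))%C
    with (0, (4 * cos (2 * x))%R).
  - unfold Im, Re; simpl; ring.
  - assert (Q := sin_cos_sqr (2 * x)).
    set (c := cos (2 * x)) in *; set (s := sin (2 * x)) in *.
    apply C_eq; unfold Re, Im; simpl.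
    + transitivity (- (2 * s) * (1 - (s * s + c * c)))%R; [rewrite Q|]; ring.
    + transitivity (2 * c + 2 * c * (s * s + c * c))%R; [rewrite Q|]; ring.
Qed.

Lemma re_cot_ker (x : R) : 0 <= x < PI / 2 ->
  Re (cot_ker (gam 0 x)) =
  sin (ln (2 * cos x) / alpha) / (cosh (x / alpha) - cos (ln (2 * cos x) / alpha)).
Proof.
  intros Hx.
  assert (Hn := dom_neq_ker _ (dom_gam 0 x (or_introl eq_refl) Hx)).
  apply norm2_neq_0 in Hn.
  unfold cot_ker, coth_half; rewrite ker_arg in *; unfold gam, cexp in *.
  unfold Re, Im, Cminus, Cplus, Copp, Cdiv, Cmult, Cinv, Ci, RtoC in *; simpl fst in *; simpl snd in *.
  rewrite Rminus_0_r in *.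
  replace (- x / alpha) with (- (x / alpha)) in * by (unfold Rdiv; ring).
  unfold cosh; rewrite exp_Ropp in *.
  set (t := ln (2 * cos x) / alpha) in *; set (r := exp (x / alpha)) in *.
  assert (Hr : 0 < r) by apply exp_pos.
  assert (Q := sin_cos_sqr t).
  set (c := cos t) in *; set (s := sin t) in *.
  assert (E : (/ r * c + - (1)) ^ 2 + (/ r * s + - 0) ^ 2 = 2 * / r * ((r + / r) / 2 - c)).
  { transitivity ((/ r) ^ 2 * (s * s + c * c) - 2 * / r * c + 1); [ring|].
    rewrite Q; field; lra. }
  rewrite E in Hn.
  change ((/ r * c + - (1)) * ((/ r * c + - (1)) * 1) + (/ r * s + - 0) * ((/ r * s + - 0) * 1))
    with ((/ r * c + - (1)) ^ 2 + (/ r * s + - 0) ^ 2).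
  rewrite E.
  assert (Hd : (r + / r) / 2 - c <> 0) by (intros Z; apply Hn; rewrite Z; ring).
  set (d := (r + / r) / 2 - c) in *.
  field; split; lra.
Qed.

Theorem is_RInt_cot : is_RInt
  (fun x => cos (2 * x) * sin (ln (2 * cos x) / alpha)
            / (cosh (x / alpha) - cos (ln (2 * cos x) / alpha)))
  0 (PI / 2)
  (5 * PI * alpha / 24 - PI / (24 * alpha) + PI * alpha / (4 * tanh (PI * alpha))
   + PI * alpha / 2 * csch2_even (PI * alpha)).
Proof.
  assert (HP := PI_RGT_0).
  set (g := fun x => / 4 * pull (amp_cot 1) 0 x).
  apply is_RInt_ext with g.
  { intros x Hx; minmax Hx.
    unfold g; rewrite pull_amp_cot_1, re_cot_ker by lra.
    rewrite <- Rmult_assoc, Rinv_l, Rmult_1_l by lra; real_eq; unfold Rdiv; ring. }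
  destruct cot_ker_bounded as [M HM].
  (* The integrand is bounded but oscillates at [PI / 2], so the integral is recovered from the
     truncations at [approach j]. *)
  apply is_RInt_limit_upper with M approach; [lra| | | | |].
  - intros x Hx; apply (continuous_Rmult (T := R_UniformSpace)); [apply continuous_const|].
    apply ccont_pull; [lra|].
    apply hol_on_ccont with dom; [now apply hol_on_amp_cot; auto|].
    apply dom_gam; auto.
  - intros x Hx; unfold g; rewrite pull_amp_cot_1 by lra.
    replace (/ 4 * (4 * (cos (2 * x) * Re (cot_ker (gam 0 x)))))
      with (cos (2 * x) * Re (cot_ker (gam 0 x))) by field.
    rewrite Rabs_mult.
    assert (Rabs (cos (2 * x)) <= 1) by (apply Rabs_le, COS_bound).
    assert (B := re_le_Cmod (cot_ker (gam 0 x))); specialize (HM x Hx).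
    assert (P := Rabs_pos (Re (cot_ker (gam 0 x)))).
    assert (P2 := Rabs_pos (cos (2 * x))); nra.
  - intros n; destruct (approach_bounds n); lra.
  - apply is_lim_seq_approach.
  - assert (L := is_lim_seq_transported).
    assert (E : / 4 * (PI * (residue_0 + 2 * alpha *
        (exp (- (2 * PI * alpha)) / (1 - exp (- (2 * PI * alpha))) + csch2_even (PI * alpha))))
      = 5 * PI * alpha / 24 - PI / (24 * alpha) + PI * alpha / (4 * tanh (PI * alpha))
        + PI * alpha / 2 * csch2_even (PI * alpha)).
    { assert (Hh : 0 < PI * alpha) by (apply Rmult_lt_0_compat; lra).
      assert (Hs := sinh_pos _ Hh); assert (Hc := cosh_ge_1 (PI * alpha)).
      (* The geometric series [q / (1 - q)] is [(coth h - 1) / 2]. It yields the term in [tanh] and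
         lowers the coefficient of [PI * alpha] from [11 / 24] to [5 / 24]. *)
      assert (Eq : exp (- (2 * PI * alpha)) / (1 - exp (- (2 * PI * alpha)))
         = (/ tanh (PI * alpha) - 1) / 2).
      { unfold tanh, sinh, cosh in *; rewrite !exp_Ropp in *.
        replace (2 * PI * alpha) with (PI * alpha + PI * alpha) by ring; rewrite exp_plus.
        assert (He := exp_pos (PI * alpha)); set (e := exp (PI * alpha)) in *.
        assert (e * (e - / e) = e * e - 1) by (field; lra).
        assert (0 < e * e - 1) by (rewrite <- H; apply Rmult_lt_0_compat; lra).
        field; repeat split; nra. }
      rewrite Eq; unfold residue_0.
      assert (Ht : tanh (PI * alpha) <> 0).
      { unfold tanh; apply Rgt_not_eq, Rdiv_lt_0_compat; lra. }
      field; split; lra. }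
    rewrite <- E.
    apply is_lim_seq_ext with (fun j => / 4 * transported 1 (approach j)).
    + intros j; unfold g, transported; symmetry.
      destruct (approach_bounds j) as [H1 _].
      apply (RInt_scal (V := R_CompleteNormedModule)).
      apply (ex_RInt_pull_dom); [|auto|lra].
      now apply hol_on_amp_cot; auto.
    + apply is_lim_seq_mult'; [apply is_lim_seq_const | exact L].
Qed.

End Kernel.

(** The first integral at [alpha] minus twice that at [alpha / 2], whence the stronger condition on
    [alpha]. The sums combine through [csch2_even (h / 2) = csch2_even h + csch2_odd h], and the
    hyperbolic terms through [coth (h / 2) = coth h + 1 / sinh h]. *)
Theorem is_RInt_tan (alpha : R) : 0 < alpha -> ln 2 < PI * alpha -> is_RInt
  (fun x => cos (2 * x) * sin (ln (2 * cos x) / alpha)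
            / (cosh (x / alpha) + cos (ln (2 * cos x) / alpha)))
  0 (PI / 2)
  (PI / (8 * alpha) - PI * alpha / (4 * sinh (PI * alpha))
   - PI * alpha / 2 * csch2_odd (PI * alpha)).
Proof.
  intros Ha Hl; assert (HP := PI_RGT_0); assert (L2 := ln_2_pos).
  assert (I1 := is_RInt_cot alpha Ha ltac:(lra)).
  assert (I2 := is_RInt_cot (alpha / 2) ltac:(lra) ltac:(lra)).
  assert (I := is_RInt_minus (V := R_NormedModule) _ _ _ _ _ _ I1
    (is_RInt_scal (V := R_NormedModule) _ _ _ 2 _ I2)).
  assert (Hh : 0 < PI * alpha) by nra.
  match type of I with is_RInt _ _ _ ?l =>
    replace (PI / (8 * alpha) - PI * alpha / (4 * sinh (PI * alpha))
      - PI * alpha / 2 * csch2_odd (PI * alpha)) with l end.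
  - apply is_RInt_ext with (2 := I); intros x Hx; minmax Hx.
    change (cos (2 * x) * sin (ln (2 * cos x) / alpha)
        / (cosh (x / alpha) - cos (ln (2 * cos x) / alpha))
      - 2 * (cos (2 * x) * sin (ln (2 * cos x) / (alpha / 2))
        / (cosh (x / (alpha / 2)) - cos (ln (2 * cos x) / (alpha / 2))))
      = cos (2 * x) * sin (ln (2 * cos x) / alpha)
        / (cosh (x / alpha) + cos (ln (2 * cos x) / alpha))).
    set (u := ln (2 * cos x)).
    replace (u / (alpha / 2)) with (2 * (u / alpha)) by (field; lra).
    replace (x / (alpha / 2)) with (2 * (x / alpha)) by (field; lra).
    assert (Hx1 : 0 < x / alpha) by (apply Rdiv_lt_0_compat; lra).
    (* Strict because [x > 0]; hence neither [C - c] nor [C + c] vanishes. At [x = 0] the first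
       could, but only interior points have to be compared. *)
    assert (Hc : 1 < cosh (x / alpha)).
    { replace (x / alpha) with (2 * (x / alpha / 2)) by (field; lra); rewrite cosh_double.
      assert (0 < sinh (x / alpha / 2)) by (apply sinh_pos; lra).
      assert (0 < sinh (x / alpha / 2) ^ 2) by (now apply pow_lt); lra. }
    assert (Hcos := COS_bound (u / alpha)).
    assert (Hch : cosh (2 * (x / alpha)) = 2 * cosh (x / alpha) ^ 2 - 1).
    { generalize (x / alpha); intros y; unfold cosh; replace (2 * y) with (y + y) by ring.
      rewrite !exp_Ropp, !exp_plus; field; apply Rgt_not_eq, exp_pos. }
    rewrite (sin_2a (u / alpha)), (cos_2a_cos (u / alpha)), Hch.
    set (C := cosh (x / alpha)) in *; set (c := cos (u / alpha)) in *.
    replace (2 * C ^ 2 - 1 - (2 * c * c - 1)) with (2 * ((C - c) * (C + c))) by ring.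
    field; lra.
  - unfold minus, plus, opp, scal; simpl; unfold mult; simpl.
    assert (E := csch2_even_double (PI * (alpha / 2)) ltac:(lra)).
    replace (2 * (PI * (alpha / 2))) with (PI * alpha) in E by field.
    rewrite E.
    assert (Hs2 : 0 < sinh (PI * (alpha / 2))) by (apply sinh_pos; lra).
    assert (Hc2 := cosh_ge_1 (PI * (alpha / 2))).
    assert (Et : / tanh (PI * (alpha / 2)) = / tanh (PI * alpha) + / sinh (PI * alpha)).
    { replace (PI * alpha) with (2 * (PI * (alpha / 2))) by field.
      unfold tanh; rewrite sinh_double, cosh_double.
      assert (Q : cosh (PI * (alpha / 2)) ^ 2 = 1 + sinh (PI * (alpha / 2)) ^ 2).
      { unfold cosh, sinh; rewrite !exp_Ropp; field; apply Rgt_not_eq, exp_pos. }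
      set (S := sinh (PI * (alpha / 2))) in *; set (C := cosh (PI * (alpha / 2))) in *.
      transitivity (C ^ 2 / (S * C)); [field; lra|].
      assert (0 < S ^ 2) by (now apply pow_lt).
      rewrite Q; field; repeat split; lra. }
    assert (Ht : forall t, 0 < t -> tanh t <> 0).
    { intros t Hpos; unfold tanh; apply Rgt_not_eq, Rdiv_lt_0_compat;
        [now apply sinh_pos | generalize (cosh_ge_1 t); lra]. }
    assert (T1 := Ht _ Hh); assert (T2 := Ht (PI * (alpha / 2)) ltac:(lra)).
    assert (Hs := sinh_pos _ Hh).
    replace (PI * (alpha / 2) / (4 * tanh (PI * (alpha / 2))))
      with (PI * (alpha / 2) / 4 * / tanh (PI * (alpha / 2))) by (field; auto).
    rewrite Et; field; repeat split; lra.
Qed.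

Theorem theorem4 (alpha k : R) (halpha : 0 < alpha) (hk : 0 < k < 1)
    (hmod : ellK (compl_modulus k) / ellK k = alpha) :
  (alpha > ln 2 / (2 * PI) ->
   is_RInt
     (fun x => cos (2 * x) * sin (ln (2 * cos x) / alpha)
               / (cosh (x / alpha) - cos (ln (2 * cos x) / alpha)))
     0 (PI / 2)
     (11 * PI * alpha / 48 - PI / (24 * alpha)
      + PI * alpha / (4 * tanh (PI * alpha))
      - alpha / (4 * PI) * (ellE k - (2 - k ^ 2) / 3 * ellK k) * ellK k))
  /\
  (alpha > ln 2 / PI ->
   is_RInt
     (fun x => cos (2 * x) * sin (ln (2 * cos x) / alpha)
               / (cosh (x / alpha) + cos (ln (2 * cos x) / alpha)))
     0 (PI / 2)
     (PI / (8 * alpha) - PI * alpha / (4 * sinh (PI * alpha))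
      + alpha / (4 * PI) * (ellE k - ellK k) * ellK k)).
Proof.
  assert (HP := PI_RGT_0).
  assert (Hh : 0 < PI * alpha) by (apply Rmult_lt_0_compat; lra).
  assert (Hm : ellK (compl_modulus k) / ellK k = PI * alpha / PI)
    by (rewrite hmod; field; lra).
  split; intros Hl.
  - assert (Hp : ln 2 < 2 * PI * alpha).
    { apply Rmult_lt_reg_r with (/ (2 * PI)); [apply Rinv_0_lt_compat; lra|].
      replace (2 * PI * alpha * / (2 * PI)) with alpha by (field; lra); exact Hl. }
    assert (I := is_RInt_cot alpha halpha Hp).
    rewrite (csch2_even_ell _ k Hh hk Hm) in I.
    match type of I with is_RInt _ _ _ ?l => match goal with |- is_RInt _ _ _ ?r =>
      replace r with l; [exact I|] end end.
    assert (tanh (PI * alpha) <> 0).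
    { unfold tanh; apply Rgt_not_eq, Rdiv_lt_0_compat;
        [now apply sinh_pos | generalize (cosh_ge_1 (PI * alpha)); lra]. }
    field; repeat split; lra.
  - assert (Hp : ln 2 < PI * alpha).
    { apply Rmult_lt_reg_r with (/ PI); [now apply Rinv_0_lt_compat|].
      replace (PI * alpha * / PI) with alpha by (field; lra); exact Hl. }
    assert (I := is_RInt_tan alpha halpha Hp).
    rewrite (csch2_odd_ell _ k Hh hk Hm) in I.
    match type of I with is_RInt _ _ _ ?l => match goal with |- is_RInt _ _ _ ?r =>
      replace r with l; [exact I|] end end.
    assert (0 < sinh (PI * alpha)) by now apply sinh_pos.
    field; repeat split; lra.
Qed.
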